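(* Let $m\ge 1$, $n\ge 1$ be integers and let $\mathcal M(R,F)$ be a quantum matrix algebra of $GL(m|n)$ type, i.e. $\{R,F\}$ is a compatible pair of strictly skew-invertible R-matrices with $R_f=F^{-1}R^{-1}F$ skew-invertible, and $R$ is a Hecke R-matrix of $GL(m|n)$ type. Let $M=\|M_i^j\|_{i,j=1}^N$ be the matrix of generators of $\mathcal M(R,F)$. Then the following identity holds in $\mathrm{Mat}_N(\mathcal M(R,F))$: $$\sum_{i=0}^{m+n} M^{\overline{m+n-i}}\sum_{k=\max\{0,i-n\}}^{\min\{i,m\}}(-1)^k q^{2k-i}\, s_{\Lambda(k,i-k)}(M)\;=\;0,$$ where $\Lambda(k,l)=\left((n+1)^k,n^{m-k},l\right)$ is the partition with $k$ parts equal to $n+1$, followed by $m-k$ parts equal to $n$, followed by one part equal to $l$ (for $0\le k\le m$, $0\le l\le n$), $M^{\overline{j}}$ are the powers of the quantum matrix $M$, and $s_\lambda(M)$ are the Schur functions.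
   Context: **Scalars and Hecke algebras.** The ground field is $\mathbb C$. Fix $q\in\mathbb C\setminus\{0\}$ with $k_q:=\frac{q^k-q^{-k}}{q-q^{-1}}\ne0$ for all integers $k\ge 1$ (with $k_q=q^{k-1}+q^{k-3}+\dots+q^{1-k}$, so that $q=\pm1$ is understood as a limit). The Hecke algebra $\mathcal H_k(q)$ is the unital associative algebra with generators $\sigma_1,\dots,\sigma_{k-1}$ and relations $\sigma_i\sigma_{i+1}\sigma_i=\sigma_{i+1}\sigma_i\sigma_{i+1}$, $\sigma_i\sigma_j=\sigma_j\sigma_i$ for $|i-j|\ge2$, $\sigma_i^2=1+(q-q^{-1})\sigma_i$. It is isomorphic to $\bigoplus_{\lambda\vdash k}\mathrm{Mat}_{d_\lambda}(\mathbb C)$, where $d_\lambda$ is the number of standard Young tableaux of shape $\lambda$. Partitions are identified with Young diagrams (parts are row lengths, zero parts are dropped), and the content of the node in row $r$ and column $s$ is $s-r$. For a standard tableau $\alpha$ of shape $\lambda\vdash k$, $E^\lambda_\alpha\in\mathcal H_k(q)$ denotes the corresponding diagonal matrix unit (a primitive idempotent). These are normalized as follows, for the chain of embeddings $\mathcal H_{j}(q)\hookrightarrow\mathcal H_{j+1}(q)$, $\sigma_i\mapsto\sigma_{i+1}$: put $y_1=0$, $y_{j+1}=\sigma_{k-j}\,y_j\,\sigma_{k-j}+\sigma_{k-j}$ for $1\le j\le k-1$; then $E^\lambda_\alpha$ is the unique nonzero idempotent with $y_jE^\lambda_\alpha=E^\lambda_\alpha y_j=q^{c(j)}c(j)_q\,E^\lambda_\alpha$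 for all $1\le j\le k$, where $c(j)$ is the content of the node of $\alpha$ containing $j$. (Thus $E^{(2)}=(\sigma_1+q^{-1})/2_q$ and $E^{(1,1)}=(q-\sigma_1)/2_q$, and the image of $E^\lambda_\alpha$ in $\mathcal H_{k'}(q)$, $k'\ge k$, under the composition of the embeddings $\mathcal H_{j}(q)\hookrightarrow\mathcal H_{j+1}(q)$, $\sigma_i\mapsto\sigma_{i+1}$, for $k\le j<k'$, is the sum of the $E^\mu_\beta$ over all standard tableaux $\beta$ of shape $\mu\vdash k'$ in which the numbers $1,\dots,k$ occupy the same nodes as in $\alpha$.) For $k=1$, $\mathcal H_1(q)=\mathbb C$ and $E^{(1)}=1$. **R-matrices.** Let $V$ be a complex vector space of dimension $N$ with a fixed basis $\{v_i\}$. For $X\in\mathrm{End}(V^{\otimes p})$, $X_i$ denotes $\mathrm{Id}^{\otimes(i-1)}\otimes X\otimes\mathrm{Id}^{\otimes(k-p-i+1)}$ acting on $V^{\otimes k}$. An operator $R\in\mathrm{Aut}(V^{\otimes2})$ with $R_1R_2R_1=R_2R_1R_2$ is an R-matrix. It is a Hecke R-matrix if $(R-q\,\mathrm{Id})(R+q^{-1}\mathrm{Id})=0$; then $\rho_R(\sigma_i)=R_i$ defines representations $\rho_R:\mathcal H_k(q)\to\mathrm{End}(V^{\otimes k})$. A Hecke R-matrix $R$ is of $GL(m|n)$ type if $\rho_R$ is faithful on $\mathcal H_k(q)$ for all $2\le k<(m+1)(n+1)$, while on $\mathcal H_{(m+1)(n+1)}(q)$ its kernel is generated by any matrix unit corresponding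 to the rectangular diagram with $m+1$ rows of length $n+1$; i.e. $\rho_R(E_\alpha^{((n+1)^{m+1})})=0$ and $\rho_R(E^\mu_\alpha)\neq0$ for every $\mu\vdash(m+1)(n+1)$, $\mu\ne((n+1)^{m+1})$. For $X\in\mathrm{End}(V^{\otimes2})$ write $X(v_i\otimes v_j)=\sum_{k,l}X_{ij}^{kl}v_k\otimes v_l$. $X$ is skew-invertible if there is $\Psi^X\in\mathrm{End}(V^{\otimes 2})$ with $\sum_{a,b}X_{ia}^{kb}(\Psi^X)_{bj}^{al}=\delta_i^l\delta_j^k$. Put $D^X=\mathrm{Tr}_{(2)}\Psi^X\in\mathrm{End}(V)$ (trace over the second tensor factor); $X$ is strictly skew-invertible if in addition $D^X$ is invertible. For skew-invertible $R$ and an $N\times N$ matrix $Y$ with entries in a vector space, the R-trace is $\mathrm{Tr}_R(Y)=\sum_{i,j}(D^R)_i^jY_j^i$; $\mathrm{Tr}_{R^{(a\dots b)}}$ denotes the R-trace taken over the tensor factors $a,a+1,\dots,b$ of $V^{\otimes k}$. A pair $\{R,F\}$ of R-matrices is compatible if $R_1F_2F_1=F_2F_1R_2$ and $R_2F_1F_2=F_1F_2R_1$. **Quantum matrix algebra.** Let $\{R,F\}$ be a compatible pair of strictly skew-invertible R-matrices such that $R_f=F^{-1}R^{-1}F$ is skew-invertible. For a matrix $M=\|M_i^j\|$ with entries in an algebra put $M_{\overline1}=M\otimes\mathrm{Id}\otimes\cdots\otimes\mathrm{Id}$ and $M_{\overline{j+1}}=F_jM_{\overline j}F_j^{-1}$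 (matrices over $V^{\otimes k}$ with entries in the algebra; they are multiplied by $(XY)_i^j=\sum_aX_i^aY_a^j$, and operators on $V^{\otimes k}$ are treated as matrices with scalar entries). $\mathcal M(R,F)$ is the unital associative algebra generated by the $N^2$ elements $M_i^j$ subject to the entries of the matrix relation $R_1M_{\overline1}M_{\overline2}=M_{\overline1}M_{\overline2}R_1$. **Powers and Schur functions.** $M^{\overline0}=\mathrm{Id}_V$, $M^{\overline1}=M$, and $M^{\overline k}=\mathrm{Tr}_{R^{(2\dots k)}}(M_{\overline1}\cdots M_{\overline k}R_{k-1}\cdots R_1)$ for $k\ge2$. The Schur functions are $s_0(M)=s_\emptyset(M)=1$ and $s_\lambda(M)=\mathrm{Tr}_{R^{(1\dots k)}}(M_{\overline1}\cdots M_{\overline k}\,\rho_R(E^\lambda_\alpha))\in\mathcal M(R,F)$ for $\lambda\vdash k\ge1$; this does not depend on the choice of the standard tableau $\alpha$ of shape $\lambda$. A matrix times an element of $\mathcal M(R,F)$ on its right means entrywise right multiplication. *)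

(* Defs.v *)
From HB Require Import structures.
From mathcomp Require Import all_boot all_order all_algebra.
From mathcomp Require Import generic_quotient finmap.
From mathcomp Require Import boolp classical_sets.
From mathcomp Require Import complex.
From mathcomp Require Import reals.
From mathcomp.multinomials Require Import monalg.

Set Implicit Arguments.
Unset Strict Implicit.
Unset Printing Implicit Defensive.

Import Order.TTheory GRing.Theory Num.Theory.
Local Open Scope ring_scope.
Local Open Scope quotient_scope.

Section QuotientAlgebra.
Variables (K : fieldType) (A : algType K) (S : set A).

Inductive ideal_gen : A -> Prop :=
| IdealGen x of S x : ideal_gen x
| Ideal0 : ideal_gen 0
| IdealD x y of ideal_gen x & ideal_gen y : ideal_gen (x + y)
| IdealMl a x of ideal_gen x : ideal_gen (a * x)
| IdealMr a x of ideal_gen x : ideal_gen (x * a).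

Lemma ideal_genN x : ideal_gen x -> ideal_gen (- x).
Proof. by move=> /(IdealMl (-1)); rewrite mulN1r. Qed.

Lemma ideal_genZ c x : ideal_gen x -> ideal_gen (c *: x).
Proof. by move=> /(IdealMl c%:A); rewrite mulr_algl. Qed.

Definition quot_eq (x y : A) : bool := `[< ideal_gen (x - y) >].

Lemma quot_eq_equiv : equiv_class_of quot_eq.
Proof.
split=> [x|x y|y x z].
- by apply/asboolP; rewrite subrr; exact: Ideal0.
- by apply/asboolP/asboolP => /ideal_genN; rewrite opprB.
- move=> /asboolP xy /asboolP yz; apply/asboolP.
  by rewrite -(subrKA y); exact: IdealD.
Qed.
Canonical quot_eq_equiv_rel := EquivRelPack quot_eq_equiv.

(* Only quotients by proper ideals are formed: the unital algebras of the
   library are non-trivial, so the properness proof is part of the type. *)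
Definition quot_alg of ~ ideal_gen 1 : Type := {eq_quot quot_eq}.

Hypothesis S_proper : ~ ideal_gen 1.
Local Notation Q := (quot_alg S_proper).
HB.instance Definition _ := Choice.on Q.
HB.instance Definition _ := EqQuotient.on Q.

Definition quot_pi (x : A) : Q := \pi_Q x.

Lemma quot_piP x y : quot_pi x = quot_pi y <-> ideal_gen (x - y).
Proof.
split=> [/eqP|h]; first by rewrite /quot_pi eqmodE => /asboolP.
by apply/eqP; rewrite /quot_pi eqmodE; apply/asboolP.
Qed.

Lemma quot_reprK (x : Q) : quot_pi (repr x) = x.
Proof. exact: reprK. Qed.

Lemma repr_quot_pi x : ideal_gen (repr (quot_pi x) - x).
Proof. by apply/quot_piP; rewrite quot_reprK. Qed.

Definition quot_add (x y : Q) : Q := quot_pi (repr x + repr y).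
Definition quot_opp (x : Q) : Q := quot_pi (- repr x).
Definition quot_mul (x y : Q) : Q := quot_pi (repr x * repr y).
Definition quot_scale c (x : Q) : Q := quot_pi (c *: repr x).

Lemma quot_piD x y : quot_pi (x + y) = quot_add (quot_pi x) (quot_pi y).
Proof.
apply/esym/quot_piP; rewrite opprD addrACA.
by apply: IdealD; exact: repr_quot_pi.
Qed.

Lemma quot_piN x : quot_pi (- x) = quot_opp (quot_pi x).
Proof.
by apply/esym/quot_piP; rewrite -opprD; exact/ideal_genN/repr_quot_pi.
Qed.

Lemma quot_piM x y : quot_pi (x * y) = quot_mul (quot_pi x) (quot_pi y).
Proof.
apply/esym/quot_piP.
set x' := repr _; set y' := repr _.
have -> : x' * y' - x * y = (x' - x) * y' + x * (y' - y).
  by rewrite mulrBl mulrBr addrA subrK.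
by apply: IdealD; [apply: IdealMr|apply: IdealMl]; exact: repr_quot_pi.
Qed.

Lemma quot_piZ c x : quot_pi (c *: x) = quot_scale c (quot_pi x).
Proof.
by apply/esym/quot_piP; rewrite -scalerBr; exact/ideal_genZ/repr_quot_pi.
Qed.

Lemma quot_ind (P : Q -> Prop) :
  (forall x, P (quot_pi x)) -> forall x, P x.
Proof. by move=> h x; rewrite -(quot_reprK x). Qed.

Fact quot_addA : associative quot_add.
Proof.
by elim/quot_ind=> x; elim/quot_ind=> y; elim/quot_ind=> z; rewrite -!quot_piD addrA.
Qed.
Fact quot_addC : commutative quot_add.
Proof. by elim/quot_ind=> x; elim/quot_ind=> y; rewrite -!quot_piD addrC. Qed.
Fact quot_add0 : left_id (quot_pi 0) quot_add.
Proof. by elim/quot_ind=> x; rewrite -quot_piD add0r. Qed.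
Fact quot_addN : left_inverse (quot_pi 0) quot_opp quot_add.
Proof. by elim/quot_ind=> x; rewrite -quot_piN -quot_piD addNr. Qed.
HB.instance Definition _ :=
  GRing.isZmodule.Build Q quot_addA quot_addC quot_add0 quot_addN.

Fact quot_mulA : associative quot_mul.
Proof.
by elim/quot_ind=> x; elim/quot_ind=> y; elim/quot_ind=> z; rewrite -!quot_piM mulrA.
Qed.
Fact quot_mul1 : left_id (quot_pi 1) quot_mul.
Proof. by elim/quot_ind=> x; rewrite -quot_piM mul1r. Qed.
Fact quot_mulr1 : right_id (quot_pi 1) quot_mul.
Proof. by elim/quot_ind=> x; rewrite -quot_piM mulr1. Qed.
Fact quot_mulDl : left_distributive quot_mul quot_add.
Proof.
elim/quot_ind=> x; elim/quot_ind=> y; elim/quot_ind=> z.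
by rewrite -quot_piD -!quot_piM -quot_piD mulrDl.
Qed.
Fact quot_mulDr : right_distributive quot_mul quot_add.
Proof.
elim/quot_ind=> x; elim/quot_ind=> y; elim/quot_ind=> z.
by rewrite -quot_piD -!quot_piM -quot_piD mulrDr.
Qed.
HB.instance Definition _ := GRing.Zmodule_isPzRing.Build Q
  quot_mulA quot_mul1 quot_mulr1 quot_mulDl quot_mulDr.

Fact quot_1neq0 : quot_pi 1 != quot_pi 0.
Proof. by apply/eqP => /quot_piP; rewrite subr0. Qed.
HB.instance Definition _ := GRing.PzSemiRing_isNonZero.Build Q quot_1neq0.

Fact quot_pi_zmod_morphism : zmod_morphism quot_pi.
Proof. by move=> x y; rewrite quot_piD quot_piN. Qed.
HB.instance Definition _ :=
  GRing.isZmodMorphism.Build A Q quot_pi quot_pi_zmod_morphism.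
Fact quot_pi_monoid_morphism : monoid_morphism quot_pi.
Proof. by split=> [|x y]; rewrite ?quot_piM. Qed.
HB.instance Definition _ :=
  GRing.isMonoidMorphism.Build A Q quot_pi quot_pi_monoid_morphism.

Fact quot_scaleA a b x : quot_scale a (quot_scale b x) = quot_scale (a * b) x.
Proof. by elim/quot_ind: x => x; rewrite -!quot_piZ scalerA. Qed.
Fact quot_scale1 : left_id 1 quot_scale.
Proof. by elim/quot_ind=> x; rewrite -quot_piZ scale1r. Qed.
Fact quot_scaleDr : right_distributive quot_scale +%R.
Proof.
move=> c; elim/quot_ind=> x; elim/quot_ind=> y.
by rewrite -raddfD -!quot_piZ scalerDr raddfD.
Qed.
Fact quot_scaleDl x : {morph quot_scale^~ x : a b / a + b}.
Proof.
by move=> a b; elim/quot_ind: x => x; rewrite -!quot_piZ scalerDl raddfD.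
Qed.
HB.instance Definition _ := GRing.Zmodule_isLmodule.Build K Q
  quot_scaleA quot_scale1 quot_scaleDr quot_scaleDl.

Fact quot_pi_scalable : scalable quot_pi.
Proof. exact: quot_piZ. Qed.
HB.instance Definition _ :=
  GRing.isScalable.Build K A Q *:%R quot_pi quot_pi_scalable.

Fact quot_scaleAl a (x y : Q) : a *: (x * y) = a *: x * y.
Proof.
elim/quot_ind: x => x; elim/quot_ind: y => y.
by rewrite -rmorphM -!linearZ -rmorphM scalerAl.
Qed.
HB.instance Definition _ := GRing.LSemiModule_isLSemiAlgebra.Build K Q
  quot_scaleAl.

Fact quot_scaleAr a (x y : Q) : a *: (x * y) = x * (a *: y).
Proof.
elim/quot_ind: x => x; elim/quot_ind: y => y.
by rewrite -rmorphM -!linearZ -rmorphM scalerAr.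
Qed.
HB.instance Definition _ := GRing.Lalgebra_isAlgebra.Build K Q
  quot_scaleAr.

End QuotientAlgebra.

Lemma malg_scaleAr (K : fieldType) (T : monomType) a (x y : {malg K[T]}) :
  a *: (x * y) = x * (a *: y).
Proof.
apply/malgP => w; rewrite mcoeffZ (mcoeffMl x y w).
rewrite (@mcoeffMlw _ _ _ _ x (a *: y) w (fsubset_refl _) (msuppZ_le a y)).
rewrite mulr_sumr; apply: eq_bigr => u _.
rewrite mulr_sumr; apply: eq_bigr => v _.
by rewrite mcoeffZ mulrnAr mulrCA.
Qed.

Fact free_key : unit. Proof. by []. Qed.

(* The free algebra on I. Its operations are those of the monoid algebra, locked
   to keep conversion from unfolding them into finitely supported sums. *)
Definition free_alg (K : fieldType) (I : choiceType) : Type :=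
  {malg K[{fmonom I}]}.

Section FreeAlgebra.
Variables (K : fieldType) (I : choiceType).
Local Notation T := (free_alg K I).
Local Notation MT := {malg K[{fmonom I}]}.

Definition free_add : T -> T -> T := locked_with free_key (@GRing.add MT).
Definition free_opp : T -> T := locked_with free_key (@GRing.opp MT).
Definition free_mul : T -> T -> T := locked_with free_key (@GRing.mul MT).
Definition free_scale : K -> T -> T := locked_with free_key (@GRing.scale K MT).
Definition free_zero : T := locked_with free_key (0 : MT).
Definition free_one : T := locked_with free_key (1 : MT).
Definition free_gen (i : I) : T := locked_with free_key (<< fmu i >> : MT).

Lemma free_addE (x y : T) : free_add x y = ((x : MT) + (y : MT) : MT).
Proof. by rewrite /free_add unlock. Qed.
Lemma free_oppE (x : T) : free_opp x = (- (x : MT) : MT).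
Proof. by rewrite /free_opp unlock. Qed.
Lemma free_mulE (x y : T) : free_mul x y = ((x : MT) * (y : MT) : MT).
Proof. by rewrite /free_mul unlock. Qed.
Lemma free_scaleE a (x : T) : free_scale a x = (a *: (x : MT) : MT).
Proof. by rewrite /free_scale unlock. Qed.
Lemma free_zeroE : free_zero = (0 : MT).
Proof. by rewrite /free_zero unlock. Qed.
Lemma free_oneE : free_one = (1 : MT).
Proof. by rewrite /free_one unlock. Qed.
Lemma free_genE i : free_gen i = (<< fmu i >> : MT).
Proof. by rewrite /free_gen unlock. Qed.
Local Definition freeE :=
  (free_addE, free_oppE, free_mulE, free_scaleE, free_zeroE, free_oneE).

HB.instance Definition _ := Choice.on T.

Fact free_addA : associative free_add.
Proof. by move=> x y z; rewrite !freeE (@addrA MT). Qed.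
Fact free_addC : commutative free_add.
Proof. by move=> x y; rewrite !freeE (@addrC MT). Qed.
Fact free_add0 : left_id free_zero free_add.
Proof. by move=> x; rewrite !freeE (@add0r MT). Qed.
Fact free_addN : left_inverse free_zero free_opp free_add.
Proof. by move=> x; rewrite !freeE (@addNr MT). Qed.
HB.instance Definition _ :=
  GRing.isZmodule.Build T free_addA free_addC free_add0 free_addN.

Fact free_mulA : associative free_mul.
Proof. by move=> x y z; rewrite !freeE (@mulrA MT). Qed.
Fact free_mul1 : left_id free_one free_mul.
Proof. by move=> x; rewrite !freeE (@mul1r MT). Qed.
Fact free_mulr1 : right_id free_one free_mul.
Proof. by move=> x; rewrite !freeE (@mulr1 MT). Qed.
Fact free_mulDl : left_distributive free_mul free_add.
Proof. by move=> x y z; rewrite !freeE (@mulrDl MT). Qed.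
Fact free_mulDr : right_distributive free_mul free_add.
Proof. by move=> x y z; rewrite !freeE (@mulrDr MT). Qed.
Fact free_1neq0 : free_one != free_zero.
Proof. by rewrite !freeE; exact: (@oner_neq0 MT). Qed.
HB.instance Definition _ := GRing.Zmodule_isNzRing.Build T
  free_mulA free_mul1 free_mulr1 free_mulDl free_mulDr free_1neq0.

Fact free_scaleA a b x : free_scale a (free_scale b x) = free_scale (a * b) x.
Proof. by rewrite !freeE (@scalerA K MT). Qed.
Fact free_scale1 : left_id 1 free_scale.
Proof. by move=> x; rewrite !freeE (@scale1r K MT). Qed.
Fact free_scaleDr : right_distributive free_scale free_add.
Proof. by move=> a x y; rewrite !freeE (@scalerDr K MT). Qed.
Fact free_scaleDl x a b :
  free_scale (a + b) x = free_add (free_scale a x) (free_scale b x).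
Proof. by rewrite !freeE (@scalerDl K MT). Qed.
HB.instance Definition _ := GRing.Zmodule_isLmodule.Build K T
  free_scaleA free_scale1 free_scaleDr (fun x a b => free_scaleDl x a b).

Fact free_scaleAl a x y : free_scale a (free_mul x y) = free_mul (free_scale a x) y.
Proof. by rewrite !freeE (@scalerAl K MT). Qed.
HB.instance Definition _ := GRing.Lmodule_isLalgebra.Build K T free_scaleAl.

Fact free_scaleAr a x y : free_scale a (free_mul x y) = free_mul x (free_scale a y).
Proof. by rewrite !freeE malg_scaleAr. Qed.
HB.instance Definition _ := GRing.Lalgebra_isAlgebra.Build K T free_scaleAr.

(* Value of x under the algebra morphism sending the generator i to f i. *)
Definition free_eval (d : nat) (f : I -> 'M[K]_d) (x : free_alg K I) : 'M[K]_d :=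
  \sum_(w <- msupp (x : MT)) (x : MT)@_w *: \prod_(i <- w) f i.

Lemma free_character (c : K) : exists phi : {rmorphism free_alg K I -> K},
  (forall i, phi (free_gen i) = c) /\ (forall a x, phi (a *: x) = a * phi x).
Proof.
pose h (w : {fmonom I}) : K := c ^+ fdeg w.
have hM : mmorphism h.
  by split=> [x y|]; rewrite /h ?fdeg1 ?expr0 // fdegM exprD.
pose hm : {mmorphism {fmonom I} -> K} :=
  HB.pack h (isMultiplicative.Build _ _ h hM).
pose f : T -> K := mmap idfun hm.
have fB : zmod_morphism f.
  by move=> x y; rewrite -[x - y]/(free_add x (free_opp y)) !freeE; exact: mmapB.
have fM : monoid_morphism f.
  split; first by rewrite -[1]/free_one freeE; exact: mmap1.
  by move=> x y; rewrite -[x * y]/(free_mul x y) freeE; exact: (rmorphM (mmap _ _)).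
pose phi : {rmorphism T -> K} := HB.pack f
  (GRing.isZmodMorphism.Build _ _ f fB) (GRing.isMonoidMorphism.Build _ _ f fM).
exists phi; split=> [i|a x] /=.
  by rewrite /phi /= /f free_genE mmapU mul1r /= /h fdegU expr1.
by rewrite -[a *: x]/(free_scale a x) freeE /phi /=; exact: mmapZ.
Qed.

End FreeAlgebra.


Lemma ideal_gen_proper (K : fieldType) (A : algType K) (S : set A)
    (phi : {rmorphism A -> K}) :
  (forall x, S x -> phi x = 0) -> ~ ideal_gen S 1.
Proof.
move=> phiS; suff h x : ideal_gen S x -> phi x = 0.
  by move=> /h/eqP; rewrite rmorph1 oner_eq0.
elim=> [{}x /phiS //||y z _ hy _ hz|a y _ hy|a y _ hy].
- by rewrite rmorph0.
- by rewrite rmorphD hy hz addr0.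
- by rewrite rmorphM hy mulr0.
- by rewrite rmorphM hy mul0r.
Qed.

Section Hecke.
Variables (C : fieldType) (q : C) (k : nat).

(* The generator sigma_a, 1 <= a <= k - 1, is [free_gen i] with i = a - 1. *)
Definition hecke_rel : set (free_alg C 'I_k.-1) := fun x =>
  let s := @free_gen C 'I_k.-1 in
  [\/ exists i j : 'I_k.-1, j = i.+1 :> nat /\
        x = s i * s j * s i - s j * s i * s j,
      exists i j : 'I_k.-1, (i.+1 < j)%N /\ x = s i * s j - s j * s i
    | exists i : 'I_k.-1, x = s i * s i - (1 + (q - q^-1) *: s i)].

Lemma hecke_proper : ~ ideal_gen hecke_rel 1.
Proof.
pose a : C := if q == 0 then 1 else q.
have a2 : a * a = 1 + (q - q^-1) * a.
  rewrite /a; have [->|q0] := eqVneq q 0; first by rewrite invr0 subr0 mul0r addr0 mulr1.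
  by rewrite mulrBl mulVf // addrC subrK.
have [phi [phis phiZ]] := @free_character C 'I_k.-1 a.
apply: (@ideal_gen_proper _ _ _ phi) => x.
case=> [[i [j [_ ->]]]|[i [j [_ ->]]]|[i ->]].
- by rewrite rmorphB !rmorphM !phis subrr.
- by rewrite rmorphB !rmorphM !phis subrr.
- by rewrite rmorphB !rmorphD rmorph1 phiZ rmorphM !phis a2 subrr.
Qed.

Definition hecke : Type := quot_alg hecke_proper.
HB.instance Definition _ := GRing.Algebra.on hecke.

End Hecke.

Definition hecke_gen (C : fieldType) (q : C) (k i : nat) : hecke q k :=
  if insub i is Some i' then quot_pi (@hecke_proper C q k) (free_gen C i')
  else 0.

(* [hecke_y q k j] is y_{j+1}; the generator sigma_{k-(j+1)} occurring in
   y_{j+2} has index k - (j+1) - 1. *)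
Fixpoint hecke_y (C : fieldType) (q : C) (k j : nat) : hecke q k :=
  if j is j'.+1 then
    let s := hecke_gen q k (k - j'.+2) in s * hecke_y q k j' * s + s
  else 0.

(* The sum form of (q^k - q^-k) / (q - q^-1), meaningful also for q = 1, -1. *)
Definition qnum (C : fieldType) (q : C) (k : nat) : C :=
  \sum_(i < k) q ^ (k%:Z - 1 - (i.*2)%:Z).

Definition qnumz (C : fieldType) (q : C) (c : int) : C :=
  (sgz c)%:~R * qnum q `|c|%N.

Definition is_partition (lam : seq nat) := sorted geq lam && (0%N \notin lam).

Definition cells (lam : seq nat) : seq (nat * nat) :=
  [seq (r, c) | r <- iota 0 (size lam), c <- iota 0 (nth 0%N lam r)].

(* A standard tableau is given by the list of its nodes (row, column), both
   counted from 0: the j-th entry of the list is the node containing j + 1. *)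
Definition is_std_tableau (lam : seq nat) (t : seq (nat * nat)) :=
  perm_eq t (cells lam) &&
  all (fun x => all (fun y =>
    ((x.1 == y.1) && (x.2 < y.2)%N || (x.2 == y.2) && (x.1 < y.1)%N)
      ==> (index x t < index y t)%N) t) t.

Definition content (x : nat * nat) : int := x.2%:Z - x.1%:Z.

Definition munit_spec (C : fieldType) (q : C) (k : nat) (t : seq (nat * nat)) :
    set (hecke q k) := fun e =>
  [/\ e != 0, e * e = e &
    forall j, (j < k)%N ->
      let c := content (nth (0, 0)%N t j) in
      hecke_y q k j * e = (q ^ c * qnumz q c) *: e /\
      e * hecke_y q k j = (q ^ c * qnumz q c) *: e].

(* The idempotent E^lambda_alpha of H_k(q), for alpha a standard tableau t with
   k nodes; [munit_spec] determines it uniquely under the assumptions on q. *)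
Definition munit (C : fieldType) (q : C) (k : nat) (t : seq (nat * nat)) :
  hecke q k := xget 0 (@munit_spec C q k t).

(* Endomorphisms of V^{(x)k}, dim V = N, are square matrices whose rows (lower
   indices) and columns (upper indices) are numbered by words of length k in
   'I_N; products are matrix products, (XY)_i^j = \sum_a X_i^a Y_a^j. *)
Definition tdim (N k : nat) : nat := #|{: k.-tuple 'I_N}|.

Definition word (N k : nat) (a : 'I_(tdim N k)) : seq 'I_N :=
  tval (enum_val a : k.-tuple 'I_N).

Definition tens (A : nmodType) (N k : nat) (f : seq 'I_N -> seq 'I_N -> A) :
  'M[A]_(tdim N k) := \matrix_(a, b) f (word a) (word b).

(* The entry X_u^v; by convention 0 if u or v does not have length k. *)
Definition entry (A : nmodType) (N k : nat) (X : 'M[A]_(tdim N k))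
    (u v : seq 'I_N) : A :=
  match insub u : option (k.-tuple 'I_N), insub v : option (k.-tuple 'I_N) with
  | Some a, Some b => X (enum_rank a) (enum_rank b)
  | _, _ => 0
  end.

(* X_{i+1} = Id^{(x)i} (x) X (x) Id^{(x)(k-i-2)} for i.+1 < k. *)
Definition site (C : fieldType) (N k i : nat) (X : 'M[C]_(tdim N 2)) :
    'M[C]_(tdim N k) :=
  tens k (fun u v => entry X (take 2 (drop i u)) (take 2 (drop i v))
    *+ ((take i u == take i v) && (drop i.+2 u == drop i.+2 v))).

Section RMatrices.
Variables (C : fieldType) (N : nat).
Implicit Types X R F : 'M[C]_(tdim N 2).

Definition is_Rmatrix R :=
  R \in unitmx /\
  site 3 0 R *m site 3 1 R *m site 3 0 R = site 3 1 R *m site 3 0 R *m site 3 1 R.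

Definition is_Hecke (q : C) R :=
  is_Rmatrix R /\ (R - q%:M) *m (R + (q^-1)%:M) = 0.

Definition compatible R F :=
  site 3 0 R *m site 3 1 F *m site 3 0 F = site 3 1 F *m site 3 0 F *m site 3 1 R /\
  site 3 1 R *m site 3 0 F *m site 3 1 F = site 3 0 F *m site 3 1 F *m site 3 0 R.

(* Psi is unique when it exists: the condition says that two reshuffled
   N^2 x N^2 matrices are mutually inverse. *)
Definition skew_inverse X : set 'M[C]_(tdim N 2) := fun Psi =>
  forall i j k l : 'I_N,
    \sum_a \sum_b entry X [:: i; a] [:: k; b] * entry Psi [:: b; j] [:: a; l]
    = ((i == l) && (j == k))%:R.

Definition skew_invertible X := exists Psi, skew_inverse X Psi.

Definition Dmx X : 'M[C]_N :=
  \matrix_(i, j) \sum_a entry (xget 0 (skew_inverse X)) [:: i; a] [:: j; a].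

Definition strictly_skew_invertible X := skew_invertible X /\ Dmx X \in unitmx.

(* rho_R : sigma_a |-> R_a, computed on a representative in the free algebra; it
   does not depend on the representative when R is a Hecke R-matrix. *)
Definition hecke_rep (q : C) R (k : nat) (x : hecke q k) : 'M[C]_(tdim N k) :=
  free_eval (fun i : 'I_k.-1 => site k i R)
    (repr (x : quot_alg (@hecke_proper C q k))).

(* On H_{(m+1)(n+1)}(q), an irreducible block lies in the kernel of rho_R exactly
   when its matrix units do, so the last two clauses say that the kernel is the
   ideal generated by any matrix unit of rectangular shape. *)
Definition is_GL_type (q : C) (m n : nat) R :=
  let K := (m.+1 * n.+1)%N in
  let rect := nseq m.+1 n.+1 in
  [/\ is_Hecke q R,
      forall k, (2 <= k < K)%N -> injective (@hecke_rep q R k),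
      forall t, is_std_tableau rect t -> hecke_rep R (munit q K t) = 0
    & forall mu t, is_partition mu -> sumn mu = K -> mu != rect ->
        is_std_tableau mu t -> hecke_rep R (munit q K t) != 0].

End RMatrices.

Section MatrixFunctions.
Variables (C : fieldType) (A : algType C) (N : nat).
Implicit Types (R F : 'M[C]_(tdim N 2)) (M : 'M[A]_N).

Definition scal_mx d (X : 'M[C]_d) : 'M[A]_d := map_mx (in_alg A) X.

(* [mcopy F M k j] is the matrix M_{\overline{j+1}} over V^{(x)k}. *)
Fixpoint mcopy F M (k j : nat) : 'M[A]_(tdim N k) :=
  if j is j'.+1 then
    scal_mx (site k j' F) *m mcopy F M k j' *m scal_mx (invmx (site k j' F))
  else tens k (fun u v =>
    if (u, v) is (a :: u', b :: v') then M a b *+ (u' == v') else 0).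

(* R-trace of Y over the last r of the k tensor factors; u and v are the
   lower and upper indices of the k - r remaining ones. *)
Definition Rtrace (D : 'M[C]_N) (r k : nat) (Y : 'M[A]_(tdim N k))
    (u v : seq 'I_N) : A :=
  \sum_(s : r.-tuple 'I_N) \sum_(t : r.-tuple 'I_N)
    (\prod_(j < r) D (tnth s j) (tnth t j)) *: entry Y (u ++ t) (v ++ s).

(* The R-matrices enter in the order R_{k-1} ... R_1. *)
Definition mpower R F M (k : nat) : 'M[A]_N :=
  match k with
  | 0 => 1%:M
  | 1 => M
  | _ => \matrix_(i, j)
      Rtrace (Dmx R) k.-1
        ((\prod_(l < k) mcopy F M k l)
          *m scal_mx (\prod_(l <- rev (iota 0 k.-1)) site k l R))
        [:: i] [:: j]
  end.

(* [alpha] selects a standard tableau of each shape. *)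
Definition schur (q : C) R F M (alpha : seq nat -> seq (nat * nat))
    (lam : seq nat) : A :=
  let k := sumn lam in
  if lam is [::] then 1 else
  Rtrace (Dmx R) k
    ((\prod_(l < k) mcopy F M k l)
      *m scal_mx (hecke_rep R (munit q k (alpha lam))))
    [::] [::].

End MatrixFunctions.

Lemma map_comm_mx0 (A B : nzRingType) (phi : {rmorphism A -> B}) d
    (X P Q : 'M[A]_d) a b :
  map_mx phi P = 0 -> phi ((X *m P *m Q - P *m Q *m X) a b) = 0.
Proof.
move=> P0; suff /matrixP/(_ a b) : map_mx phi (X *m P *m Q - P *m Q *m X) = 0.
  by rewrite !mxE.
by rewrite map_mxB !(map_mxM phi) P0 !(mul0mx, mulmx0) subrr.
Qed.

Section QuantumMatrixAlgebra.
Variables (C : fieldType) (N : nat) (R F : 'M[C]_(tdim N 2)).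

Definition qma_rel : set (free_alg C ('I_N * 'I_N)%type) := fun x =>
  let M : 'M[free_alg C _]_N := \matrix_(i, j) free_gen C (i, j) in
  let R1 := scal_mx _ (site 2 0 R) in
  exists a b, x = (R1 *m mcopy F M 2 0 *m mcopy F M 2 1
                   - mcopy F M 2 0 *m mcopy F M 2 1 *m R1) a b.

Lemma qma_proper : ~ ideal_gen qma_rel 1.
Proof.
have [phi [phi0 _]] := @free_character C ('I_N * 'I_N)%type 0.
apply: (@ideal_gen_proper _ _ _ phi) => x [a [b ->]].
set M : 'M[free_alg C _]_N := \matrix_(i, j) _.
have M0 : map_mx phi (mcopy F M 2 0) = 0.
  apply/matrixP => i j; rewrite !mxE.
  case: (word _) (word _) => [|u us] [|v vs]; rewrite ?rmorph0 //.
  by rewrite rmorphMn /= mxE phi0 mul0rn.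
exact: map_comm_mx0 M0.
Qed.

Definition qma : Type := quot_alg qma_proper.
HB.instance Definition _ := GRing.Algebra.on qma.

Definition qma_mx : 'M[qma]_N :=
  \matrix_(i, j) quot_pi qma_proper (free_gen C (i, j)).

End QuantumMatrixAlgebra.

Definition Lambda (m n k l : nat) : seq nat :=
  [seq x <- nseq k n.+1 ++ nseq (m - k) n ++ [:: l] | x != 0%N].

(* Main.v *)
(** For K = (m+1)(n+1), let psi(x) be the trace over the factors 2, ..., K of
    M_2 ... M_K rho_R(x). It kills E^rect, and psi(ab) = psi(ba) whenever a only
    involves these factors. If the idempotent E_S of a tableau S of shape
    Lambda(k,l) acts on the last mn+k+l factors and j = m+n-k-l, then
    psi(E_S sigma_j ... sigma_1) = phi(M^j) s_Lambda(k,l)(M), where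
    phi(X) = Tr_R(2) (F X_1 F^-1 R). Splitting E_S over the addable nodes of its
    shape and computing E_T sigma E_T by Young's seminormal form gives, for all
    k and l, linear relations between traces attached to one more node. Weighted
    by (-1)^k q^(k-l) they telescope, and what is left is psi(E^rect) = 0. The
    theorem follows because phi is injective, which is a consequence of strict
    skew-invertibility and compatibility. *)

Require Import Defs.
From HB Require Import structures.
From mathcomp Require Import all_boot all_order all_algebra.
From mathcomp Require Import complex reals.
From mathcomp Require Import finmap.
From mathcomp Require Import boolp classical_sets zify ring.
From mathcomp.multinomials Require Import monalg.

Set Implicit Arguments.
Unset Strict Implicit.
Unset Printing Implicit Defensive.

Import Order.TTheory GRing.Theory Num.Theory.
Local Open Scope ring_scope.

(** * q-contents and addable nodes *)

(** The matrix units are specified only through eigenvalues of the Jucys-Murphy elements, so their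
    theory is derived from the Hecke relations: the idempotent of a tableau is a product of Lagrange
    polynomials in these elements. The crux is that, behind this idempotent, the next Jucys-Murphy
    element has no eigenvalue besides the q-contents of the addable nodes. Moving the annihilating
    polynomial one step further by the intertwiner adds two candidates, of contents c + 1 and c - 1
    for c the content of the last node; where no addable node has such a content, the braid relation
    excludes it. Of the nodes addable to Lambda(k,l), at most two stay in the family, one completes
    the rectangle, and two leave it; for k, l > 0 the coefficients [coefA] and [coefB] solve the two
    linear equations that make the last two disappear. Injectivity of phi is reduced to that of the
    same map with R^-1 in place of R, which differs from phi by a scalar matrix and factors into
    contractions with invertible kernels. *)

Section QuantumContent.
Variables (C : fieldType) (q : C).
Hypothesis q_neq0 : q != 0.

(** This is (q^(2c) - 1)/(q - q^-1), in a form that keeps its meaning at q = 1 and q = -1. *)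
Definition qcont (c : int) : C := q ^ c * qnumz q c.

Local Notation z := (q - q^-1).

Lemma qnumS k : qnum q k.+1 = q * qnum q k + q ^- k.
Proof.
rewrite /qnum big_ord_recr /= mulr_sumr; congr (_ + _).
  apply: eq_bigr => i _; rewrite -[q in LHS]expr1z.
  rewrite -{2}(expr1z q) -expfzDr //; congr (_ ^ _); lia.
by rewrite exprnN; congr (_ ^ _); lia.
Qed.

Lemma qnumSV k : qnum q k.+1 = q^-1 * qnum q k + q ^+ k.
Proof.
rewrite /qnum big_ord_recl /= addrC mulr_sumr; congr (_ + _).
  apply: eq_bigr => i _; rewrite -exprN1 -expfzDr //; congr (_ ^ _).
  rewrite /bump /=; lia.
by rewrite exprnP; congr (_ ^ _); lia.
Qed.

Lemma qcont0 : qcont 0 = 0.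
Proof. by rewrite /qcont /qnumz sgz0 mul0r mulr0. Qed.

Lemma qcontn (n : nat) : qcont n = q ^+ n * qnum q n.
Proof.
rewrite /qcont /qnumz; case: n => [|n]; last by rewrite /= mul1r.
by rewrite sgz0 mul0r /qnum big_ord0.
Qed.

Lemma qcontNn (n : nat) : qcont (- n%:Z) = - (q ^- n * qnum q n).
Proof.
rewrite /qcont /qnumz; case: n => [|n].
  by rewrite oppr0 sgz0 mul0r /qnum big_ord0 !mulr0 oppr0.
by rewrite sgzN abszN /= mulN1r mulrN exprnN.
Qed.

Lemma qcontS c : qcont (c + 1) = q ^+ 2 * qcont c + q.
Proof.
case: (intP c) => [|n|n].
- rewrite add0r qcont0 mulr0 add0r (qcontn 1) /qnum big_ord1 expr1 /=.
  by rewrite (_ : 1%Z - 1 - 0.*2%:Z = 0) // expr0z mulr1.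
- have -> : n.+1%:Z + 1 = n.+2%:Z by lia.
  rewrite !qcontn (qnumS n.+1) mulrDr exprS.
  by rewrite mulfK ?expf_neq0 //; ring.
- have -> : - n.+1%:Z + 1 = - n%:Z by lia.
  have qn0 : q ^+ n != 0 by rewrite expf_neq0.
  rewrite !qcontNn qnumSV (exprS q n); move: (q ^+ n) qn0 => X X0.
  by field; rewrite X0 q_neq0.
Qed.

Lemma qcontD c d : qcont (c + d) = qcont c + (q ^ c) ^+ 2 * qcont d.
Proof.
have pos e (n : nat) : 1 + z * qcont e = (q ^ e) ^+ 2 ->
    qcont (e + n%:Z) = qcont e + (q ^ e) ^+ 2 * qcont n.
  move=> he; elim: n => [|n IH]; first by rewrite addr0 qcont0 mulr0 addr0.
  have -> : n.+1%:Z = n%:Z + 1 by lia.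
  rewrite addrA !qcontS IH -he; field; exact: q_neq0.
have zq (n : nat) : 1 + z * qcont n = (q ^ n%:Z) ^+ 2.
  elim: n => [|n IH]; first by rewrite qcont0 mulr0 addr0 expr0z expr1n.
  have -> : n.+1%:Z = n%:Z + 1 by lia.
  rewrite qcontS expfzDr // expr1z exprMn -IH; field; exact: q_neq0.
have zq' e : 1 + z * qcont e = (q ^ e) ^+ 2.
  case: (intP e) => [|n|n]; [exact: (zq 0%N) | exact: zq |].
  elim: n.+1 => [|k IH]; first by rewrite oppr0; exact: (zq 0%N).
  have e1 : - k%:Z = - k.+1%:Z + 1 by lia.
  move: IH; rewrite {}e1 qcontS expfzDr // expr1z exprMn => IH.
  have q2 : q ^+ 2 != 0 by rewrite expf_neq0.
  apply: (mulIf q2); rewrite -IH; field; exact: q_neq0.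
case: (intP d) => [|n|n]; [exact: (pos c 0%N) | exact: pos |].
(* A negative [d] is reached backwards: [pos] raises [c + m] and [m] by [n.+1], to [c] and to 0, and
   the two equations are solved for [qcont (c + m)]. *)
set m := - _; have hm := pos (c + m) n.+1 (zq' _).
have h0 := pos m n.+1 (zq' _).
have e1 : c + m + n.+1%:Z = c by rewrite /m; lia.
have e0 : m + n.+1%:Z = 0 by rewrite /m; lia.
rewrite {}e1 in hm; rewrite {}e0 qcont0 in h0.
rewrite hm expfzDr // exprMn -[X in X = _]addr0.
have -> : qcont m = - ((q ^ m) ^+ 2 * qcont n.+1) by apply/eqP; rewrite -addr_eq0 -h0.
by ring.
Qed.

(** Comparison of [qcontS] with [qcontD] at [d = 1]. It lets q^(2c) be handled as a polynomial in
    the q-content. *)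
Lemma qcont_sqr c : 1 + z * qcont c = (q ^ c) ^+ 2.
Proof.
have := qcontD c 1.
have -> : qcont 1 = q by rewrite -[1]add0r qcontS qcont0 mulr0 add0r.
rewrite qcontS => /(congr1 (fun x => q^-1 * x)).
rewrite !mulrDr => h; apply: (addrI (q^-1 * qcont c)).
have -> : (q ^ c) ^+ 2 = q^-1 * ((q ^ c) ^+ 2 * q) by field.
rewrite -h; field; exact: q_neq0.
Qed.

Hypothesis qnum_neq0 : forall k : nat, (0 < k)%N -> qnum q k != 0.

Lemma qcont_neq0 c : c != 0 -> qcont c != 0.
Proof.
move=> c0; rewrite /qcont /qnumz !mulf_neq0 ?expfz_neq0 //.
  by case: sgzP c0 => //= _ _; rewrite ?oppr_eq0 oner_neq0.
by apply: qnum_neq0; rewrite absz_gt0.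
Qed.

(** By [qcontD], two q-contents differ by a power of q times the q-content of the difference, which
    is nonzero because no k_q vanishes. Hence eigenvalues determine contents. *)
Lemma qcont_inj : injective qcont.
Proof.
move=> c d h; apply/eqP; rewrite -subr_eq0; apply/negPn/negP => cd.
have := qcontD d (c - d); rewrite addrC subrK h => /eqP.
rewrite -subr_eq0 opprD addrA subrr add0r oppr_eq0 mulf_eq0 (negPf (qcont_neq0 cd)).
by rewrite orbF expf_eq0 /= (negPf (expfz_neq0 _ q_neq0)).
Qed.

End QuantumContent.

Section AddableNodes.
Implicit Types (s : seq (nat * nat)) (x v : nat * nat).

Definition addable s x :=
  [&& x \notin s, (x.1 == 0)%N || ((x.1.-1, x.2) \in s)
    & (x.2 == 0)%N || ((x.1, x.2.-1) \in s)].

(* The latest node comes first. *)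
Fixpoint rtab s := if s is x :: s' then addable s' x && rtab s' else true.

(** The box is large enough: the nodes of a tableau have coordinates below [size s], and an addable
    node is next to one of them or on an edge. *)
Definition adds s :=
  [seq x <- [seq (i, j) | i <- iota 0 (size s).+1, j <- iota 0 (size s).+1]
         | addable s x].

Lemma rtab_lt_size s i j : rtab s -> (i, j) \in s -> (i < size s)%N /\ (j < size s)%N.
Proof.
elim: s i j => // x s IH i j /= /andP[/and3P[_ h1 h2] hs].
rewrite inE => /orP[/eqP xE|h]; last by have := IH _ _ hs h; lia.
move: h1 h2; rewrite -xE /= => h1 h2; split.
  by case: i xE h1 {h2} => //= i _ /(IH _ _ hs); lia.
by case: j xE h2 {h1} => //= j _ /(IH _ _ hs); lia.
Qed.

Lemma mem_adds s x : rtab s -> (x \in adds s) = addable s x.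
Proof.
move=> hs; rewrite mem_filter; case ax : (addable s x); last by [].
case: x ax => i j /and3P[_ h1 h2]; rewrite andTb.
apply/allpairsP; exists (i, j); rewrite !mem_iota; move: h1 h2 => /= h1 h2; split=> //.
  by case: i h1 h2 => //= i /(rtab_lt_size hs); lia.
by case: j h1 h2 => //= j h1 /(rtab_lt_size hs); lia.
Qed.

Lemma adds_uniq s : uniq (adds s).
Proof.
by apply: filter_uniq; apply: allpairs_uniq; rewrite ?iota_uniq // => -[? ?] [? ?].
Qed.

Lemma rtab_uniq s : rtab s -> uniq s.
Proof. by elim: s => //= x s IH /andP[/and3P[-> _ _] /IH]. Qed.

Lemma rtab_closed s i j i' j' : rtab s -> (i, j) \in s ->
  (i' <= i)%N -> (j' <= j)%N -> (i', j') \in s.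
Proof.
elim: s i j i' j' => // x s IH i j i' j' /= /andP[/and3P[_ h1 h2] hs].
rewrite !inE => /orP[/eqP xE|/(IH _ _ i' j' hs)h]; last by move=> *; rewrite h ?orbT.
move=> li lj; case: eqP => //= ne; move: h1 h2; rewrite -xE /=.
have [ij|ij] : (i' < i)%N \/ (j' < j)%N.
- move: ne; rewrite -xE => ne; have [?|?] := eqVneq i' i; last by left; lia.
  by right; have : j' <> j by [move=> ?; apply: ne; congr (_, _)]; lia.
- by case: i ij li xE => // i ij li xE /= h1 _; apply: (IH _ _ _ _ hs h1); lia.
by case: j ij lj xE => // j ij lj xE /= _ h2; apply: (IH _ _ _ _ hs h2); lia.
Qed.

Lemma addable_closed s i j i' j' : rtab s -> addable s (i, j) ->
  (i' <= i)%N -> (j' <= j)%N -> (i' < i)%N || (j' < j)%N -> (i', j') \in s.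
Proof.
move=> hs hx li lj lt; have : rtab ((i, j) :: s) by rewrite /= hx.
move=> /rtab_closed h; have := h i j i' j'; rewrite !inE eqxx => /(_ isT li lj).
by case/orP=> // /eqP[ei ej]; move: lt; rewrite ei ej !ltnn.
Qed.

(** Of two nodes on one diagonal, the upper left one would already lie in [s], being northwest of an
    addable node. *)
Lemma addable_content_inj s x v : rtab s -> addable s x -> addable s v ->
  content x = content v -> x = v.
Proof.
case: x v => [i j] [i' j'] hs hx hv; rewrite /content /= => e.
have [nx _ _] := and3P hx; have [nv _ _] := and3P hv.
case: (ltngtP i i') => ii.
- by move: nx; rewrite (addable_closed hs hv) //=; lia.
- by move: nv; rewrite (addable_closed hs hx) //=; lia.
by congr (_, _); lia.
Qed.

Lemma addable_content_nadj s x v : rtab s -> addable s x -> addable s v ->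
  content v != content x + 1.
Proof.
case: x v => [i j] [i' j'] hs hx hv; rewrite /content /=; apply/eqP => e.
have [nx _ _] := and3P hx; have [nv _ _] := and3P hv.
case: (leqP i i') => ii.
  by move: nx; rewrite (addable_closed hs hv) //=; lia.
by move: nv; rewrite (addable_closed hs hx) //=; lia.
Qed.

(** The next node on the diagonal of [a] would require the node to the right of [a], which is not
    there yet. This keeps the denominators of the seminormal form away from 0. *)
Lemma addable_next_content s a x : rtab s -> addable s a -> addable (a :: s) x ->
  content x != content a.
Proof.
case: a x => [i j] [i' j'] hs aa ax; rewrite /content /=; apply/eqP => e.
have hr : rtab ((i, j) :: s) by rewrite /= aa.
have [na _ _] := and3P aa; have [nx _ _] := and3P ax.
case: (ltngtP i i') => ii.
- have : (i, j.+1) \in (i, j) :: s.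
    by apply: (addable_closed hr ax); lia.
  rewrite inE xpair_eqE eqxx /= => /orP[|h]; first by lia.
  by move: na; rewrite (rtab_closed hs h).
- move: nx; rewrite (@rtab_closed _ i j i' j' hr) ?inE ?eqxx //; lia.
move: nx; rewrite inE negb_or => /andP[/eqP []]; congr (_, _); lia.
Qed.

Lemma eq_addable s s' : perm_eq s s' -> addable s =1 addable s'.
Proof. by move=> /perm_mem e x; rewrite /addable !e. Qed.

Lemma perm_adds s s' : perm_eq s s' -> adds s = adds s'.
Proof.
move=> e; rewrite /adds (perm_size e); apply: eq_filter; exact: eq_addable.
Qed.

(* A node with no node to its right and none below can be removed. *)
Definition corner s x :=
  [&& x \in s, (x.1.+1, x.2) \notin s & (x.1, x.2.+1) \notin s].

Lemma addable_rem s x v : rtab s -> corner s x -> addable s v -> v != (x.1.+1, x.2) ->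
  v != (x.1, x.2.+1) -> addable (rem x s) v.
Proof.
move=> hs cx /and3P[nv h1 h2] n1 n2; have us := rtab_uniq hs.
rewrite /addable !(mem_rem_uniq _ us) !inE (negPf nv) andbF /=.
case: v x n1 n2 h1 h2 cx {nv} => [i j] [i' j'] /= n1 n2 h1 h2 cx.
apply/andP; split; apply/orP.
  case/orP: h1 => h1; [by left|have [|i0] := eqVneq i 0%N; [by left|right]].
  rewrite h1 andbT; apply: contra n1 => /eqP[<- <-].
  by rewrite prednK ?lt0n.
case/orP: h2 => h2; [by left|have [|j0] := eqVneq j 0%N; [by left|right]].
rewrite h2 andbT; apply: contra n2 => /eqP[<- <-].
by rewrite prednK ?lt0n.
Qed.

Lemma rtab_rem s x : rtab s -> corner s x -> rtab (rem x s).
Proof.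
elim: s x => //= v s IH x /andP[av hs] /and3P[xs n1 n2].
move: xs; rewrite inE => /orP[/eqP<-|xs]; first by rewrite eqxx.
have cx : corner s x.
  by rewrite /corner xs; move: n1 n2; rewrite !inE !negb_or => /andP[_ ->] /andP[_ ->].
case: eqP => // vx /=; rewrite IH // andbT; apply: addable_rem => //.
  by move: n1; rewrite inE negb_or eq_sym => /andP[].
by move: n2; rewrite inE negb_or eq_sym => /andP[].
Qed.

Lemma corner_addable_rem s x : rtab s -> corner s x -> addable (rem x s) x.
Proof.
move=> hs /and3P[xs n1 n2]; have us := rtab_uniq hs.
rewrite /addable !(mem_rem_uniq _ us) !inE eqxx /=.
case: x xs n1 n2 => [i j] /= xs n1 n2; apply/andP; split; apply/orP.
  case: i xs n1 n2 => [|i] xs n1 n2; [by left|right].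
  by rewrite (rtab_closed hs xs) // andbT; apply/eqP => -[]; lia.
case: j xs n1 n2 => [|j] xs n1 n2; [by left|right].
by rewrite (rtab_closed hs xs) // andbT; apply/eqP => -[]; lia.
Qed.

(* When the neighbour of content [content x + 1] is not addable after [x], the
   node above [x] has that content and is a corner; symmetrically for [- 1]. *)
Lemma not_addable_next s x (e : bool) : rtab s -> addable s x ->
  let a := if e then content x + 1 else content x - 1 in
  (forall v, addable (x :: s) v -> content v != a) ->
  exists2 w, corner s w & content w = a.
Proof.
case: x => [i j] hs ax; set x := (i, j) => a hn.
have hxs : rtab (x :: s) by rewrite /= ax.
have [nx h1 h2] := and3P ax; move: h1 h2 => /= h1 h2.
rewrite {}/a in hn *; case: e hn => hn.
- have : ~~ addable (x :: s) (i, j.+1).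
    by apply/negP => /hn/eqP; apply; rewrite /content /=; lia.
  have nr : (i, j.+1) \notin s.
    by apply: contra nx => h; apply: rtab_closed hs h _ _.
  rewrite /addable !inE (negPf nr) /= !xpair_eqE eqxx /=.
  have -> : (j.+1 == j) = false by lia.
  rewrite /= eqxx /= ?andbF ?andbT ?orbF negb_or /= => /andP[i0 ni].
  exists (i.-1, j); last by rewrite /content /=; lia.
  by move: h1; rewrite (negPf i0) /corner /= prednK ?lt0n // nx => ->.
- have : ~~ addable (x :: s) (i.+1, j).
    by apply/negP => /hn/eqP; apply; rewrite /content /=; lia.
  have nr : (i.+1, j) \notin s.
    by apply: contra nx => h; apply: rtab_closed hs h _ _.
  rewrite /addable !inE (negPf nr) /= !xpair_eqE eqxx /= andbT.
  have -> : (i.+1 == i) = false by lia.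
  rewrite /= ?eqxx /= ?andbF ?andbT ?orbF negb_or /= => /andP[j0 nj].
  exists (i, j.-1); last by rewrite /content /=; lia.
  by move: h2; rewrite (negPf j0) /corner /= prednK ?lt0n // nx nj => ->.
Qed.

Lemma addable_cons s x v : addable s x -> x != v -> addable (v :: s) x.
Proof.
rewrite /addable !inE negb_or => /and3P[-> h1 h2] -> /=.
by apply/andP; split; [case/orP: h1 | case/orP: h2] => ->; rewrite ?orbT.
Qed.

End AddableNodes.

(** * Jucys-Murphy elements and tableau idempotents *)

Section HornerAlg.
Variables (C : fieldType) (A : algType C).

Lemma horner_alg_intertwine (u a b : A) (p : {poly C}) :
  u * a = b * u -> u * horner_alg a p = horner_alg b p * u.
Proof.
move=> h; elim/poly_ind: p => [|p c IH]; first by rewrite !rmorph0 mulr0 mul0r.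
rewrite !rmorphD !rmorphM /= !horner_algX !horner_algC mulrDr mulrDl.
by rewrite mulrA IH -[_ * u * a]mulrA h mulrA -scalerAr -scalerAl mulr1 mul1r.
Qed.

Lemma horner_alg_eigen (a w : A) (c : C) (p : {poly C}) :
  a * w = c *: w -> horner_alg a p * w = p.[c] *: w.
Proof.
move=> h; elim/poly_ind: p => [|p d IH]; first by rewrite rmorph0 mul0r horner0 scale0r.
rewrite rmorphD rmorphM /= horner_algX horner_algC mulrDl -mulrA h.
by rewrite -scalerAr IH -scalerAl mul1r !hornerE scalerA scalerDl mulrC.
Qed.

Lemma horner_alg_eigenr (a w : A) (c : C) (p : {poly C}) :
  w * a = c *: w -> w * horner_alg a p = p.[c] *: w.
Proof.
move=> h; elim/poly_ind: p => [|p d IH]; first by rewrite rmorph0 mulr0 horner0 scale0r.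
rewrite rmorphD rmorphM /= horner_algX horner_algC mulrDr mulrA IH.
by rewrite -scalerAl h -scalerAr mulr1 !hornerE scalerA scalerDl.
Qed.

End HornerAlg.

(** Only the relations are required, in any algebra, so that one development serves [hgen q k] for
    every [k]. *)
Definition hecke_family (C : fieldType) (A : algType C) (q : C) (n : nat)
    (t : nat -> A) :=
  [/\ forall i, (i.+1 < n)%N -> t i * t i.+1 * t i = t i.+1 * t i * t i.+1,
      forall i j, (i.+1 < j)%N -> (j < n)%N -> t i * t j = t j * t i
    & forall i, (i < n)%N -> t i * t i = 1 + (q - q^-1) *: t i].

Section NodePolynomials.
Variables (C : fieldType) (q : C).
Hypothesis q_neq0 : q != 0.
Hypothesis qnum_neq0 : forall k : nat, (0 < k)%N -> qnum q k != 0.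
Implicit Types (s : seq (nat * nat)) (x v : nat * nat).

Local Notation kap x := (qcont q (content x)).

Definition lag s x : {poly C} :=
  \prod_(v <- adds s | v != x) ((kap x - kap v)^-1 *: ('X - (kap v)%:P)).

Definition qroots s : {poly C} := \prod_(v <- adds s) ('X - (kap v)%:P).

Lemma kap_adds_inj s x v : rtab s -> x \in adds s -> v \in adds s ->
  kap x = kap v -> x = v.
Proof.
move=> hs; rewrite !mem_adds // => ax av /(qcont_inj q_neq0 qnum_neq0).
exact: addable_content_inj hs ax av.
Qed.

Lemma horner_lag s x v : rtab s -> x \in adds s -> v \in adds s ->
  (lag s x).[kap v] = (v == x)%:R.
Proof.
move=> hs ax av; rewrite horner_prod; case: eqP => [->|/eqP vx].
  rewrite big_seq_cond big1 // => w /andP[aw wx].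
  rewrite !hornerE mulVf // subr_eq0; apply: contra wx => /eqP e.
  by apply/eqP/esym; exact: kap_adds_inj hs ax aw e.
by rewrite (big_rem v) //= vx !hornerE subrr mulr0 mul0r.
Qed.

(** Through this divisibility, an equation for [qroots] turns into an eigenvector equation for the
    image of [lag]. *)
Lemma lag_qroots s x : rtab s -> x \in adds s ->
  exists c, ('X - (kap x)%:P) * lag s x = c *: qroots s.
Proof.
move=> hs ax; exists (\prod_(v <- adds s | v != x) (kap x - kap v)^-1).
rewrite /lag /qroots scaler_prod -scalerAr (bigD1_seq x) //; exact: adds_uniq.
Qed.

Lemma adds_neq0 s : rtab s -> exists x, x \in adds s.
Proof.
move=> hs; have ex : exists j, (0%N, j) \notin s.
  by exists (size s); apply/negP => /(rtab_lt_size hs); rewrite ltnn => -[].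
have [j nj min] := ex_minnP ex; exists (0%N, j); rewrite mem_adds // /addable nj /=.
case: j nj min => //= j _ min; apply/negPn/negP => /min; lia.
Qed.

Lemma size_lag s x : x \in adds s -> (size (lag s x) <= size (adds s))%N.
Proof.
move=> ax; rewrite /lag scaler_prod (leq_trans (size_scale_leq _ _)) //.
rewrite -big_filter size_prod_XsubC size_filter -(count_predC (pred1 x)) addnC.
by rewrite -[X in (X < _)%N]addn0 ltn_add2l -has_count has_pred1.
Qed.

(** Both sides agree at the q-contents of all addable nodes, which are pairwise distinct and more
    numerous than the degrees allow. *)
Lemma sum_lag s : rtab s -> \sum_(x <- adds s) lag s x = 1.
Proof.
move=> hs; apply/eqP; rewrite -subr_eq0; apply/eqP.
apply: (@roots_geq_poly_eq0 _ _ [seq kap x | x <- adds s]).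
- apply/allP => _ /mapP[v av ->]; rewrite rootE hornerD hornerN hornerC horner_sum.
  rewrite (bigD1_seq v) ?adds_uniq //= horner_lag // eqxx.
  rewrite big_seq_cond big1 ?addr0 ?subrr // => x /andP[ax xv].
  by rewrite horner_lag // eq_sym (negPf xv).
- rewrite map_inj_in_uniq ?adds_uniq // => x v ax av; exact: kap_adds_inj ax av.
rewrite size_map; apply: (leq_trans (size_polyD _ _)).
rewrite geq_max size_polyN size_poly1.
have [x ax] := adds_neq0 hs; apply/andP; split; last by case: (adds s) ax.
rewrite big_seq; elim/big_ind: _ => [|p1 p2 h1 h2|v av]; first by rewrite size_poly0.
  by apply: (leq_trans (size_polyD _ _)); rewrite geq_max h1.
exact: size_lag.
Qed.

End NodePolynomials.

Section HeckeTower.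
Set Default Proof Using "All".
Variables (C : fieldType) (q : C).
Hypothesis q_neq0 : q != 0.
Hypothesis qnum_neq0 : forall k : nat, (0 < k)%N -> qnum q k != 0.
Variables (A : algType C) (n : nat) (t : nat -> A).
Hypothesis t_hecke : hecke_family q n t.
Implicit Types (s : seq (nat * nat)) (x v : nat * nat) (a b w : A).

Local Notation z := (q - q^-1).
Local Notation kap x := (qcont q (content x)).

(** * Subalgebras of the tower and Jucys-Murphy elements *)

Inductive gen (j : nat) : A -> Prop :=
| GenC c : gen j c%:A
| GenT i of (i < j)%N : gen j (t i)
| GenD a b of gen j a & gen j b : gen j (a + b)
| GenM a b of gen j a & gen j b : gen j (a * b).

(** [jm j] is y_(j+1). It lies in [gen j], and its eigenvalue is read off the node number [j] of a
    tableau, counted from 0. *)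
Fixpoint jm (j : nat) : A := if j is j'.+1 then t j' * jm j' * t j' + t j' else 0.

Lemma jmS j : jm j.+1 = t j * jm j * t j + t j. Proof. by []. Qed.

Arguments jm : simpl never.

Lemma gen_widen j k a : (j <= k)%N -> gen j a -> gen k a.
Proof.
move=> jk; elim=> [c|i ij|? ? _ ? _ ?|? ? _ ? _ ?]; [exact: GenC| |exact: GenD|exact: GenM].
by apply: GenT; apply: leq_trans jk.
Qed.

Lemma gen1 j : gen j 1.
Proof. by rewrite -[1]scale1r; exact: GenC. Qed.

Lemma genZ j c a : gen j a -> gen j (c *: a).
Proof. by move=> h; rewrite -mulr_algl; apply: GenM => //; exact: GenC. Qed.

Lemma gen_jm j : gen j (jm j).
Proof.
elim: j => [|j IH]; first by rewrite -[jm 0]/(0 : A) -(scale0r (1 : A)); exact: GenC.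
rewrite jmS.
have ht : gen j.+1 (t j) by exact: GenT.
by apply: GenD => //; apply: GenM => //; apply: GenM => //; apply: gen_widen IH.
Qed.

Lemma gen_horner j k p : (k <= j)%N -> gen j (horner_alg (jm k) p).
Proof.
move=> kj; elim/poly_ind: p => [|p d IH].
  by rewrite rmorph0 -(scale0r (1 : A)); exact: GenC.
rewrite rmorphD rmorphM /= horner_algX horner_algC.
by apply: GenD; [apply: GenM => //; apply: gen_widen (gen_jm k)|exact: GenC].
Qed.

Lemma gen_comm j a w : (forall i, (i < j)%N -> GRing.comm w (t i)) -> gen j a ->
  GRing.comm w a.
Proof.
move=> h; elim=> [c|i /h //|? ? _ ? _ ?|? ? _ ? _ ?].
- by rewrite /GRing.comm mulr_algl mulr_algr.
- exact: commrD.
- exact: commrM.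
Qed.

Lemma comm_t i j : (i.+1 < j)%N -> (j < n)%N -> GRing.comm (t i) (t j).
Proof. by have [_ h _] := t_hecke; exact: h. Qed.

Lemma comm_t_jm i j : (i < n)%N -> (j <= n)%N -> i != j -> i.+1 != j ->
  GRing.comm (t i) (jm j).
Proof.
have [hb hf hq] := t_hecke.
elim/ltn_ind: j i => -[|j] IH i iN jN ij ij1; first exact: commr0.
have [lt|ge] := ltnP j.+1 i.
  have c1 : GRing.comm (t i) (t j) by apply/commr_sym/comm_t.
  have c2 : GRing.comm (t i) (jm j) by apply: IH => //; lia.
  by apply: commrD => //; apply: commrM => //; apply: commrM.
have ltj : (i < j)%N by lia.
have [lt|ge1] := ltnP i.+1 j.
  have c1 : GRing.comm (t i) (t j) by apply/comm_t.
  have c2 : GRing.comm (t i) (jm j) by apply: IH => //; lia.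
  by apply: commrD => //; apply: commrM => //; apply: commrM.
(* What remains is [jm i.+2 = b a y a b + b a b + b]. The braid relation carries [a] through the
   first term ([e1]); the other two are compared by the quadratic relation ([e2], [e3]). *)
have jE : j = i.+1 by lia.
rewrite jE !jmS; set a := t i; set b := t i.+1; set y := jm i.
have bab : a * b * a = b * a * b by apply: hb; lia.
have aa : a * a = 1 + z *: a by apply: hq.
have byE : b * y = y * b by apply: IH; lia.
rewrite /GRing.comm !(mulrDr, mulrDl, mulrA).
have e1 : a * b * a * y * a * b = b * a * y * a * b * a.
  rewrite bab -[b * a * b * y]mulrA byE !mulrA.
  by rewrite -!(mulrA (b * a * y)) -bab.
have bb : b * b = 1 + z *: b by apply: hq; lia.
have e2 : a * b * a * b = b * a + z *: (b * a * b).
  by rewrite bab -[b * a * b * b]mulrA bb mulrDr mulr1 -scalerAr.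
have e3 : b * a * b * a = a * b + z *: (b * a * b).
  by rewrite -bab -[a * b * a * a]mulrA aa mulrDr mulr1 -scalerAr.
by rewrite e1 e2 e3 -!addrA; congr (_ + _); rewrite addrC -addrA addrCA.
Qed.

Lemma gen_comm_t j k a : (j < k)%N -> (k < n)%N -> gen j a -> GRing.comm (t k) a.
Proof.
by move=> jk kn; apply: gen_comm => i ij; apply/commr_sym/comm_t => //; lia.
Qed.

Lemma gen_comm_jm j k a : (j < k)%N -> (k <= n)%N -> gen j a -> GRing.comm (jm k) a.
Proof.
by move=> jk kn; apply: gen_comm => i ij; apply/commr_sym/comm_t_jm; lia.
Qed.

Lemma jm_comm j k : (j <= n)%N -> (k <= n)%N -> GRing.comm (jm j) (jm k).
Proof.
move=> jn kn; case: (ltngtP j k) => [jk|jk|-> //].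
  exact/commr_sym/gen_comm_jm/gen_jm.
exact/gen_comm_jm/gen_jm.
Qed.

Lemma comm_horner a b p : GRing.comm a b -> GRing.comm a (horner_alg b p).
Proof. exact: horner_alg_intertwine. Qed.

(* The intertwiner: it exchanges [jm r] and [jm r.+1], and its square is a
   polynomial in them. *)
Definition itw r := t r * (jm r - jm r.+1) + (1 + z *: jm r.+1).

Section Intertwiner.
Variable r : nat.
Hypothesis rn : (r < n)%N.
Local Notation y := (jm r).
Local Notation y' := (jm r.+1).
Local Notation u := (itw r).

Let tt : t r * t r = 1 + z *: t r. Proof. by have [_ _] := t_hecke; exact. Qed.
Let yy' : GRing.comm y y'. Proof. by apply: jm_comm => //; exact: ltnW. Qed.

Lemma jm_t : y' * t r = t r * y + (1 + z *: y').
Proof.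
rewrite jmS mulrDl -[_ * t r * t r]mulrA tt mulrDr mulr1 -scalerAr scalerDr -addrA.
by congr (_ + _); rewrite addrCA.
Qed.

Lemma t_jmS : t r * y' = y * t r + (1 + z *: y').
Proof.
rewrite jmS mulrDr !mulrA tt !mulrDl mul1r -!scalerAl scalerDr -addrA.
by congr (_ + _); rewrite addrCA.
Qed.

Lemma itwE : u = (y' - y) * t r - (1 + z *: y').
Proof.
have e : t r * y = y' * t r - (1 + z *: y') by rewrite jm_t addrK.
rewrite /itw mulrBr e t_jmS mulrBl; move: (1 + _) => b.
by rewrite opprD addrA subrK addrAC.
Qed.

Lemma itw_jm : u * y = y' * u.
Proof.
have e : t r * y = y' * t r - (1 + z *: y') by rewrite jm_t addrK.
have e2 : (y - y') * y = y * (y - y') by rewrite mulrBl mulrBr yy'.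
have c : GRing.comm y' (1 + z *: y').
  by apply: commrD; [exact: commr1|rewrite /GRing.comm -scalerAr -scalerAl].
rewrite /itw mulrDl -mulrA e2 mulrA e mulrBl [RHS]mulrDr -!mulrA -addrA; congr (_ + _).
by rewrite mulrBr opprB subrK c.
Qed.

Lemma itw_jmS : u * y' = y * u.
Proof.
have c : GRing.comm y' (1 + z *: y').
  by apply: commrD; [exact: commr1|rewrite /GRing.comm -scalerAr -scalerAl].
have e2 : (y - y') * y' = y' * (y - y') by rewrite mulrBl mulrBr yy'.
rewrite /itw mulrDl -mulrA e2 mulrA t_jmS mulrDl [RHS]mulrDr -!mulrA -addrA; congr (_ + _).
by rewrite -mulrDr subrK mulrDl mulrDr mul1r mulr1 -scalerAl -scalerAr yy'.
Qed.

Lemma itw_sqr : u * u = (1 + z *: y) * (1 + z *: y') - (y - y') * (y - y').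
Proof.
have c1 : u * (1 + z *: y') = (1 + z *: y) * u.
  by rewrite mulrDr mulr1 -scalerAr itw_jmS mulrDl mul1r -scalerAl.
have ut : u * t r = (y' - y) - (1 + z *: y) * t r.
  rewrite itwE mulrBl -mulrA tt mulrDr mulr1 -addrA; congr (_ + _).
  rewrite -scalerAr scalerAl -mulrBl -mulNr; congr (_ * _).
  rewrite scalerBr; move: (z *: y') (z *: y) => a b.
  by rewrite !opprD [- 1 - a]addrC [a - b]addrC addrA addrK addrC.
have e : t r * (y - y') = u - (1 + z *: y') by rewrite /itw addrK.
rewrite {2}/itw mulrDr mulrA ut mulrBl -[_ * t r * _]mulrA e c1.
rewrite [(1 + _) * (u - _)]mulrBr -[y' - y]opprB mulNr.
move: (_ * _) (_ * u) (_ * (1 + _)) => a b d.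
by rewrite opprB addrA subrK addrC.
Qed.

End Intertwiner.

Lemma itw_comm r a : GRing.comm a (t r) -> GRing.comm a (jm r) -> GRing.comm a (jm r.+1) ->
  GRing.comm a (itw r).
Proof.
move=> h0 h1 h2; apply: commrD; last first.
  by apply: commrD; [exact: commr1|rewrite /GRing.comm -scalerAr -scalerAl h2].
by apply: commrM => //; apply: commrB.
Qed.

(** Recovers the action of a generator on a joint eigenvector from that of the intertwiner, which
    permutes eigenspaces. *)
Lemma t_eigen r w (a b : C) : (r < n)%N -> jm r * w = a *: w -> jm r.+1 * w = b *: w ->
  (a - b) *: (t r * w) = itw r * w - (1 + z * b) *: w.
Proof.
move=> rn ha hb; rewrite /itw mulrDl [(1 + _ *: _) * w]mulrDl mul1r -scalerAl hb.
rewrite -mulrA [(_ - _) * w]mulrBl ha hb.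
by rewrite -scalerBl -scalerAr scalerA scalerDl scale1r addrK.
Qed.

Lemma itw_sqr_eigen r w (a b : C) : (r < n)%N -> jm r * w = a *: w -> jm r.+1 * w = b *: w ->
  itw r * (itw r * w) = ((1 + z * a) * (1 + z * b) - (a - b) ^+ 2) *: w.
Proof.
move=> rn ha hb; rewrite mulrA itw_sqr // mulrBl -!mulrA.
have h1 : (1 + z *: jm r.+1) * w = (1 + z * b) *: w.
  by rewrite mulrDl mul1r -scalerAl hb scalerA scalerDl scale1r.
have h2 : (1 + z *: jm r) * w = (1 + z * a) *: w.
  by rewrite mulrDl mul1r -scalerAl ha scalerA scalerDl scale1r.
have h3 : (jm r - jm r.+1) * w = (a - b) *: w by rewrite mulrBl ha hb scalerBl.
by rewrite h1 -scalerAr h2 h3 -scalerAr h3 !scalerA -scalerBl; congr (_ *: _); ring.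
Qed.

(* The idempotent of a tableau: the Jucys-Murphy element [jm j] is projected on
   its eigenvalue at the node [j] by Lagrange interpolation. *)
Fixpoint et s : A :=
  if s is x :: s' then et s' * horner_alg (jm (size s')) (lag q s' x) else 1.

Fixpoint eig s w : Prop :=
  if s is x :: s' then jm (size s') * w = kap x *: w /\ eig s' w else True.

Fixpoint eigr s w : Prop :=
  if s is x :: s' then w * jm (size s') = kap x *: w /\ eigr s' w else True.

Lemma gen_et s : gen (size s).-1 (et s).
Proof.
elim: s => [|x s IH] /=; first exact: gen1.
by apply: GenM; [apply: gen_widen IH; exact: leq_pred|exact: gen_horner].
Qed.

Lemma et_comm_jm s k : (size s <= n.+1)%N -> (k <= n)%N -> GRing.comm (et s) (jm k).
Proof.
elim: s => [|x s IH] /= sn kn; first exact/commr_sym/commr1.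
apply/commr_sym/commrM; first by apply/commr_sym/IH => //; lia.
by apply: comm_horner; exact: jm_comm.
Qed.

Lemma eig_mulr s w a : eig s w -> eig s (w * a).
Proof. by elim: s => //= x s IH [h /IH]; rewrite mulrA h scalerAl. Qed.

Lemma eig_mull s w a : (forall i, (i < size s)%N -> GRing.comm a (jm i)) ->
  eig s w -> eig s (a * w).
Proof.
elim: s => //= x s IH ha [h hs]; rewrite mulrA -(ha (size s)) // -mulrA h -scalerAr.
by split=> //; apply: IH => // i ilt; apply: ha; exact: ltnW.
Qed.

Lemma eigrP s w : (forall i, (i < size s)%N -> GRing.comm w (jm i)) -> eig s w -> eigr s w.
Proof.
elim: s => //= x s IH hw [h hs]; rewrite hw // h; split=> //.
by apply: IH => // i ilt; apply: hw; exact: ltnW.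
Qed.

Lemma et_mul s w : rtab s -> eig s w -> et s * w = w.
Proof.
elim: s => [|x s IH] /=; first by rewrite mul1r.
move=> /andP[ax hs] [h1 h2]; rewrite -mulrA (horner_alg_eigen _ h1).
by rewrite horner_lag // ?mem_adds // eqxx scale1r IH.
Qed.

Lemma mul_et s w : rtab s -> eigr s w -> w * et s = w.
Proof.
elim: s => [|x s IH] /=; first by rewrite mulr1.
move=> /andP[ax hs] [h1 h2]; rewrite mulrA (IH hs h2) (horner_alg_eigenr _ h1).
by rewrite horner_lag // ?mem_adds // eqxx scale1r.
Qed.

Lemma et_mul0 s s' w : rtab s -> rtab s' -> size s = size s' -> s != s' ->
  eig s w -> et s' * w = 0.
Proof.
elim: s s' => [|x s IH] [|x' s'] //= /andP[ax hs] /andP[ax' hs'] [e] ne [h1 h2].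
rewrite -mulrA -e (horner_alg_eigen _ h1) -scalerAr.
have [ss|ss] := eqVneq s s'; last by rewrite (IH s') // scaler0.
move: ne ax'; rewrite -ss eqseq_cons eqxx andbT => ne ax'.
by rewrite horner_lag ?mem_adds // (negPf ne) scale0r.
Qed.

Lemma et_sum_adds s : rtab s -> et s = \sum_(x <- adds s) et (x :: s).
Proof.
move=> hs /=; rewrite -mulr_sumr -raddf_sum /=.
by rewrite sum_lag // rmorph1 mulr1.
Qed.

(* After the nodes [s], the next Jucys-Murphy element has no eigenvalue besides
   the q-contents of the addable nodes. *)
Definition split s := horner_alg (jm (size s)) (qroots q s) * et s = 0.

(** By [lag_qroots], the factor [jm - kap x] turns the interpolation polynomial of the last node
    into a multiple of [qroots], which the splitting property annihilates. *)
Lemma eig_et s : rtab s -> (size s <= n.+1)%N ->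
  (forall s', rtab s' -> (size s' < size s)%N -> split s') -> eig s (et s).
Proof.
elim: s => //= x s IH /andP[ax hs] sn hsp; split; last first.
  by apply/eig_mulr/IH => //; [lia|move=> s' h1 h2; apply: hsp => //; lia].
have [|c hc] := lag_qroots q (x := x) hs; first by rewrite mem_adds.
have := congr1 (fun p => horner_alg (jm (size s)) p * et s) hc.
rewrite -mul_polyC !(rmorphM (horner_alg _)) rmorphB /= horner_algX !horner_algC mulr_algl -scalerAl.
rewrite [horner_alg _ (qroots _ _) * _]hsp // scaler0 -mulrA mulrBl mulr_algl => /eqP; rewrite subr_eq0 => /eqP.
have ch p : GRing.comm (et s) (horner_alg (jm (size s)) p).
  by apply: comm_horner; apply: et_comm_jm => //; lia.
by rewrite (ch (lag q s x)) => ->.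
Qed.

(* No eigenvalue other than the contents of the addable nodes occurs. *)
Lemma split_eigen s w (v : C) : rtab s -> split s -> et s * w = w -> jm (size s) * w = v *: w ->
  v \notin [seq kap x | x <- adds s] -> w = 0.
Proof.
move=> hs sp ew hw nv; have := congr1 (fun a => a * w) sp.
rewrite mul0r -mulrA ew (horner_alg_eigen _ hw) => /eqP.
rewrite scaler_eq0 => /orP[|/eqP//]; rewrite horner_prod => /eqP p0.
case/negP: nv; move/eqP: p0; rewrite prodf_seq_eq0 => /hasP[x ax /=].
by rewrite !hornerE subr_eq0 => /eqP->; apply: map_f.
Qed.

(** * The spectrum of the next Jucys-Murphy element *)

Definition split_below r := forall s, rtab s -> (size s < r)%N -> split s.

Lemma itw_eig s w r : (size s <= r)%N -> (r < n)%N -> eig s w -> eig s (itw r * w).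
Proof.
move=> sr rn; apply: eig_mull => i ilt; apply/commr_sym/itw_comm.
- by apply/commr_sym/comm_t_jm => //; lia.
- by apply: jm_comm; lia.
- by apply: jm_comm; lia.
Qed.

(* Two neighbouring generators act by scalars [al != be] on such a [w]: this
   contradicts the braid relation. *)
Lemma eig_zigzag s x v w : rtab (x :: v :: s) -> ((size s).+2 <= n)%N ->
  split s -> split (v :: s) -> (content v == content x + 1) || (content x == content v + 1) ->
  eig (x :: v :: s) w -> jm (size s).+2 * w = kap v *: w -> w = 0.
Proof.
move=> hx sn sp spv adj [/= hx1 [hv1 hs]] h2.
have hvs : rtab (v :: s) by move: hx => /= /andP[_].
have [ax [av hs0]] : addable (v :: s) x /\ addable s v /\ rtab s.
  by move: hx => /= /andP[-> /andP[-> ->]].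
set r := size s in sn hx1 hv1 h2 *.
have rn : (r < n)%N by lia.
have kne : kap x != kap v.
  by apply/eqP => /(qcont_inj q_neq0 qnum_neq0); lia.
(* Each of the two intertwiners would produce an eigenvector whose last content is adjacent to that
   of a node addable to the same diagram, against [addable_content_nadj]. *)
have u1 : itw r * w = 0.
  apply: (split_eigen (v := kap x) hs0 sp).
  - by apply: et_mul => //; apply: itw_eig.
  - by rewrite mulrA -itw_jmS // -mulrA [jm r.+1 * w]hx1 scalerAr.
  apply/mapP => -[y ay /(qcont_inj q_neq0 qnum_neq0) e].
  rewrite mem_adds // in ay; have n1 := addable_content_nadj hs0 ay av.
  by have n2 := addable_content_nadj hs0 av ay; lia.
have u2 : itw r.+1 * w = 0.
  apply: (split_eigen (s := v :: s) (v := kap v)) => //.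
  - apply: et_mul => //; split; last by apply: itw_eig => //; lia.
    rewrite mulrA; have -> : GRing.comm (jm r) (itw r.+1).
      apply: itw_comm; [|by apply: jm_comm; lia..].
      by apply/commr_sym/comm_t_jm; lia.
    by rewrite -mulrA hv1 scalerAr.
  - by rewrite mulrA -itw_jmS // -mulrA [jm r.+2 * w]h2 scalerAr.
  apply/mapP => -[y ay /(qcont_inj q_neq0 qnum_neq0) e].
  rewrite mem_adds // in ay; have n1 := addable_content_nadj hvs ay ax.
  by have n2 := addable_content_nadj hvs ax ay; lia.
have [hb _ _] := t_hecke.
have t1 := t_eigen rn hv1 hx1; rewrite u1 sub0r in t1.
have t2 := t_eigen sn hx1 h2; rewrite u2 sub0r in t2.
have dv : kap v - kap x != 0 by rewrite subr_eq0 eq_sym.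
(* Now both generators act on [w] by scalars and the braid relation reads [al be al = be al be]. As
   both scalars are nonzero, [al = be]; for adjacent contents this means 1 + q^2 = 0, against 2_q !=
   0. *)
set al := - (1 + z * kap x) / (kap v - kap x).
set be := (1 + z * kap v) / (kap v - kap x).
have e1 : t r * w = al *: w.
  apply: (scalerI dv); rewrite t1 scalerA -scaleNr; congr (_ *: _).
  by rewrite [RHS]mulrC /al divfK.
have e2 : t r.+1 * w = be *: w.
  apply: (scalerI dv); rewrite -[in LHS]opprB scaleNr t2 scalerA opprK; congr (_ *: _).
  by rewrite [RHS]mulrC /be divfK.
have := congr1 (fun a => a * w) (hb r sn).
rewrite -!mulrA !(e1, e2, =^~ scalerAr) !scalerA => /eqP.
rewrite -subr_eq0 -scalerBl scaler_eq0 => /orP[|/eqP//].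
have zk c : 1 + z * qcont q c != 0 by rewrite qcont_sqr // expf_neq0 // expfz_neq0.
have al0 : al != 0 by rewrite mulf_neq0 ?invr_eq0 // oppr_eq0.
have be0 : be != 0 by rewrite mulf_neq0 ?invr_eq0.
have -> : al * be * al - be * al * be = al * be * (al - be).
  by rewrite mulrBr [be * al]mulrC.
rewrite (mulf_eq0 (al * be)) (mulf_eq0 al be) (negPf al0) (negPf be0) subr_eq0 /= /al /be => /eqP e; exfalso.
have {e} /eqP : - (1 + z * kap x) = 1 + z * kap v.
  by apply: (mulIf (x := (kap v - kap x)^-1)) => //; rewrite invr_eq0.
rewrite eq_sym -addr_eq0 !qcont_sqr //.
have q2 : 1 + q ^+ 2 != 0.
  have := @qnum_neq0 2 isT; apply: contra => /eqP h.
  rewrite qnumS // qnumS // /qnum big_ord0 expr0 invr1 mulr0 add0r mulr1 expr1.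
  have -> : q + q^-1 = q^-1 * (1 + q ^+ 2) by field.
  by rewrite h mulr0.
have qc c : (q ^ c) ^+ 2 != 0 by rewrite expf_neq0 // expfz_neq0.
have fin X : X ^+ 2 * (1 + q ^+ 2) = 0 -> X ^+ 2 != 0 -> False.
  by move=> /eqP; rewrite mulf_eq0 (negPf q2) orbF => ->.
case/orP: adj => /eqP ->; rewrite expfzDr // expr1z exprMn => /eqP h.
  by apply: (fin (q ^ content x)) => //; rewrite -h; ring.
by apply: (fin (q ^ content v)) => //; rewrite -h; ring.
Qed.

(** Equivalence of two idempotents inside a subalgebra: a functional that is cyclic for this
    subalgebra takes the same value on both. *)
Definition link s s' := exists a b,
  [/\ gen (size s).-1 a, gen (size s).-1 b, a * b = et s & b * a = et s'].

Lemma et_idem s : rtab s -> (size s <= n.+1)%N -> split_below (size s) ->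
  et s * et s = et s.
Proof. by move=> hs sn sp; apply: et_mul => //; apply: eig_et. Qed.

Lemma link_trans s1 s2 s3 : et s1 * et s1 = et s1 -> et s3 * et s3 = et s3 ->
  size s1 = size s2 -> link s1 s2 -> link s2 s3 -> link s1 s3.
Proof.
move=> i1 i3 e [a [b [ga gb h1 h2]]] [c [d [gc gd h3 h4]]].
rewrite -e in gc gd; exists (a * c), (d * b); split; [exact: GenM..| |].
  by rewrite -mulrA (mulrA c) h3 -h2 -mulrA h1 mulrA h1.
by rewrite -mulrA (mulrA b) h2 -h3 -mulrA h4 mulrA h4.
Qed.

Lemma gen_pred_comm_jm r a : (r <= n)%N -> gen r.-1 a -> GRing.comm a (jm r).
Proof.
case: r => [|r] rn ga; first exact: commr0.
by apply/commr_sym; apply: (gen_comm_jm (j := r)).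
Qed.

(** The interpolation factor of [x] depends only on the set of earlier nodes, and it commutes with
    [a] and [b]. *)
Lemma link_cons s s' x : rtab (x :: s) -> rtab s' -> perm_eq s s' ->
  ((size s).+1 <= n.+1)%N -> split_below (size s).+1 -> link s s' -> link (x :: s) (x :: s').
Proof.
move=> hx hs' pe sn sp [a [b [ga gb h1 h2]]].
have [ax hs] := andP (hx : addable s x && rtab s).
have hx' : rtab (x :: s') by rewrite /= hs' -(eq_addable pe) ax.
have i1 : et (x :: s) * et (x :: s) = et (x :: s) by apply: et_idem.
have i2 : et (x :: s') * et (x :: s') = et (x :: s').
  by apply: et_idem; rewrite //= -(perm_size pe).
have j1 : et s * et s = et s.
  by apply: et_idem => //; [exact: ltnW|move=> w hw lw; apply: sp => //; exact: ltnW].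
have j2 : et s' * et s' = et s'.
  apply: et_idem; rewrite -?(perm_size pe) //; first exact: ltnW.
  by move=> w hw lw; apply: sp => //; exact: ltnW.
have le : lag q s' x = lag q s x by rewrite /lag (perm_adds pe).
move: i1 i2; rewrite /= -(perm_size pe) le; set L := horner_alg _ _ => i1 i2.
have cL d : gen (size s).-1 d -> GRing.comm d L.
  by move=> gd; apply: comm_horner; apply: gen_pred_comm_jm.
have gL : gen (size s) L by exact: gen_horner.
have gW d : gen (size s).-1 d -> gen (size s) (d * L).
  by move=> gd; apply: GenM => //; apply: gen_widen gd; exact: leq_pred.
have ce : GRing.comm (et s) L by rewrite -h1; apply/commr_sym/commrM; apply/commr_sym/cL.
have ce' : GRing.comm (et s') L by rewrite -h2; apply/commr_sym/commrM; apply/commr_sym/cL.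
exists (a * L), (b * L); split=> /=; [exact: gW..| |].
  by rewrite -i1 -mulrA (mulrA L) -(cL b) // !mulrA h1 -(mulrA _ L (et s)) -ce !mulrA j1.
by rewrite -(perm_size pe) le -/L -i2 -mulrA (mulrA L) -(cL a) // !mulrA h2 -(mulrA _ L (et s')) -ce' !mulrA j2.
Qed.

Lemma itw_swap_eig s x v w : ((size s).+1 <= n)%N -> eig (x :: v :: s) w ->
  eig (v :: x :: s) (itw (size s) * w).
Proof.
move=> sn [h1 [h2 h3]]; split; last split.
- by rewrite mulrA -itw_jm // -mulrA [jm (size s) * w]h2 scalerAr.
- by rewrite mulrA -itw_jmS // -mulrA [jm (size s).+1 * w]h1 scalerAr.
exact: itw_eig.
Qed.

(** As a polynomial in the q-content of [d], this scalar has the q-contents of [c + 1] and [c - 1]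
    as its roots. *)
Lemma swap_scalar_neq0 (c d : int) : c != d -> c != d + 1 -> d != c + 1 ->
  (1 + z * qcont q c) * (1 + z * qcont q d) - (qcont q c - qcont q d) ^+ 2 != 0.
Proof.
move=> cd cd1 dc1; have e : qcont q c = q ^+ 2 * qcont q (c - 1) + q.
  by rewrite -qcontS // subrK.
have -> : (1 + z * qcont q c) * (1 + z * qcont q d) - (qcont q c - qcont q d) ^+ 2 =
    - ((qcont q d - qcont q (c + 1)) * (qcont q d - qcont q (c - 1))).
  by rewrite qcontS // e; field.
rewrite oppr_eq0 mulf_neq0 // subr_eq0; apply/eqP => /(qcont_inj q_neq0 qnum_neq0) h; lia.
Qed.

Lemma gen_itw r : gen r.+1 (itw r).
Proof.
have g k : (k <= r.+1)%N -> gen r.+1 (jm k) by move=> kr; apply: gen_widen (gen_jm k).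
apply: GenD; last by apply: GenD; [exact: gen1|apply/genZ/g].
apply: GenM; first exact: GenT.
by rewrite -scaleN1r; apply: GenD; [apply: g|apply/genZ/g].
Qed.

(** The intertwiner exchanges the last two eigenvalues, and its square is a scalar on the
    eigenspace, nonzero since the contents of two addable nodes are neither equal nor adjacent. *)
Lemma link_swap s x v : rtab s -> addable s x -> addable s v -> x != v ->
  ((size s).+2 <= n.+1)%N -> split_below (size s).+2 ->
  link (x :: v :: s) (v :: x :: s).
Proof.
move=> hs ax av xv sn sp; rewrite ltnS in sn.
have h1 : rtab (x :: v :: s) by rewrite /= addable_cons // av.
have h2 : rtab (v :: x :: s) by rewrite /= addable_cons 1?eq_sym // ax.
have g1 : eig (x :: v :: s) (et (x :: v :: s)) by apply: eig_et.
have g2 : eig (v :: x :: s) (et (v :: x :: s)) by apply: eig_et.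
set e1 := et (x :: v :: s) in g1 *; set e2 := et (v :: x :: s) in g2 *.
set r := size s in sn *; set u := itw r.
set f := (1 + z * kap v) * (1 + z * kap x) - (kap v - kap x) ^+ 2.
have f0 : f != 0.
  apply: swap_scalar_neq0; [|by apply: addable_content_nadj hs _ _..].
  by apply: contra xv => /eqP e; apply/eqP/(addable_content_inj hs ax av).
have ue1 : e2 * (u * e1) = u * e1 by apply: et_mul => //; apply: itw_swap_eig.
have ue2 : e1 * (u * e2) = u * e2 by apply: et_mul => //; apply: itw_swap_eig.
have uu1 : u * (u * e1) = f *: e1.
  by case: g1 => k1 [k2 _]; apply: itw_sqr_eigen.
have uu2 : u * (u * e2) = f *: e2.
  case: g2 => k1 [k2 _]; rewrite (itw_sqr_eigen _ k2 k1) //; congr (_ *: _).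
  by rewrite /f; ring.
have gu : gen r.+1 u by exact: gen_itw.
exists (f^-1 *: (u * e2)), (u * e1); split.
- by apply/genZ/GenM => //; exact: (gen_et (v :: x :: s)).
- by apply/GenM => //; exact: (gen_et (x :: v :: s)).
- by rewrite -scalerAl -mulrA ue1 uu1 scalerA mulVf // scale1r.
by rewrite -scalerAr -mulrA ue2 uu2 scalerA mulVf // scale1r.
Qed.

Lemma corner_head s x : rtab (x :: s) -> corner (x :: s) x.
Proof.
move=> /= /andP[ax hs]; have [nx _ _] := and3P ax; rewrite /corner !inE eqxx /=.
case: x ax nx => [i j] ax nx; rewrite /= !xpair_eqE !negb_or.
apply/andP; split; apply/andP; split.
- by rewrite negb_and; apply/orP; left; lia.
- by apply: contra nx => h; apply: rtab_closed hs h _ _.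
- by rewrite negb_and; apply/orP; right; lia.
- by apply: contra nx => h; apply: rtab_closed hs h _ _.
Qed.

Lemma eq_corner s s' : perm_eq s s' -> corner s =1 corner s'.
Proof. by move=> /perm_mem e x; rewrite /corner !e. Qed.

Lemma link_perm s s' : rtab s -> rtab s' -> perm_eq s s' -> (size s <= n.+1)%N ->
  split_below (size s) -> link s s'.
Proof.
elim: {s}_.+1 {-2}s s' (ltnSn (size s)) => // k IH s s' sk hs hs' pe sn sp.
case: s s' sk hs hs' pe sn sp => [|x s] [|x' s'] sk hs hs' pe sn sp.
- by exists 1, 1; split; rewrite ?mulr1 //; exact: gen1.
- by have := perm_size pe.
- by have := perm_size pe.
have sp' : split_below (size s) by move=> w hw lw; apply: sp => //=; exact: ltnW.
have [ax hs0] := andP (hs : addable s x && rtab s).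
have [ax' hs0'] := andP (hs' : addable s' x' && rtab s').
have [xx|xx] := eqVneq x x'.
  rewrite -xx in hs' pe ax' *; have pe' : perm_eq s s' by rewrite -(perm_cons x).
  by apply: link_cons => //; apply: IH => //; exact: ltnW.
have cx' : corner (x :: s) x' by rewrite (eq_corner pe) corner_head.
have x's : x' \in s by case/and3P: cx'; rewrite inE eq_sym (negPf xx).
have cx's : corner s x'.
  case/and3P: cx' => _; rewrite !inE !negb_or => /andP[_ c1] /andP[_ c2].
  by rewrite /corner x's c1.
(* [x'] is a corner of [s], so it can be brought next to [x]. The chain is [x :: s],
   [x :: x' :: t0], [x' :: x :: t0], [x' :: s']; only the middle link is a swap, the outer ones come
   from the induction. *)
set t0 := rem x' s; have ht0 : rtab t0 by exact: rtab_rem.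
have at0 : addable t0 x' by exact: corner_addable_rem.
have at1 : addable t0 x.
  have := rtab_rem hs cx'; rewrite /= (negPf xx) /=; by case/andP.
have ps : perm_eq s (x' :: t0) by exact: perm_to_rem.
have ps' : perm_eq (x :: t0) s'.
  rewrite -(perm_cons x') -(permPr pe) -[_ :: _ :: _]/([:: x'] ++ [:: x] ++ t0).
  by rewrite perm_catCA /= perm_cons perm_sym.
have st : size s = (size t0).+1 by rewrite (perm_size ps).
have h1 : rtab (x' :: t0) by rewrite /= at0.
have h2 : rtab (x :: t0) by rewrite /= at1.
have k1 : link (x :: s) (x :: x' :: t0).
  by apply: link_cons => //; apply: IH => //; exact: ltnW.
have k2 : link (x :: x' :: t0) (x' :: x :: t0).
  by apply: link_swap => //; rewrite -st.
have k3 : link (x' :: x :: t0) (x' :: s').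
  have h3 : rtab (x' :: x :: t0) by rewrite /= addable_cons 1?eq_sym // at1.
  apply: link_cons; rewrite //= -?st //.
  by apply: IH; rewrite //= -?st //; exact: ltnW.
have i1 : et (x :: s) * et (x :: s) = et (x :: s) by apply: et_idem.
have i3 : et (x' :: s') * et (x' :: s') = et (x' :: s').
  by apply: et_idem; rewrite // -(perm_size pe).
have h3 : rtab (x' :: x :: t0) by rewrite /= addable_cons 1?eq_sym // at1.
have i2 : et (x' :: x :: t0) * et (x' :: x :: t0) = et (x' :: x :: t0).
  by apply: et_idem; rewrite //= -st.
apply: (link_trans i1 i3 _ _ k3); first by rewrite /= st.
by apply: (link_trans i1 i2 _ k1 k2); rewrite /= st.
Qed.

(** With equal eigenvalues, [t r * w] is sent by [jm r - kap x] to a nonzero multiple of [w]. This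
    would be a Jordan block, whereas [qroots] has simple roots. *)
Lemma eig_repeat s x w : rtab (x :: s) -> (size s < n)%N -> split s ->
  eig (x :: s) w -> jm (size s).+1 * w = kap x *: w -> w = 0.
Proof.
move=> hx sn sp [h1 hs] h2; have [ax hs0] := andP (hx : addable s x && rtab s).
set r := size s in sn h1 h2 *; set w' := t r * w.
have e1 : jm r * w' - kap x *: w' = - ((1 + z * kap x) *: w).
  have := congr1 (fun a => a * w) (t_jmS sn).
  rewrite -mulrA h2 -scalerAr [(_ + _) * w]mulrDl -[jm r * t r * w]mulrA => ->.
  rewrite opprD addrA subrr sub0r mulrDl mul1r -scalerAl h2 scalerA.
  by rewrite scalerDl scale1r.
have ew' : et s * w' = w'.
  apply: et_mul => //; apply: eig_mull => // i ilt.
  by apply: comm_t_jm => //; lia.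
have [|c hc] := lag_qroots q (x := x) hs0; first by rewrite mem_adds.
have := congr1 (fun p => horner_alg (jm r) p * w') hc.
rewrite -mul_polyC mulrC !(rmorphM (horner_alg _)) rmorphB /= horner_algX !horner_algC.
rewrite -!mulrA -[in X in _ = X]ew' (mulrA (horner_alg _ _) (et s)) [horner_alg _ _ * et s]sp.
rewrite mul0r mulr0 mulrBl mulr_algl e1 mulrN -scalerAr (horner_alg_eigen _ h1).
rewrite horner_lag // ?mem_adds // eqxx scale1r => /eqP.
rewrite oppr_eq0 scaler_eq0 qcont_sqr // expf_eq0 /= (negPf (expfz_neq0 _ q_neq0)).
by move/eqP.
Qed.

(** A linear factor whose root cannot be an eigenvalue may be cancelled from an annihilating
    polynomial. The factor [g] accumulates what has been kept. *)
Lemma horner_prune (good : pred C) (rs : seq C) (g : {poly C}) (Y e : A) :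
  (forall p (v : C), v \in rs -> ~~ good v ->
     Y * (horner_alg Y p * e) = v *: (horner_alg Y p * e) -> horner_alg Y p * e = 0) ->
  horner_alg Y (\prod_(v <- rs) ('X - v%:P) * g) * e = 0 ->
  horner_alg Y (\prod_(v <- rs | good v) ('X - v%:P) * g) * e = 0.
Proof.
elim: rs g => [|v rs IH] g hbad; first by rewrite !big_nil.
rewrite !big_cons; case: ifP => gv h.
  rewrite -mulrA mulrCA; apply: IH; last by rewrite mulrCA mulrA.
  by move=> p a ars; apply: hbad; rewrite inE ars orbT.
apply: IH => [p a ars|]; first by apply: hbad; rewrite inE ars orbT.
apply: (hbad _ v); rewrite ?inE ?eqxx ?gv //; apply/eqP; rewrite -subr_eq0; apply/eqP.
rewrite -[RHS]h -[in RHS]mulrA [in RHS](rmorphM (horner_alg Y)) rmorphB /=.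
by rewrite horner_algX horner_algC -mulrA [in RHS]mulrBl mulr_algl.
Qed.

(** The intertwiner sends [e] to a vector killed by [qroots q s] at [jm r]. Carrying this back gives
    an annihilating polynomial of [jm r.+1] with the roots [rs]: the old q-contents and two new ones
    from the square of the intertwiner. The roots that do not belong to addable nodes are then
    removed: [kap x] by [eig_repeat], the new ones by [eig_zigzag]. *)
Lemma split_cons s x : rtab (x :: s) -> ((size s).+1 <= n)%N ->
  split_below (size s).+1 -> split (x :: s).
Proof.
move=> hx sn sp; have [ax hs] := andP (hx : addable s x && rtab s).
have sps : split s by apply: sp.
have spb : split_below (size s) by move=> w hw lw; apply: sp => //; exact: ltnW.
have ge : eig (x :: s) (et (x :: s)) by apply: eig_et => //; exact: ltnW.
set e := et (x :: s) in ge *; set r := size s in sn *.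
set c := content x; set rs := [seq kap v | v <- adds s] ++ [:: qcont q (c + 1); qcont q (c - 1)].
set good : pred C := fun v : C => v \in [seq kap v | v <- adds (x :: s)].
have rootsP : horner_alg (jm r.+1) (\prod_(v <- rs) ('X - v%:P) * 1) * e = 0.
  have e0 : horner_alg (jm r) (qroots q s) * (itw r * e) = 0.
    have -> : itw r * e = et s * (itw r * e).
      by rewrite et_mul //; apply: itw_eig => //; case: ge.
    by rewrite [LHS]mulrA (sps : horner_alg (jm r) _ * et s = 0) mul0r.
  (* On [e], [jm r] is the scalar [kap x] and [jm r.+1] becomes the variable. So the square of the
     intertwiner turns into a quadratic polynomial, minus the product of the linear factors for
     [c + 1] and [c - 1]. *)
  pose phi p := horner_alg (jm r.+1) p * e.
  have phiD p1 p2 : phi (p1 + p2) = phi p1 + phi p2 by rewrite /phi rmorphD mulrDl.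
  have phiZ k p : phi (k%:P * p) = k *: phi p.
    by rewrite /phi (rmorphM (horner_alg _)) /= horner_algC -mulrA mulr_algl.
  have phiX p : jm r.+1 * phi p = phi ('X * p).
    by rewrite /phi (rmorphM (horner_alg _)) /= horner_algX -mulrA.
  have phiy p : jm r * phi p = kap x *: phi p.
    have cy : GRing.comm (jm r) (horner_alg (jm r.+1) p).
      by apply/comm_horner/jm_comm => //; exact: ltnW.
    by rewrite /phi [LHS]mulrA cy -mulrA; case: ge => -> _; rewrite -scalerAr.
  have phiN p : phi (- p) = - phi p by rewrite -mulN1r -polyCN phiZ scaleN1r.
  have h1 p : (1 + z *: jm r.+1) * phi p = phi ((1 + z%:P * 'X) * p).
    by rewrite !mulrDl !mul1r -scalerAl phiX -mulrA phiD phiZ.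
  have h2 p : (1 + z *: jm r) * phi p = phi ((1 + z%:P * (kap x)%:P) * p).
    by rewrite !mulrDl !mul1r -scalerAl phiy -mulrA phiD !phiZ.
  have h3 p : (jm r - jm r.+1) * phi p = phi (((kap x)%:P - 'X) * p).
    by rewrite !mulrBl phiX phiy phiD phiN phiZ.
  have e1 : itw r * phi (qroots q s) = 0.
    by rewrite -[RHS]e0 /phi [LHS]mulrA (horner_alg_intertwine _ (itw_jmS sn)) -mulrA.
  have := congr1 (fun a => itw r * a) e1.
  rewrite mulr0 [itw r * _]mulrA itw_sqr // [(_ - _) * phi _]mulrBl.
  rewrite -[_ * _ * phi _]mulrA h1 h2 -[_ * _ * phi _]mulrA !h3 -phiN -phiD => h.
  rewrite -[LHS]/(phi _) big_cat big_map -/(qroots q s) /= 2!big_cons big_nil !mulr1.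
  apply/eqP; rewrite -oppr_eq0 -phiN -[X in _ == X]h; apply/eqP; congr (phi _).
  have cm : kap x = q ^+ 2 * qcont q (c - 1) + q by rewrite -qcontS // subrK.
  have sE : qcont q (c + 1) + qcont q (c - 1) = 2 * kap x + z + z * (z * kap x).
    by rewrite qcontS // -/c cm; field.
  have pE : qcont q (c + 1) * qcont q (c - 1) = kap x * kap x - z * kap x - 1.
    by rewrite qcontS // -/c cm; field.
  move: sE pE; move: (qcont q (c + 1)) (qcont q (c - 1)) => ka kb sE pE.
  have -> : ('X - ka%:P) * ('X - kb%:P) = 'X ^+ 2 - (ka + kb)%:P * 'X + (ka * kb)%:P.
    by rewrite polyCD polyCM; ring.
  rewrite sE pE !(polyCD, polyCM, polyCN, polyC1); ring.
have bad p (v : C) : v \in rs -> ~~ good v ->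
    jm r.+1 * (horner_alg (jm r.+1) p * e) = v *: (horner_alg (jm r.+1) p * e) ->
    horner_alg (jm r.+1) p * e = 0.
  set w := _ * e => vr bv hw.
  have gw : eig (x :: s) w.
    apply: eig_mull => // i ilt; apply/commr_sym/comm_horner/jm_comm => //.
    by apply: leq_trans sn; exact: ltnW.
  (* If no node of this content is addable after [x], then [not_addable_next] gives a corner [u] of
     [s] that has it. By [link_perm], [u] may be taken as the node just before [x], and there
     [eig_zigzag] applies. *)
  have zig (b : bool) : v = qcont q (if b then c + 1 else c - 1) -> w = 0.
    move=> ve; have [|u cu ue] := @not_addable_next s x b hs ax.
      move=> y ay; apply: contra bv => /eqP ye; rewrite /good ve -ye.
      by apply: (map_f (fun v => kap v)); rewrite mem_adds.
    set s0 := rem u s; have us : u \in s by case/and3P: cu.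
    have pe : perm_eq s (u :: s0) by exact: perm_to_rem.
    have hs0 : rtab s0 by exact: rtab_rem.
    have au : addable s0 u by exact: corner_addable_rem.
    have hu : rtab (u :: s0) by rewrite /= au.
    have axu : addable (u :: s0) x by rewrite -(eq_addable pe).
    have rE : r = (size s0).+1 by rewrite /r (perm_size pe).
    have rn1 : (r <= n.+1)%N by exact: leqW (ltnW sn).
    have [a1 [b1 [ga gb ab ba]]] := link_perm hs hu pe rn1 spb.
    have hw1 : et s * w = w by case: gw => _; apply: et_mul.
    have gu : eig (u :: s0) (b1 * w).
      have -> : b1 * w = et (u :: s0) * (b1 * w) by rewrite -ba -mulrA (mulrA a1) ab hw1.
      apply/eig_mulr/eig_et => //; first by rewrite -(perm_size pe).
      by rewrite -(perm_size pe).
    have gx : jm r * (b1 * w) = kap x *: (b1 * w).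
      rewrite [LHS]mulrA -(gen_pred_comm_jm _ gb); last exact: ltnW.
      by rewrite -[b1 * _ * w]mulrA; case: gw => -> _; rewrite -scalerAr.
    have gv : jm r.+1 * (b1 * w) = kap u *: (b1 * w).
      have cb : GRing.comm (jm r.+1) b1 by apply: gen_comm_jm gb => //; rewrite ltnS leq_pred.
      by rewrite [LHS]mulrA cb -[b1 * _ * w]mulrA hw -scalerAr ve ue.
    rewrite -hw1 -ab -mulrA (_ : b1 * w = 0) ?mulr0 //.
    rewrite rE in gx gv; apply: (eig_zigzag (x := x) (v := u) (s := s0)) => //.
    - by rewrite /= axu.
    - by rewrite -rE.
    - by apply: sp => //; rewrite -/r rE ltnS leqnSn.
    - by apply: sp => //; rewrite -/r rE.
    by rewrite ue /c; case: (b); rewrite ?eqxx // addrNK eqxx orbT.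
  move: vr; rewrite mem_cat => /orP[/mapP[y ay ve]|].
    have [yx|yx] := eqVneq y x.
      by apply: (eig_repeat hx) => //; rewrite -yx -ve.
    case/negP: bv; rewrite /good ve; apply: (map_f (fun v => kap v)).
    by rewrite mem_adds // addable_cons // -mem_adds.
  by rewrite !inE => /orP[/eqP/(zig true)|/eqP/(zig false)].
(* The remaining roots are simple and belong to addable nodes, so their product divides
   [qroots q (x :: s)]. *)
have := horner_prune bad rootsP; rewrite mulr1 => h.
set L := [seq kap v | v <- adds (x :: s)].
have uL : uniq L.
  rewrite map_inj_in_uniq ?adds_uniq // => y1 y2 a1 a2.
  exact: kap_adds_inj q_neq0 qnum_neq0 _ _ _ hx a1 a2.
have nadj y k : y \in adds s -> content y = k -> k != c + 1 /\ k != c - 1.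
  rewrite mem_adds // => ay <-; rewrite (addable_content_nadj hs ax ay); split=> //.
  by have := addable_content_nadj hs ay ax; apply: contra => /eqP->; rewrite subrK.
have urs : uniq rs.
  rewrite cat_uniq map_inj_in_uniq ?adds_uniq => [|y1 y2 a1 a2]; last first.
    exact: kap_adds_inj q_neq0 qnum_neq0 _ _ _ hs a1 a2.
  apply/and3P; split=> //=.
    rewrite orbF negb_or; apply/andP; split; apply/mapP => -[y ay];
      move=> /(qcont_inj q_neq0 qnum_neq0) e1; have [] := nadj y _ ay erefl;
      by rewrite e1 ?eqxx.
  rewrite inE andbT; apply/eqP => /(qcont_inj q_neq0 qnum_neq0); lia.
have pe : perm_eq [seq v <- rs | v \in L] [seq v <- L | v \in rs].
  apply: uniq_perm; rewrite ?filter_uniq // => v.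
  by rewrite !mem_filter andbC.
have QE : qroots q (x :: s) = \prod_(v <- L | v \in rs) ('X - v%:P) *
    \prod_(v <- L | v \notin rs) ('X - v%:P).
  have -> : qroots q (x :: s) = \prod_(v <- L) ('X - v%:P) by rewrite /L big_map.
  by rewrite [LHS](bigID (mem rs)).
rewrite /split QE -(big_filter L) -(perm_big _ pe) big_filter mulrC.
by rewrite (rmorphM (horner_alg _)) -mulrA [X in _ * X]h mulr0.
Qed.

Lemma split_all s : rtab s -> (size s <= n)%N -> split s.
Proof.
elim: {s}_.+1 {-2}s (ltnSn (size s)) => // k IH [|x s] sk hs sn.
  rewrite /split /qroots (_ : adds [::] = [:: (0, 0)%N]) // big_seq1 /= mulr1.
  by rewrite rmorphB /= horner_algX horner_algC qcont0 // scale0r subr0.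
by apply: split_cons => // s' hs' sn'; apply: IH => //; move: sk sn => /=; lia.
Qed.

Arguments et : simpl never.

Lemma split_belowT r : (r <= n.+1)%N -> split_below r.
Proof. by move=> rn s hs sr; apply: split_all => //; lia. Qed.

Lemma eigT s : rtab s -> (size s <= n.+1)%N -> eig s (et s).
Proof. by move=> hs sn; apply: eig_et => //; exact: split_belowT. Qed.

Lemma eigrT s : rtab s -> (size s <= n.+1)%N -> eigr s (et s).
Proof.
by move=> hs sn; apply: eigrP; [move=> i si; apply: et_comm_jm => //; lia|exact: eigT].
Qed.

Lemma idemT s : rtab s -> (size s <= n.+1)%N -> et s * et s = et s.
Proof. by move=> hs sn; apply: et_idem => //; exact: split_belowT. Qed.

Lemma orthoT s s' : rtab s -> rtab s' -> size s = size s' -> (size s <= n.+1)%N ->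
  s != s' -> et s * et s' = 0.
Proof.
move=> hs hs' e sn ne; apply: (@et_mul0 s') => //; first by rewrite eq_sym.
by apply: eigT => //; rewrite -e.
Qed.

(** * Seminormal form and primitivity of the idempotents *)

Fixpoint tabs r : seq (seq (nat * nat)) :=
  if r is r'.+1 then flatten [seq [seq x :: s | x <- adds s] | s <- tabs r'] else [:: [::]].

Lemma mem_tabs r s : s \in tabs r -> rtab s /\ size s = r.
Proof.
elim: r s => [|r IH] s; first by rewrite inE => /eqP->.
move=> /flatten_mapP[s' /IH[hs' e]] /mapP[x ax ->] /=; rewrite e.
by rewrite hs' -mem_adds // ax.
Qed.

Lemma sum_tabs r : \sum_(s <- tabs r) et s = 1.
Proof.
elim: r => [|r IH]; first by rewrite big_seq1.
rewrite big_flatten big_map -IH big_seq [RHS]big_seq; apply: eq_bigr => s /mem_tabs[hs _].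
by rewrite big_map -et_sum_adds.
Qed.

Inductive two_sided (j : nat) : A -> Prop :=
| TwoG a of gen j a : two_sided j a
| TwoM a b of gen j a & gen j b : two_sided j (a * t j * b)
| TwoD a b of two_sided j a & two_sided j b : two_sided j (a + b).

Lemma gen0 a : gen 0 a -> exists c, a = c%:A.
Proof.
elim=> [c|//|? ? _ [c ->] _ [d ->]|? ? _ [c ->] _ [d ->]]; first by exists c.
  by exists (c + d); rewrite scalerDl.
by exists (c * d); rewrite -scalerAl mul1r scalerA.
Qed.

Lemma two_sided_mull j a b : gen j a -> two_sided j b -> two_sided j (a * b).
Proof.
move=> ga; elim=> [c gc|c d gc gd|? ? _ h1 _ h2].
- by apply/TwoG/GenM.
- by rewrite !mulrA; apply: TwoM => //; exact: GenM.
- by rewrite mulrDr; exact: TwoD.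
Qed.

(** A normal form in which the top generator occurs at most once in each term. A product
    [t j * c * t j] with [c] in the smaller algebra is reduced by putting [c] itself in this form:
    then either the quadratic or the braid relation applies. *)
Lemma gen_two_sided j a : (j < n)%N -> gen j.+1 a -> two_sided j a.
Proof.
have [hb _ hq] := t_hecke.
elim: j a => [|j IH] a jn ga.
  suff tm b : two_sided 0 b -> two_sided 0 (t 0%N * b).
    have : two_sided 0 1 by apply/TwoG/gen1.
    rewrite -[a]mulr1; elim: ga (1 : A) => [c|[|//] _|c d _ h1 _ h2|c d _ h1 _ h2] b hb'.
    - by apply: two_sided_mull => //; exact: GenC.
    - exact: tm.
    - by rewrite mulrDl; apply: TwoD; auto.
    - by rewrite -mulrA; auto.
  elim=> [c gc|c d gc gd|? ? _ h1 _ h2]; last by rewrite mulrDr; exact: TwoD.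
    by rewrite -[t 0%N]mul1r; apply: TwoM => //; exact: gen1.
  have [k ->] := gen0 gc; rewrite mulr_algl -scalerAl -scalerAr mulrA hq //.
  rewrite mulrDl mul1r scalerDr; apply: TwoD; first exact/TwoG/genZ.
  by rewrite -scalerAl scalerA scalerAl -[t 0%N]mul1r scalerAl; apply: TwoM => //; exact/genZ/gen1.
have ct w : gen j w -> GRing.comm (t j.+1) w by move=> gw; apply: (gen_comm_t (j := j)).
have tm b : two_sided j.+1 b -> two_sided j.+1 (t j.+1 * b).
  elim=> [c gc|c d gc gd|? ? _ h1 _ h2]; last by rewrite mulrDr; exact: TwoD.
    by rewrite -[t j.+1]mul1r; apply: TwoM => //; exact: gen1.
  have {gc} := IH c (ltnW jn) gc; elim=> [e ge|e f ge gf|e f _ h1 _ h2].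
  - rewrite !mulrA (ct e) // -[e * _ * _]mulrA hq // mulrDr mulr1 mulrDl.
    apply: TwoD; first by apply/TwoG/GenM => //; apply: gen_widen ge.
    rewrite -scalerAr scalerAl; apply: TwoM => //; apply/genZ.
    by apply: gen_widen ge.
  - have -> : t j.+1 * (e * t j * f * t j.+1 * d) = (e * t j) * t j.+1 * (t j * f * d).
      rewrite !mulrA (ct e) // -(mulrA _ f (t j.+1)) -(ct f) // mulrA.
      by rewrite -!(mulrA e) -hb.
    have gt : gen j.+1 (t j) by exact: GenT.
    have ge' : gen j.+1 e by apply: gen_widen ge.
    have gf' : gen j.+1 f by apply: gen_widen gf.
    by apply: TwoM; apply: GenM => //; apply: GenM.
  - by rewrite !mulrDl mulrDr; exact: TwoD.
have : two_sided j.+1 1 by apply/TwoG/gen1.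
rewrite -[a]mulr1; elim: ga (1 : A) => [c|i ij|c d _ h1 _ h2|c d _ h1 _ h2] b hb'.
- by apply: two_sided_mull => //; exact: GenC.
- have [->|ne] := eqVneq i j.+1; first exact: tm.
  by apply: two_sided_mull => //; apply: GenT; lia.
- by rewrite mulrDl; apply: TwoD; auto.
- by rewrite -mulrA; auto.
Qed.

Lemma kap_next s (a x : nat * nat) : rtab s -> addable s a -> addable (a :: s) x -> kap a != kap x.
Proof.
move=> hs aa ax; apply/eqP => /(qcont_inj q_neq0 qnum_neq0) e.
by move: (addable_next_content hs aa ax); rewrite e eqxx.
Qed.

(** The intertwiner exchanges the last two eigenvalues of the right idempotent; the product vanishes
    unless the result fits the left one. *)
Lemma et_itw_et s (a x b x' : nat * nat) : rtab (x :: a :: s) -> rtab (x' :: b :: s) ->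
  (size s < n)%N -> (kap a != kap x') || (kap x != kap b) ->
  et (x :: a :: s) * (itw (size s) * et (x' :: b :: s)) = 0.
Proof.
move=> h1 h2 sn ne; have [r1 [r2 _]] := eigrT h1 sn.
have [l1 [l2 _]] : eig (b :: x' :: s) (itw (size s) * et (x' :: b :: s)).
  by apply: itw_swap_eig => //; exact: eigT.
set e1 := et (x :: _) in r1 r2 *; set w := _ * et _ in l1 l2 *.
have k1 : kap x *: (e1 * w) = kap b *: (e1 * w).
  by rewrite [LHS]scalerAl -r1 -mulrA l1 -scalerAr.
have k2 : kap a *: (e1 * w) = kap x' *: (e1 * w).
  by rewrite [LHS]scalerAl -r2 -mulrA l2 -scalerAr.
apply/eqP; case/orP: ne => ne; rewrite -subr_eq0 in ne.
  move/eqP: k2; rewrite -subr_eq0 -scalerBl scaler_eq0; by rewrite (negPf ne).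
move/eqP: k1; rewrite -subr_eq0 -scalerBl scaler_eq0; by rewrite (negPf ne).
Qed.

(* The coefficients of Young's seminormal form. *)
Definition seminormal (a x : nat * nat) : C := - (1 + z * kap x) / (kap a - kap x).

Lemma et_t_diag s (a x : nat * nat) : rtab (x :: a :: s) -> (size s < n)%N ->
  et (x :: a :: s) * t (size s) * et (x :: a :: s) = seminormal a x *: et (x :: a :: s).
Proof.
move=> hx sn; have := hx => /= /andP[ax /andP[aa hs]].
have ne : kap a - kap x != 0 by rewrite subr_eq0; exact: kap_next hs aa ax.
have [l1 [l2 _]] := eigT hx sn.
apply: (scalerI ne); rewrite -mulrA scalerAr (t_eigen sn l2 l1) mulrBr.
rewrite et_itw_et // ?(kap_next hs aa ax) // sub0r -scalerAr idemT //.
by rewrite -scaleNr scalerA; congr (_ *: _); rewrite /seminormal [RHS]mulrC divfK.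
Qed.

Lemma et_t_offdiag s (a x b x' : nat * nat) : rtab (x :: a :: s) -> rtab (x' :: b :: s) ->
  (size s < n)%N -> x :: a :: s != x' :: b :: s ->
  (kap a != kap x') || (kap x != kap b) ->
  et (x :: a :: s) * t (size s) * et (x' :: b :: s) = 0.
Proof.
move=> h1 h2 sn ne ne'; have := h2 => /= /andP[ax /andP[aa hs]].
have ne2 : kap b - kap x' != 0 by rewrite subr_eq0; exact: kap_next hs aa ax.
have [l1 [l2 _]] := eigT h2 sn.
apply: (scalerI ne2); rewrite -mulrA scalerAr (t_eigen sn l2 l1) mulrBr.
by rewrite et_itw_et // sub0r -scalerAr orthoT // !scaler0 oppr0.
Qed.

(** The generator commutes with [et s], so the orthogonality of [et s] and [et s'] passes through
    it. *)
Lemma et_t_neq s s' (a x b x' : nat * nat) : rtab (x :: a :: s) -> rtab (x' :: b :: s') ->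
  size s = size s' -> (size s < n)%N -> s != s' ->
  et (x :: a :: s) * t (size s) * et (x' :: b :: s') = 0.
Proof.
move=> h1 h2 e sn ne.
have hs : rtab s by move: h1 => /= /and3P[].
have hs' : rtab s' by move: h2 => /= /and3P[].
have e1 : et (x :: a :: s) * et s = et (x :: a :: s).
  by apply: mul_et => //; case: (eigrT h1 sn) => _ [].
have e2 : et s * et (x' :: b :: s') = 0.
  apply: (@et_mul0 s') => //; first by rewrite eq_sym.
  by have [] := eigT h2; rewrite /= -?e // => _ [].
have cs : GRing.comm (t (size s)) (et s).
  case: (s) sn => [|v s0] sn; first exact: commr1.
  by apply: (gen_comm_t (j := size s0)) => //; exact: (gen_et (v :: s0)).
by rewrite -e1 -[_ * et s * t _]mulrA -cs -!mulrA e2 !mulr0.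
Qed.

(* [e_t sigma e_t] for [t = a :: s], decomposed along the nodes added to [t]. *)
Lemma et_t_et s (a : nat * nat) : rtab (a :: s) -> (size s < n)%N ->
  et (a :: s) * t (size s) * et (a :: s) =
  \sum_(x <- adds (a :: s)) seminormal a x *: et (x :: a :: s).
Proof.
move=> ha sn; have := ha => /= /andP[aa hs]; rewrite {1 2}(et_sum_adds ha).
rewrite !mulr_suml big_seq [RHS]big_seq; apply: eq_bigr => x ax.
rewrite mulr_sumr (bigD1_seq x) ?adds_uniq //=.
have hx v : v \in adds (a :: s) -> rtab (v :: a :: s).
  by move=> av; apply/andP; split; rewrite // -mem_adds.
rewrite (et_t_diag (hx _ ax) sn) big_seq_cond big1 ?addr0 // => v /andP[av vx].
apply: et_t_offdiag => //; [exact: hx|exact: hx| |].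
  by apply: contra vx => /eqP[->].
apply/orP; right; rewrite eq_sym; apply: kap_next (aa) _ => //.
by rewrite -mem_adds.
Qed.

Lemma swapped_nodes s (a x b x' : nat * nat) : rtab (x :: a :: s) -> rtab (x' :: b :: s) ->
  kap a = kap x' -> kap x = kap b -> a = x' /\ x = b.
Proof.
move=> /= /andP[ax /andP[aa hs]] /andP[bx /andP[bb _]].
move=> /(qcont_inj q_neq0 qnum_neq0) e1 /(qcont_inj q_neq0 qnum_neq0) e2.
have ab : a != b.
  by apply: contra (addable_next_content hs aa ax) => /eqP ab; rewrite e2 ab.
split.
  apply: (@addable_content_inj (b :: s)) => //; first by rewrite /= bb.
  by rewrite addable_cons.
apply: (@addable_content_inj (a :: s)) => //; first by rewrite /= aa.
by rewrite addable_cons // eq_sym.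
Qed.

Lemma et_t_nperm s s' x x' r : rtab (x :: s) -> rtab (x' :: s') -> size s = r.+1 ->
  size s' = r.+1 -> (r < n)%N -> ~~ perm_eq (x :: s) (x' :: s') ->
  et (x :: s) * t r * et (x' :: s') = 0.
Proof.
case: s => // v s; case: s' => // v' s' h1 h2 [es] [es'] rn np; rewrite -es.
have [ss|ss] := eqVneq s s'; last by apply: et_t_neq; rewrite ?es.
rewrite -ss in h2 np *; apply: et_t_offdiag; rewrite ?es //.
  by apply: contra np => /eqP ->.
rewrite -negb_and; apply: contra np => /andP[/eqP e1 /eqP e2].
have [-> ->] := swapped_nodes h1 h2 e1 e2.
by apply/permPl; exact: (perm_catCA [:: v'] [:: x'] s).
Qed.

(* Since [gen j.+1] is [gen j + gen j * t j * gen j], this follows by induction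
   from the seminormal form. *)
Lemma primitive_aux r : (r <= n.+1)%N -> forall s s' h, rtab s -> rtab s' ->
  size s = r -> size s' = r -> gen r.-1 h ->
  (~~ perm_eq s s' -> et s * h * et s' = 0) /\
  (exists c, et s * h * et s = c *: et s).
Proof.
have scal k s s' : (k <= n.+1)%N -> rtab s -> rtab s' -> size s = k -> size s' = k ->
    forall h, gen 0 h -> (~~ perm_eq s s' -> et s * h * et s' = 0) /\
    (exists c, et s * h * et s = c *: et s).
  move=> kn hs hs' es es' h /gen0[c ->]; rewrite mulr_algr -!scalerAl; split.
    by move=> ns; rewrite orthoT ?scaler0 ?es ?es' //; apply: contra ns => /eqP->.
  by exists c; rewrite idemT // es.
have assoc (p a e1 f e2 b d m : A) : e1 * f * e2 = m ->
    p * a * e1 * f * (e2 * b * d) = p * a * m * b * d by move=> <-; rewrite !mulrA.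
elim: r => [|r IH] rn s s' h hs hs' es es' gh; first exact: (scal _ s s' rn).
case: r => [|r] in IH rn es es' gh *; first exact: (scal _ s s' rn).
have {}IH := IH (ltnW rn).
case: s hs es => // x s hx [es]; case: s' hs' es' => // x' s' hx' [es'].
have [ax hs] := andP (hx : addable s x && rtab s).
have [ax' hs'] := andP (hx' : addable s' x' && rtab s').
set L := fun s x => horner_alg (jm r.+1) (lag q s x).
have LE s0 x0 : size s0 = r.+1 -> et (x0 :: s0) = et s0 * L s0 x0.
  by move=> e; rewrite -[LHS]/(et s0 * _) e.
have cL d s0 x0 : gen r d -> GRing.comm d (L s0 x0).
  by move=> gd; apply/comm_horner/commr_sym/(gen_comm_jm (j := r)).
have gE s2 : size s2 = r.+1 -> gen r (et s2) by move=> ew; have := gen_et s2; rewrite ew.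
have cLE s1 s0 x0 : size s1 = r.+1 -> GRing.comm (et s1) (L s0 x0).
  by move=> e1; apply/cL/gE.
have permL s1 s2 y : perm_eq s1 s2 -> L s1 y = L s2 y.
  by move=> pe; rewrite /L /lag (perm_adds pe).
have LL s0 x0 y : rtab (x0 :: s0) -> size s0 = r.+1 -> addable s0 y ->
    et (x0 :: s0) * L s0 y = (x0 == y)%:R *: et (x0 :: s0).
  move=> h0 e0 ay; have [a0 hs0] := andP (h0 : addable s0 x0 && rtab s0).
  have [|k _] := eigrT h0; first by rewrite /= e0.
  by rewrite e0 in k; rewrite (horner_alg_eigenr _ k) horner_lag // mem_adds.
have {gh} := gen_two_sided (j := r) _ gh; rewrite -ltnS => /(_ rn).
elim=> [a ga|a b ga gb|a b _ [h1 [c1 h2]] _ [h3 [c2 h4]]]; last first.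
- split=> [np|]; first by rewrite mulrDr mulrDl h1 // h3 // addr0.
  by exists (c1 + c2); rewrite mulrDr mulrDl h2 h4 scalerDl.
(* The interpolation factor of the last node commutes with [gen r], so it can be moved past [a] onto
   the inner idempotent. By induction only inner tableaux with the nodes of [s] contribute. *)
- have half1 s2 : rtab s2 -> size s2 = r.+1 -> et (x :: s) * a * et s2 =
      if perm_eq s s2 then et s * a * et (x :: s2) else 0.
    move=> hw ew; have -> : et (x :: s) * a * et s2 = et s * a * et s2 * L s x.
      by rewrite LE // -[_ * L s x * a]mulrA -(cL a) // -!mulrA -(cLE s2) //.
    case: ifP => [pe|/negbT np]; last by have [-> //] := IH s s2 a hs hw es ew ga; rewrite mul0r.
    by rewrite (LE s2) // (permL s s2) // mulrA.
  have half2 s2 y s0 : rtab s2 -> size s2 = r.+1 -> rtab (y :: s0) -> size s0 = r.+1 ->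
      et s2 * b * et (y :: s0) = if perm_eq s2 s0 then et (y :: s2) * b * et s0 else 0.
    move=> hw ew hy e0; have [ay hs0] := andP (hy : addable s0 y && rtab s0).
    rewrite (LE s0) // mulrA.
    case: ifP => [pe|/negbT np]; last by have [-> //] := IH s2 s0 b hw hs0 ew e0 gb; rewrite mul0r.
    by rewrite (LE s2) // -(permL s2 s0) // -!mulrA (cLE s0) // (mulrA b) (cL b) // !mulrA.
  (* The resolution of 1 into idempotents is inserted on both sides of [t r]. *)
  have dec y s0 : et (x :: s) * (a * t r * b) * et (y :: s0) =
      \sum_(s1 <- tabs r.+1) \sum_(s2 <- tabs r.+1)
        (et (x :: s) * a * et s1) * t r * (et s2 * b * et (y :: s0)).
    transitivity ((\sum_(s1 <- tabs r.+1) et (x :: s) * a * et s1) * t r *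
      (\sum_(s2 <- tabs r.+1) et s2 * b * et (y :: s0))).
      by rewrite -mulr_sumr -!mulr_suml sum_tabs mulr1 mul1r !mulrA.
    by rewrite !mulr_suml; apply: eq_bigr => s1 _; rewrite mulr_sumr.
  split=> [np|].
    rewrite dec big_seq big1 // => s1 /mem_tabs[hv ev].
    rewrite big_seq big1 // => s2 /mem_tabs[hw ew].
    rewrite half1 // half2 //; case: ifP => p1; last by rewrite !mul0r.
    case: ifP => p2; last by rewrite mulr0.
    have hxv : rtab (x :: s1) by rewrite /= hv -(eq_addable p1) ax.
    have hyw : rtab (x' :: s2) by rewrite /= hw (eq_addable p2) ax'.
    rewrite (assoc _ _ _ _ _ _ _ 0) ?mulr0 ?mul0r //; apply: et_t_nperm => //.
    apply: contra np => pe; rewrite (perm_trans _ (perm_trans pe _)) ?perm_cons //.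
  rewrite dec; have add (D D' : A) : (exists c, D = c *: et (x :: s)) ->
      (exists c, D' = c *: et (x :: s)) -> exists c, D + D' = c *: et (x :: s).
    by move=> [c ->] [c' ->]; exists (c + c'); rewrite scalerDl.
  have zero : exists c, 0 = c *: et (x :: s) by exists 0; rewrite scale0r.
  rewrite big_seq; elim/big_ind: _ => // s1 /mem_tabs[hv ev].
  rewrite big_seq; elim/big_ind: _ => // s2 /mem_tabs[hw ew].
  rewrite half1 // half2 //; case: ifP => p1; last by exists 0; rewrite !mul0r scale0r.
  case: ifP => p2; last by exists 0; rewrite mulr0 scale0r.
  have hxv : rtab (x :: s1) by rewrite /= hv -(eq_addable p1) ax.
  have hyw : rtab (x :: s2) by rewrite /= hw (eq_addable p2) ax.
  (* Only equal inner tableaux contribute: they have the same nodes, so if they differ then they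
     already differ below the last node, and [et_t_neq] applies. *)
  have [vw|vw] := eqVneq s1 s2; last first.
    exists 0; rewrite scale0r (assoc _ _ _ _ _ _ _ 0) ?mulr0 ?mul0r //.
    case: s1 s2 ev ew hxv hyw p1 p2 vw {hv hw half1 half2} => // y s1 [//|y' s2] [ev] [ew] hxv hyw p1 p2 vw.
    rewrite -ev; apply: et_t_neq; rewrite ?ev //.
    apply: contra vw => /eqP e; rewrite -e in p2 hyw *; rewrite eqseq_cons eqxx andbT.
    have : y \in y' :: s1 by rewrite (perm_mem (perm_trans p2 p1)) inE eqxx.
    rewrite inE => /orP[//|yv]; have := hxv => /= /andP[_ /andP[/and3P[ny _ _] _]].
    by rewrite yv in ny.
  have [|c hc] := (IH s s (a * et s1 * b) hs hs es es _).2.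
    by apply: GenM => //; apply: GenM => //; exact: gE.
  have mid : exists g, et (x :: s1) * t r * et (x :: s1) = g *: et (x :: s1).
    case: s1 ev hxv {hv p1 p2 vw half1 half2 hc} => // y s1 [ev] hxv.
    by exists (seminormal y x); rewrite -ev et_t_diag // ev.
  have [g hg] := mid; exists (g * c).
  rewrite -vw (assoc _ _ _ _ _ _ _ _ hg) -scalerAr -!scalerAl -scalerA; congr (_ *: _).
  rewrite !LE // -(permL s s1) // scalerAl -hc.
  rewrite !mulrA -(mulrA _ (L s x) b) -(cL b) // mulrA.
  by rewrite -(mulrA _ (L s x) (et s)) -(cLE s) // !mulrA.
have key y s0 : rtab (y :: s0) -> size s0 = r.+1 ->
    et (x :: s) * a * et (y :: s0) = et s * a * et s0 * L s x * L s0 y.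
  move=> hy e0; rewrite !LE // !mulrA; congr (_ * _).
  by rewrite -[_ * L s x * a]mulrA -(cL a) // -!mulrA -(cLE s0) //.
split=> [np|].
  rewrite key //; have [pe|np'] := boolP (perm_eq s s'); last first.
    by have [-> //] := IH s s' a hs hs' es es' ga; rewrite !mul0r.
  have xx : x != x' by apply: contra np => /eqP->; rewrite perm_cons.
  have hxs : rtab (x :: s') by rewrite /= hs' -(eq_addable pe) ax.
  rewrite (permL s s') // -!mulrA (mulrA (et s')) -LE // LL //.
  by rewrite (negPf xx) scale0r !mulr0.
have [c hc] := (IH s s a hs hs es es ga).2; exists c.
by rewrite key // hc -!scalerAl -LE // LL // eqxx scale1r.
Qed.

Lemma eigP s w : eig s w <-> forall j, (j < size s)%N ->
  jm j * w = kap (nth (0, 0)%N (rev s) j) *: w.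
Proof.
elim: s => // x s [IH1 IH2]; rewrite rev_cons; split=> [[h /IH1 hs] j|h].
  rewrite nth_rcons size_rev /= ltnS leq_eqVlt => /orP[/eqP->|js].
    by rewrite ltnn eqxx.
  by rewrite js hs.
split; first by have := h (size s) (leqnn _); rewrite nth_rcons size_rev ltnn eqxx.
by apply: IH2 => j js; have := h j (ltnW js); rewrite nth_rcons size_rev js.
Qed.

Lemma eigrPn s w : eigr s w <-> forall j, (j < size s)%N ->
  w * jm j = kap (nth (0, 0)%N (rev s) j) *: w.
Proof.
elim: s => // x s [IH1 IH2]; rewrite rev_cons; split=> [[h /IH1 hs] j|h].
  rewrite nth_rcons size_rev /= ltnS leq_eqVlt => /orP[/eqP->|js].
    by rewrite ltnn eqxx.
  by rewrite js hs.
split; first by have := h (size s) (leqnn _); rewrite nth_rcons size_rev ltnn eqxx.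
by apply: IH2 => j js; have := h j (ltnW js); rewrite nth_rcons size_rev js.
Qed.

(** By primitivity [w] is a multiple of [et s], and an idempotent multiple that is nonzero has
    coefficient 1. *)
Lemma et_unique s w : rtab s -> size s = n.+1 -> gen n w -> w != 0 -> w * w = w ->
  eig s w -> eigr s w -> w = et s.
Proof.
move=> hs es gw w0 ww h1 h2.
have [|c hc] := (@primitive_aux n.+1 (leqnn _) s s w hs hs es es _).2; first by [].
have wE : w = c *: et s by rewrite -hc et_mul // mul_et.
have : c * c *: et s = c *: et s.
  by rewrite -[in RHS]wE -ww wE -scalerAl -scalerAr scalerA idemT // es.
move/eqP; rewrite -subr_eq0 -scalerBl scaler_eq0 => /orP[|/eqP s0]; last first.
  by case/eqP: w0; rewrite wE s0 scaler0.
rewrite -{3}(mulr1 c) -mulrBr mulf_eq0 => /orP[/eqP c0|].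
  by case/eqP: w0; rewrite wE c0 scale0r.
by rewrite subr_eq0 => /eqP c1; rewrite wE c1 scale1r.
Qed.

Unset Default Proof Using.
End HeckeTower.

(** * The sum over the shapes Lambda(k,l) *)

Section HookSum.
Set Default Proof Using "All".
Variables (C : fieldType) (q : C).
Hypothesis q_neq0 : q != 0.
Hypothesis qnum_neq0 : forall k : nat, (0 < k)%N -> qnum q k != 0.
Variables (A : algType C) (N : nat) (t : nat -> A).
Hypothesis t_hecke : hecke_family q N t.
Variables (V : lmodType C) (psi : {linear A -> V}).
(** Cyclicity leaves out the generator [t N.-1]: in the application it is sigma_1, which touches the
    untraced first factor. *)
Hypothesis psiC : forall a b, gen t N.-1 a -> psi (a * b) = psi (b * a).
Implicit Types (s : seq (nat * nat)) (x v : nat * nat).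

Local Notation z := (q - q^-1).
Local Notation kap x := (qcont q (content x)).
Local Notation et := (et q t).

(** With the strands numbered from the last one, this is sigma_(N-r) ... sigma_1. *)
Definition descent r : A := \prod_(r <= i < N) t i.

Definition node_trace x s : V := psi (et (x :: s) * descent (size s)).

(** For nonzero [j] this is q^j / j_q, the diagonal seminormal coefficient at axial distance [j]. *)
Definition qratio (j : int) : C := (1 + z * qcont q j) / qcont q j.

Lemma seminormal_qratio x v : seminormal q x v = qratio (content v - content x).
Proof.
rewrite /seminormal /qratio.
have e : kap v = kap x + (1 + z * kap x) * qcont q (content v - content x).
  by rewrite qcont_sqr // -qcontD // addrC subrK.
have x0 : 1 + z * kap x != 0 by rewrite qcont_sqr // expf_neq0 // expfz_neq0.
(* For equal contents both denominators are 0, and both quotients are 0 by convention. *)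
have [j0|j0] := eqVneq (content v - content x) 0.
  by rewrite e j0 qcont0 mulr0 addr0 subrr invr0 !mulr0.
have := qcont_neq0 q_neq0 qnum_neq0 j0; rewrite e.
move: (qcont q (_ - _)) => k k0.
have -> : kap x - (kap x + (1 + z * kap x) * k) = - ((1 + z * kap x) * k) by ring.
have -> : 1 + z * (kap x + (1 + z * kap x) * k) = (1 + z * kap x) * (1 + z * k) by ring.
move: (1 + z * kap x) (1 + z * k) x0 => w u w0.
by rewrite invrN mulrNN -mulf_div divff // mul1r.
Qed.

Lemma tail_trace s : rtab s -> psi (et s * descent (size s)) =
  \sum_(x <- adds s) node_trace x s.
Proof.
by move=> hs; rewrite (et_sum_adds q_neq0 qnum_neq0 t_hecke) // mulr_suml raddf_sum.
Qed.

Lemma descent_comm r a : (r < N)%N -> gen t r a -> GRing.comm a (descent r.+1).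
Proof.
move=> rN ga; rewrite /descent big_nat_cond; elim/big_ind: _ => [|b c|i].
- exact: commr1.
- exact: commrM.
by rewrite andbT => /andP[ri iN]; apply/commr_sym; exact: (gen_comm_t q_neq0 qnum_neq0 t_hecke ri iN ga).
Qed.

(** The elements that link [et s] with [et s'] commute with the factor of [x] and with [descent], so
    cyclicity can exchange them. *)
Lemma node_trace_perm x s s' : rtab (x :: s) -> rtab s' -> perm_eq s s' ->
  (size s <= N)%N -> node_trace x s = node_trace x s'.
Proof.
move=> hx hs' pe sN; have [ax hs] := andP (hx : addable s x && rtab s).
have [|a [b [ga gb ab ba]]] := link_perm q_neq0 qnum_neq0 t_hecke hs hs' pe (leqW sN).
  by apply: (split_belowT q_neq0 qnum_neq0 t_hecke); exact: leqW.
rewrite /node_trace -[et (x :: s)]/(et s * _) -[et (x :: s')]/(et s' * _) -ab -ba.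
rewrite -(perm_size pe) (_ : lag q s' x = lag q s x); last first.
  by rewrite /lag (perm_adds pe).
set L := horner_alg _ _.
have c1 d : gen t (size s).-1 d -> GRing.comm d L.
  by move=> gd; apply/(comm_horner q_neq0 qnum_neq0 t_hecke)/(gen_pred_comm_jm q_neq0 qnum_neq0 t_hecke).
have c2 d : gen t (size s).-1 d -> GRing.comm d (descent (size s)).
  case: (size s) sN => [|r] rN gd; last exact: descent_comm.
  by have [k ->] := gen0 q_neq0 qnum_neq0 t_hecke gd; rewrite /GRing.comm mulr_algl mulr_algr.
rewrite -!mulrA psiC; last by apply: (gen_widen q_neq0 qnum_neq0 t_hecke _ ga); lia.
by rewrite -[LHS]/(psi _) -mulrA; congr (psi (b * _)); rewrite -mulrA -(c2 a) // !mulrA (c1 a).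
Qed.

(** One copy of the idempotent [e = e e] is carried around cyclically to the other side of the first
    generator of [descent]. The product [e t e] that appears is expanded by the seminormal form. *)
Lemma node_trace_expand x s s' : rtab (x :: s) -> rtab s' -> perm_eq (x :: s) s' ->
  (size s < N)%N -> node_trace x s =
  \sum_(v <- adds s') qratio (content v - content x) *: node_trace v s'.
Proof.
move=> hx hs' pe sN; have [e eE] : exists e, e = et (x :: s) by exists (et (x :: s)).
have ge : gen t (size s) e by rewrite eE; exact: (gen_et q_neq0 qnum_neq0 t_hecke (x :: s)).
have ee : e * e = e by rewrite eE; apply: (idemT q_neq0 qnum_neq0 t_hecke) => //; exact: leqW.
have dE : descent (size s) = t (size s) * descent (size s).+1 by rewrite /descent big_ltn.
have -> : node_trace x s = psi (e * e * (t (size s) * descent (size s).+1)).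
  by rewrite ee -dE eE.
rewrite -[e * e * _]mulrA psiC; last by apply: (gen_widen q_neq0 qnum_neq0 t_hecke _ ge); lia.
have de := descent_comm sN ge; have te := et_t_et q_neq0 qnum_neq0 t_hecke hx sN.
have -> : e * (t (size s) * descent (size s).+1) * e = e * t (size s) * e * descent (size s).+1.
  by rewrite -!mulrA de.
rewrite -eE in te; rewrite te mulr_suml raddf_sum.
rewrite (perm_adds pe) big_seq [RHS]big_seq; apply: eq_bigr => v av.
rewrite -scalerAl; apply: (etrans (linearZ_LR psi _ _)); rewrite seminormal_qratio; congr (_ *: _).
have hv : rtab [:: v, x & s].
  by apply/andP; split; rewrite // (eq_addable pe) -mem_adds.
by rewrite -(node_trace_perm hv hs' pe).
Qed.

(** * Addable nodes of Lambda(k,l) and telescoping *)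

Variables m n : nat.
Hypotheses (m_gt0 : (0 < m)%N) (n_gt0 : (0 < n)%N).
Variable S : nat -> nat -> seq (nat * nat).
Hypothesis S_rtab : forall k l, (k <= m)%N -> (l <= n)%N -> rtab (S k l).
Hypothesis S_mem : forall k l i j, (k <= m)%N -> (l <= n)%N ->
  ((i, j) \in S k l) = [|| (i < m) && (j < n), (j == n) && (i < k) | (i == m) && (j < l)]%N.
Hypothesis S_size : forall k l, (k <= m)%N -> (l <= n)%N ->
  size (S k l) = (m * n + k + l)%N.
Hypothesis NE : N = (m * n + m + n)%N.
Hypothesis psi_rect : psi (et ((m, n) :: S m n)) = 0.

Lemma S_consA k l : (k < m)%N -> (l <= n)%N ->
  rtab ((k, n) :: S k l) /\ perm_eq ((k, n) :: S k l) (S k.+1 l).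
Proof.
move=> km ln; have km' := ltnW km.
have h : rtab ((k, n) :: S k l).
  by rewrite /= S_rtab // andbT /addable !S_mem //=; lia.
split=> //; apply: uniq_perm; [exact: rtab_uniq|exact/rtab_uniq/S_rtab|].
by move=> [i j]; rewrite inE !S_mem // xpair_eqE; lia.
Qed.

Lemma S_consB k l : (k <= m)%N -> (l < n)%N ->
  rtab ((m, l) :: S k l) /\ perm_eq ((m, l) :: S k l) (S k l.+1).
Proof.
move=> km ln; have ln' := ltnW ln.
have h : rtab ((m, l) :: S k l).
  by rewrite /= S_rtab // andbT /addable !S_mem //=; lia.
split=> //; apply: uniq_perm; [exact: rtab_uniq|exact/rtab_uniq/S_rtab|].
by move=> [i j]; rewrite inE !S_mem // xpair_eqE; lia.
Qed.

(** The first two nodes lead to Lambda(k+1,l) and Lambda(k,l+1), the next two leave the family, and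
    [(m, n)] completes the rectangle. *)
Lemma S_adds k l (F : nat * nat -> V) : (k <= m)%N -> (l <= n)%N ->
  \sum_(x <- adds (S k l)) F x =
  F (k, n) *+ (k < m)%N + (F (m, l) *+ (l < n)%N + (F (0, n.+1)%N *+ (0 < k)%N +
  (F (m.+1, 0)%N *+ (0 < l)%N + F (m, n) *+ ((k == m) && (l == n))))).
Proof.
move=> km ln; have hs := S_rtab km ln.
pose c (b : bool) (x : nat * nat) := nseq b x.
pose r := c (k < m)%N (k, n) ++ c (l < n)%N (m, l) ++ c (0 < k)%N (0, n.+1)%N ++
  c (0 < l)%N (m.+1, 0)%N ++ c ((k == m) && (l == n)) (m, n).
have cs b x : \sum_(y <- c b x) F y = F x *+ b.
  by case: b; rewrite /c /= ?big_seq1 ?big_nil.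
have mc b x y : (y \in c b x) = b && (y == x).
  by case: b; rewrite /c /= ?inE.
have uc b x : uniq (c b x) by case: b.
have hc b x a : has (mem a) (c b x) = b && (x \in a) by case: b; rewrite /= ?orbF.
rewrite (perm_big r) /=; first by rewrite /r !big_cat !cs.
apply: uniq_perm; first exact: adds_uniq.
  rewrite /r !cat_uniq !uc !has_cat !hc !mc !xpair_eqE /=; lia.
move=> [i j]; rewrite mem_adds // !mem_cat !mc !xpair_eqE /addable !S_mem //=.
case: (ltngtP i m) => im; case: (ltngtP j n) => jn /=; rewrite ?andbF ?orbF ?andbT /=.
all: apply/idP/idP; lia.
Qed.

Local Notation M := (m + n + 2)%N.
Local Notation kn k := (qcont q (Posz k)).

(* With these coefficients the nodes in row [0] and column [0] drop out in
   [node_coefP], and the two remaining families of terms telescope. *)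
Definition coefA k l : C := kn k * kn (M - k) / kn (M - k - l).
Definition coefB k l : C := kn l * kn (M - l) / kn (M - k - l).

Definition tailA k l : V :=
  ((-1) ^+ k * q ^- (k + l).+1 * coefA k.+1 l) *: node_trace (k, n) (S k l).
Definition tailB k l : V :=
  ((-1) ^+ k * q ^- (k + l).+1 * coefB k l.+1) *: node_trace (m, l) (S k l).

Lemma knD i j : kn (i + j) = kn i + (1 + z * kn i) * kn j.
Proof. by rewrite qcont_sqr // -qcontD. Qed.

Lemma kn1 : kn 1 = q.
Proof. by rewrite (qcontS q_neq0 0) qcont0 mulr0 add0r. Qed.

Lemma kn_neq0 i : (0 < i)%N -> kn i != 0.
Proof. by move=> i0; apply: qcont_neq0 => //; lia. Qed.

Lemma knN i : qcont q (- i%:Z) = - kn i / (1 + z * kn i).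
Proof.
have := qcontD q_neq0 i (- i%:Z); rewrite subrr qcont0 -qcont_sqr // => /eqP.
rewrite eq_sym addrC addr_eq0 => /eqP h.
have x0 : 1 + z * kn i != 0 by rewrite qcont_sqr // expf_neq0 // expfz_neq0.
by apply: (mulfI x0); rewrite h [RHS]mulrC divfK.
Qed.

Lemma qratioN i : (0 < i)%N -> qratio (- i%:Z) = - (kn i)^-1.
Proof.
move=> i0; rewrite /qratio knN.
have x0 : 1 + z * kn i != 0 by rewrite qcont_sqr // expf_neq0 // expfz_neq0.
have k0 := kn_neq0 i0; move: (kn i) k0 x0 => k k0 x0.
have -> : 1 + z * (- k / (1 + z * k)) = (1 + z * k)^-1.
  by move: z x0 => y x0; field.
move: (1 + z * k) x0 => u u0.
by rewrite invfM invrK mulrCA mulVf // mulr1 invrN.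
Qed.

(** The coefficient of [node_trace x (S k l)] in [tail_step], up to the common factor (-1)^k
    q^-(k+l). The three terms come from the last node of column [n], from the last node of row [m],
    and from the summand itself; [1 + z * kn k] is q^(2k). *)
Definition node_coef k l (x : nat * nat) : C :=
  - coefA k l * qratio (content x - (n%:Z - k%:Z + 1)) +
  coefB k l * qratio (content x - (l%:Z - m%:Z - 1)) + (1 + z * kn k).

Lemma node_coefP k l : (k <= m)%N -> (l <= n)%N ->
  [/\ (k < m)%N -> node_coef k l (k, n) = q^-1 * coefA k.+1 l,
      (l < n)%N -> node_coef k l (m, l) = q^-1 * coefB k l.+1,
      (0 < k)%N -> node_coef k l (0, n.+1)%N = 0
    & (0 < l)%N -> node_coef k l (m.+1, 0)%N = 0].
Proof.
move=> km ln; rewrite /node_coef /content /coefA /coefB /=.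
(* [e] is the axial distance from [(k, n)] to [(m, l - 1)]. Once every argument is a sum of [e],
   [k], [l] and 1, [knD] reduces the claims to identities of rational functions. *)
set e := (M - k.+1 - l)%N; have e0 : (0 < e)%N by rewrite /e; lia.
have -> : (M - k - l)%N = (1 + e)%N by rewrite /e; lia.
have -> : (M - k - l.+1)%N = e by rewrite /e; lia.
have -> : (M - k)%N = (1 + e + l)%N by rewrite /e; lia.
have -> : (M - l)%N = (1 + e + k)%N by rewrite /e; lia.
have -> : (M - k.+1)%N = (e + l)%N by rewrite /e; lia.
have -> : (M - l.+1)%N = (e + k)%N by rewrite /e; lia.
have ne := kn_neq0 e0; have ne1 : kn (1 + e) != 0 by exact: kn_neq0.
have nE : kn (1 + e) = q ^+ 2 * kn e + q by rewrite -qcontS // PoszD addrC.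
have expand (E U T x y c : C) : E != 0 -> x != 0 -> T != 0 ->
    - (x * U / E) * ((1 + c * x) / x) + y * T / E * ((1 + c * T) / T) + (1 + c * x) =
    (- U * (1 + c * x) + y * (1 + c * T) + (1 + c * x) * E) / E.
  by move=> E0 x0 T0; field; rewrite E0 x0 T0.
have expand' (E U T x y c : C) : E != 0 -> y != 0 -> U != 0 ->
    - (x * U / E) * - U^-1 + y * T / E * - y^-1 + (1 + c * x) =
    (x - T + (1 + c * x) * E) / E.
  by move=> E0 y0 U0; field; rewrite E0 y0 U0.
split=> h.
- have -> : n%:Z - k%:Z - (n%:Z - k%:Z + 1) = - 1%:Z by lia.
  have -> : n%:Z - k%:Z - (l%:Z - m%:Z - 1) = e%:Z by rewrite /e; lia.
  rewrite qratioN // /qratio -[k.+1]add1n.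
  rewrite nE in ne1; rewrite !(knD (1 + e)) nE (knD 1 k) (knD e) kn1.
  move: (kn e) (kn k) (kn l) ne ne1 => w x y ne ne1.
  by field; rewrite ?ne ?ne1 ?q_neq0.
- have -> : l%:Z - m%:Z - (n%:Z - k%:Z + 1) = - e%:Z by rewrite /e; lia.
  have -> : l%:Z - m%:Z - (l%:Z - m%:Z - 1) = 1%:Z by lia.
  rewrite qratioN // /qratio -[l.+1]add1n.
  rewrite nE in ne1; rewrite !(knD (1 + e)) nE (knD 1 l) (knD e) kn1.
  move: (kn e) (kn k) (kn l) ne ne1 => w x y ne ne1.
  by field; rewrite ?ne ?ne1 ?q_neq0.
- have -> : n.+1%:Z - 0%N%:Z - (n%:Z - k%:Z + 1) = k%:Z by lia.
  have -> : n.+1%:Z - 0%N%:Z - (l%:Z - m%:Z - 1) = (1 + e + k)%N%:Z by rewrite /e; lia.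
  have nk := kn_neq0 h; have nek : kn (1 + e + k) != 0 by exact: kn_neq0.
  rewrite /qratio expand // !(knD (1 + e)).
  move: (kn (1 + e)) (kn k) (kn l) z => E x y c; apply/eqP; rewrite mulf_eq0; apply/orP; left.
  by apply/eqP; ring.
have -> : 0%N%:Z - m.+1%:Z - (n%:Z - k%:Z + 1) = - (1 + e + l)%N%:Z by rewrite /e; lia.
have -> : 0%N%:Z - m.+1%:Z - (l%:Z - m%:Z - 1) = - l%:Z by lia.
have nl := kn_neq0 h; have nel : kn (1 + e + l) != 0 by exact: kn_neq0.
rewrite !qratioN // expand' // (addnC (1 + e)%N k) (knD k).
move: (kn (1 + e)) (kn k) z => E x c; apply/eqP; rewrite mulf_eq0; apply/orP; left.
by apply/eqP; ring.
Qed.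

Lemma tailA_expand k l : (k <= m)%N -> (l <= n)%N ->
  tailA k.-1 l *+ (0 < k)%N = \sum_(x <- adds (S k l))
    ((-1) ^+ k * q ^- (k + l) * (- coefA k l * qratio (content x - (n%:Z - k%:Z + 1)))) *:
      node_trace x (S k l).
Proof.
move=> km ln; case: k km => [|k] km.
  rewrite big1 // => x _.
  by rewrite /coefA qcont0 !mul0r oppr0 mul0r mulr0 scale0r.
have [hx pe] := S_consA km ln.
rewrite /tailA mulr1n (node_trace_expand hx (S_rtab km ln) pe); last first.
  by rewrite S_size //; [lia|exact: ltnW].
rewrite scaler_sumr; apply: eq_bigr => x _; rewrite scalerA addSn; congr (_ *: _).
have -> : n%:Z - k.+1%:Z + 1 = content (k, n) by rewrite /content /=; lia.
by rewrite -!pred_Sn (exprS (-1)); move: (q ^+ (k + l).+1) => Q; ring.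
Qed.

Lemma tailB_expand k l : (k <= m)%N -> (l <= n)%N ->
  tailB k l.-1 *+ (0 < l)%N = \sum_(x <- adds (S k l))
    ((-1) ^+ k * q ^- (k + l) * (coefB k l * qratio (content x - (l%:Z - m%:Z - 1)))) *:
      node_trace x (S k l).
Proof.
move=> km ln; case: l ln => [|l] ln.
  rewrite big1 // => x _.
  by rewrite /coefB qcont0 !mul0r mulr0 scale0r.
have [hx pe] := S_consB km ln.
rewrite /tailB mulr1n (node_trace_expand hx (S_rtab km ln) pe); last first.
  by rewrite S_size //; [lia|exact: ltnW].
rewrite scaler_sumr; apply: eq_bigr => x _; rewrite scalerA addnS; congr (_ *: _).
have -> : l.+1%:Z - m%:Z - 1 = content (m, l) by rewrite /content /=; lia.
by rewrite -!pred_Sn; move: (q ^+ (k + l).+1) => Q; ring.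
Qed.

Lemma node_trace_rect : node_trace (m, n) (S m n) = 0.
Proof.
have sz : size (S m n) = N by rewrite S_size.
by rewrite /node_trace sz /descent big_geq // mulr1.
Qed.

(** A conservation law at the shape Lambda(k,l): what arrives from Lambda(k-1,l) and Lambda(k,l-1),
    together with the summand, equals what leaves for Lambda(k+1,l) and Lambda(k,l+1). *)
Lemma tail_step k l : (k <= m)%N -> (l <= n)%N ->
  tailA k.-1 l *+ (0 < k)%N + tailB k l.-1 *+ (0 < l)%N +
  ((-1) ^+ k * q ^ (k%:Z - l%:Z)) *: psi (et (S k l) * descent (size (S k l))) =
  tailA k l *+ (k < m)%N + tailB k l *+ (l < n)%N.
Proof.
move=> km ln; rewrite tailA_expand // tailB_expand // tail_trace ?S_rtab // scaler_sumr.
rewrite -!big_split /=.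
have e x : ((-1) ^+ k * q ^- (k + l) * (- coefA k l * qratio (content x - (n%:Z - k%:Z + 1)))) *:
      node_trace x (S k l) +
    ((-1) ^+ k * q ^- (k + l) * (coefB k l * qratio (content x - (l%:Z - m%:Z - 1)))) *:
      node_trace x (S k l) + ((-1) ^+ k * q ^ (k%:Z - l%:Z)) *: node_trace x (S k l) =
    ((-1) ^+ k * q ^- (k + l) * node_coef k l x) *: node_trace x (S k l).
  rewrite -!scalerDl; congr (_ *: _).
  have -> : q ^ (k%:Z - l%:Z) = q ^- (k + l) * (1 + z * kn k).
    rewrite qcont_sqr // -exprnP -exprM exprnN exprnP -expfzDr //; congr (_ ^ _); lia.
  by rewrite /node_coef; ring.
rewrite (eq_bigr _ (fun x _ => e x)) S_adds // /tailA /tailB.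
have [cA cB cO cO'] := node_coefP km ln.
have sc (b : bool) (c d : C) (w : V) : (b -> c = d) -> (c *: w) *+ b = (d *: w) *+ b.
  by case: b => // ->.
have qS : q ^- (k + l).+1 = q ^- (k + l) * q^-1 by rewrite exprS invfM mulrC.
rewrite (sc _ _ ((-1) ^+ k * q ^- (k + l).+1 * coefA k.+1 l)); last first.
  by move=> /cA ->; rewrite qS; ring.
rewrite [X in _ + (X + _) = _](sc _ _ ((-1) ^+ k * q ^- (k + l).+1 * coefB k l.+1)); last first.
  by move=> /cB ->; rewrite qS; ring.
rewrite [X in _ + (_ + (X + _)) = _](sc _ _ 0); last by move=> /cO ->; rewrite mulr0.
rewrite [X in _ + (_ + (_ + (X + _))) = _](sc _ _ 0); last by move=> /cO' ->; rewrite mulr0.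
rewrite !scale0r !mul0rn !add0r; congr (_ + _); case: andP => [[/eqP-> /eqP->]|_].
  by rewrite node_trace_rect !scaler0 !mul0rn addr0.
by rewrite mulr0n addr0.
Qed.

Lemma hook_sum :
  \sum_(k < m.+1) \sum_(l < n.+1) ((-1) ^+ k * q ^ (k%:Z - l%:Z)) *:
    psi (et (S k l) * descent (size (S k l))) = 0.
Proof.
have e (k : 'I_m.+1) (l : 'I_n.+1) : ((-1) ^+ k * q ^ (k%:Z - l%:Z)) *:
    psi (et (S k l) * descent (size (S k l))) =
    (tailA k l *+ (k < m)%N - tailA k.-1 l *+ (0 < k)%N) +
    (tailB k l *+ (l < n)%N - tailB k l.-1 *+ (0 < l)%N).
  have := tail_step (ltn_ord k : (k <= m)%N) (ltn_ord l : (l <= n)%N).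
  move=> h; rewrite addrACA -opprD -h addrC addKr //.
have tele (p : nat) (f : nat -> V) :
    \sum_(i < p.+1) (f i *+ (i < p)%N - f i.-1 *+ (0 < i)%N) = 0.
  rewrite big_split /= sumrN big_ord_recr big_ord_recl /= ltnn !mulr0n addr0 add0r.
  rewrite (eq_bigr (fun i : 'I_p => f i)) => [|i _]; last by rewrite ltn_ord.
  rewrite (eq_bigr (fun i : 'I_p => f i)) => [|i _] //; exact: subrr.
under eq_bigr => k _ do under eq_bigr => l _ do rewrite e.
under eq_bigr => k _ do rewrite big_split /= (tele n (fun l => tailB k l)) addr0.
by rewrite exchange_big /= big1 // => l _; exact: (tele m (fun k => tailA k l)).
Qed.

Unset Default Proof Using.
End HookSum.

(** * Operators on tensor powers *)

Section Words.
Variable N : nat.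
Implicit Types (u v w : seq 'I_N).

Lemma entry_tens (B : nmodType) k (f : seq 'I_N -> seq 'I_N -> B) u v :
  size u = k -> size v = k -> entry (tens k f) u v = f u v.
Proof.
move=> su sv; rewrite /entry.
have [a _ ua|] := insubP _ u; last by rewrite su eqxx.
have [b _ vb|] := insubP _ v; last by rewrite sv eqxx.
by rewrite mxE /word !enum_rankK ua vb.
Qed.

Lemma tensK (B : nmodType) k (X : 'M[B]_(tdim N k)) : tens k (entry X) = X.
Proof.
apply/matrixP => a b; rewrite mxE /entry /word.
by rewrite !valK !enum_valK.
Qed.

Lemma eq_entry (B : nmodType) k (X Y : 'M[B]_(tdim N k)) :
  (forall u v, size u = k -> size v = k -> entry X u v = entry Y u v) -> X = Y.
Proof.
move=> h; rewrite -(tensK X) -(tensK Y); apply/matrixP => a b; rewrite !mxE.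
by apply: h; rewrite /word size_tuple.
Qed.

Lemma entry0 (B : nmodType) k u v : entry (0 : 'M[B]_(tdim N k)) u v = 0.
Proof. by rewrite /entry; case: insub => // x; case: insub => // y; rewrite mxE. Qed.

Lemma entryD (B : nmodType) k (X Y : 'M[B]_(tdim N k)) u v :
  entry (X + Y) u v = entry X u v + entry Y u v.
Proof.
by rewrite /entry; case: (insub u : option (k.-tuple 'I_N)) (insub v : option (k.-tuple 'I_N)) => [a|] [b|]; rewrite ?addr0 ?mxE.
Qed.

Lemma entryZ (B : pzRingType) k (c : B) (X : 'M[B]_(tdim N k)) u v :
  entry (c *: X) u v = c * entry X u v.
Proof.
by rewrite /entry; case: (insub u : option (k.-tuple 'I_N)) (insub v : option (k.-tuple 'I_N)) => [a|] [b|]; rewrite ?mulr0 ?mxE.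
Qed.

Definition wsum (B : nmodType) k (F : seq 'I_N -> B) : B :=
  \sum_(w : k.-tuple 'I_N) F w.

Lemma eq_wsum (B : nmodType) k (F G : seq 'I_N -> B) :
  (forall w, size w = k -> F w = G w) -> wsum k F = wsum k G.
Proof. by move=> h; apply: eq_bigr => w _; apply: h; rewrite size_tuple. Qed.

Lemma entry_mul (B : pzRingType) k (X Y : 'M[B]_(tdim N k)) u v :
  size u = k -> size v = k ->
  entry (X *m Y) u v = wsum k (fun w => entry X u w * entry Y w v).
Proof.
move=> su sv; rewrite /entry /wsum.
have [a _ ua|] := insubP _ u; last by rewrite su eqxx.
have [b _ vb|] := insubP _ v; last by rewrite sv eqxx.
rewrite mxE (reindex (@enum_rank (k.-tuple 'I_N))) /=; last first.
  by exists enum_val => i _; rewrite ?enum_rankK ?enum_valK.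
by apply: eq_bigr => w _; rewrite valK.
Qed.

Lemma wsum_cat (B : nmodType) a b (F : seq 'I_N -> B) :
  wsum (a + b) F = wsum a (fun w1 => wsum b (fun w2 => F (w1 ++ w2))).
Proof.
rewrite /wsum pair_big /=.
rewrite (reindex (fun p : a.-tuple 'I_N * b.-tuple 'I_N => cat_tuple p.1 p.2)) //=.
have sz1 (w : (a + b).-tuple 'I_N) : size (take a w) == a.
  by rewrite size_take size_tuple; case: ltnP => //; lia.
have sz2 (w : (a + b).-tuple 'I_N) : size (drop a w) == b.
  by rewrite size_drop size_tuple; apply/eqP; lia.
exists (fun w : (a + b).-tuple 'I_N => (Tuple (sz1 w), Tuple (sz2 w))) => [[w1 w2] _|w _].
  by congr (_, _); apply: val_inj; rewrite /= ?take_size_cat ?drop_size_cat ?size_tuple.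
by apply: val_inj; rewrite /= cat_take_drop.
Qed.

Lemma wsum0 (B : nmodType) (F : seq 'I_N -> B) : wsum 0 F = F [::].
Proof.
rewrite /wsum (big_pred1 [tuple]) // => w; symmetry; apply/eqP.
exact: tuple0.
Qed.

Lemma wsum1 (B : nmodType) (F : seq 'I_N -> B) : wsum 1 F = \sum_i F [:: i].
Proof.
rewrite /wsum (reindex (fun i : 'I_N => [tuple i])) //.
exists (fun w : 1.-tuple 'I_N => tnth w ord0) => [i _|w _] //.
by apply: val_inj; case: w => -[|x []].
Qed.

Lemma wsum_delta (B : nmodType) k (F : seq 'I_N -> B) u : size u = k ->
  wsum k (fun w => F w *+ (u == w)) = F u.
Proof.
move=> su; rewrite /wsum (bigD1 (tcast su (in_tuple u))) //= val_tcast eqxx mulr1n.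
rewrite big1 ?addr0 // => w; rewrite -val_eqE /= val_tcast /= eq_sym => /negPf->.
by rewrite mulr0n.
Qed.

Lemma exchange_wsum (B : nmodType) a b (F : seq 'I_N -> seq 'I_N -> B) :
  wsum a (fun w1 => wsum b (F w1)) = wsum b (fun w2 => wsum a (fun w1 => F w1 w2)).
Proof. exact: exchange_big. Qed.

Lemma wsum_distrr (B : pzRingType) k (x : B) (F : seq 'I_N -> B) :
  x * wsum k F = wsum k (fun w => x * F w).
Proof. exact: mulr_sumr. Qed.

Lemma wsum_distrl (B : pzRingType) k (x : B) (F : seq 'I_N -> B) :
  wsum k F * x = wsum k (fun w => F w * x).
Proof. exact: mulr_suml. Qed.

(* [X] acting on the factors [i + 1, ..., i + p]. *)
Definition emb (B : nmodType) K i p (X : 'M[B]_(tdim N p)) : 'M[B]_(tdim N K) :=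
  tens K (fun u v => entry X (take p (drop i u)) (take p (drop i v))
    *+ ((take i u == take i v) && (drop (i + p) u == drop (i + p) v))).

Lemma siteE (C : fieldType) K i (X : 'M[C]_(tdim N 2)) : site K i X = emb K i X.
Proof. by rewrite /site /emb addn2. Qed.

Lemma entry_emb (B : nmodType) K i p (X : 'M[B]_(tdim N p)) u1 u2 u3 v1 v2 v3 :
  size u1 = i -> size u2 = p -> size v1 = i -> size v2 = p ->
  size u3 = (K - i - p)%N -> size v3 = (K - i - p)%N -> (i + p <= K)%N ->
  entry (emb K i X) (u1 ++ u2 ++ u3) (v1 ++ v2 ++ v3) =
    entry X u2 v2 *+ ((u1 == v1) && (u3 == v3)).
Proof.
move=> s1 s2 t1 t2 s3 t3 ip; rewrite entry_tens ?size_cat; [|lia..].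
rewrite (addnC i p) -!drop_drop !(drop_size_cat _ s1, drop_size_cat _ t1).
by rewrite !(take_size_cat, drop_size_cat).
Qed.

Lemma word_split K i p u : size u = K -> (i + p <= K)%N -> exists u1 u2 u3,
  [/\ u = u1 ++ u2 ++ u3, size u1 = i, size u2 = p & size u3 = (K - i - p)%N].
Proof.
move=> su ip; exists (take i u), (take p (drop i u)), (drop p (drop i u)).
rewrite !cat_take_drop !size_take !size_drop su; split=> //.
  by case: ltnP => //; lia.
by case: ltnP => //; lia.
Qed.

Lemma wsum_split (B : nmodType) K i p (F : seq 'I_N -> B) : (i + p <= K)%N ->
  wsum K F =
  wsum i (fun w1 => wsum p (fun w2 => wsum (K - i - p) (fun w3 => F (w1 ++ w2 ++ w3)))).
Proof.
move=> ip; have -> : wsum K F = wsum (i + (p + (K - i - p))) F by congr wsum; lia.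
by rewrite wsum_cat; apply: eq_wsum => w1 _; rewrite wsum_cat.
Qed.

Lemma wsumMn (B : nmodType) k (F : seq 'I_N -> B) c : wsum k (fun w => F w *+ c) = wsum k F *+ c.
Proof. by rewrite /wsum sumrMnl. Qed.

Lemma entry_embl (A : pzRingType) K i p (X : 'M[A]_(tdim N p)) (Y : 'M[A]_(tdim N K)) u1 u2 u3 v :
  size u1 = i -> size u2 = p -> size u3 = (K - i - p)%N -> (i + p <= K)%N -> size v = K ->
  entry (emb K i X *m Y) (u1 ++ u2 ++ u3) v =
    wsum p (fun w => entry X u2 w * entry Y (u1 ++ w ++ u3) v).
Proof.
move=> s1 s2 s3 ip sv; rewrite entry_mul ?size_cat; [|lia..]; rewrite (wsum_split _ ip).
rewrite (eq_wsum (G := fun w1 => wsum p (fun w2 => entry X u2 w2 *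
    entry Y (w1 ++ w2 ++ u3) v) *+ (u1 == w1))); first by rewrite wsum_delta.
move=> w1 z1; rewrite -wsumMn; apply: eq_wsum => w2 z2.
rewrite (eq_wsum (G := fun w3 => (entry X u2 w2 * entry Y (w1 ++ w2 ++ w3) v) *+
    (u1 == w1) *+ (u3 == w3))); first exact: wsum_delta.
by move=> w3 z3; rewrite entry_emb // mulrnAl -mulrnA mulnb.
Qed.

Lemma entry_embr (A : pzRingType) K i p (X : 'M[A]_(tdim N p)) (Y : 'M[A]_(tdim N K)) u1 u2 u3 v :
  size u1 = i -> size u2 = p -> size u3 = (K - i - p)%N -> (i + p <= K)%N -> size v = K ->
  entry (Y *m emb K i X) v (u1 ++ u2 ++ u3) =
    wsum p (fun w => entry Y v (u1 ++ w ++ u3) * entry X w u2).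
Proof.
move=> s1 s2 s3 ip sv; rewrite entry_mul ?size_cat; [|lia..]; rewrite (wsum_split _ ip).
rewrite (eq_wsum (G := fun w1 => wsum p (fun w2 => entry Y v (w1 ++ w2 ++ u3) *
    entry X w2 u2) *+ (u1 == w1))); first by rewrite wsum_delta.
move=> w1 z1; rewrite -wsumMn; apply: eq_wsum => w2 z2.
rewrite (eq_wsum (G := fun w3 => (entry Y v (w1 ++ w2 ++ w3) * entry X w2 u2) *+
    (u1 == w1) *+ (u3 == w3))); first exact: wsum_delta.
move=> w3 z3; rewrite entry_emb // mulrnAr -mulrnA mulnb.
by rewrite (eq_sym w1) (eq_sym w3).
Qed.

Lemma emb_mul (B : pzRingType) K i p (X Y : 'M[B]_(tdim N p)) : (i + p <= K)%N ->
  emb K i X *m emb K i Y = emb K i (X *m Y).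
Proof.
move=> ip; apply: eq_entry => u v su sv.
have [u1 [u2 [u3 [uE s1 s2 s3]]]] := word_split su ip.
have [v1 [v2 [v3 [vE t1 t2 t3]]]] := word_split sv ip.
rewrite uE entry_embl // vE entry_emb // entry_mul // -wsumMn; apply: eq_wsum => w zw.
by rewrite entry_emb // mulrnAr.
Qed.

Lemma entry_scalar (B : pzRingType) k (a : B) u v : size u = k -> size v = k ->
  entry (a%:M : 'M[B]_(tdim N k)) u v = a *+ (u == v).
Proof.
move=> su sv; rewrite /entry.
have [c _ uc|] := insubP _ u; last by rewrite su eqxx.
have [d _ vd|] := insubP _ v; last by rewrite sv eqxx.
by rewrite mxE (inj_eq enum_rank_inj) -val_eqE /= uc vd.
Qed.

Lemma emb_scalar (B : pzRingType) K i p (a : B) : (i + p <= K)%N ->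
  emb K i (a%:M : 'M[B]_(tdim N p)) = a%:M.
Proof.
move=> ip; apply: eq_entry => u v su sv; rewrite entry_scalar //.
have [u1 [u2 [u3 [uE s1 s2 s3]]]] := word_split su ip.
have [v1 [v2 [v3 [vE t1 t2 t3]]]] := word_split sv ip.
rewrite uE vE entry_emb // entry_scalar // !eqseq_cat ?s1 ?s2 ?s3 //.
by rewrite -mulrnA; congr (_ *+ _); case: eqP; case: eqP; case: eqP.
Qed.

Lemma emb_id (B : nmodType) k (X : 'M[B]_(tdim N k)) : emb k 0 X = X.
Proof.
apply: eq_entry => u v su sv; rewrite entry_tens // !drop0 !take0 add0n.
by rewrite !take_oversize ?drop_oversize ?su ?sv // eqxx mulr1n.
Qed.

Lemma emb_emb (B : nmodType) K i p j r (X : 'M[B]_(tdim N r)) :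
  (i + p <= K)%N -> (j + r <= p)%N -> emb K i (emb p j X) = emb K (i + j) X.
Proof.
move=> ip jr; apply: eq_entry => u v su sv.
have [u1 [u2 [u3 [-> s1 s2 s3]]]] := word_split su ip.
have [v1 [v2 [v3 [-> t1 t2 t3]]]] := word_split sv ip.
have [u4 [u5 [u6 [uE s4 s5 s6]]]] := word_split s2 jr.
have [v4 [v5 [v6 [vE t4 t5 t6]]]] := word_split t2 jr.
rewrite entry_emb // uE vE entry_emb //.
rewrite -!catA !(catA _ u4) !(catA _ v4) entry_emb ?size_cat; [|lia..].
rewrite -mulrnA; congr (_ *+ _); rewrite !eqseq_cat ?s1 ?s4 ?s6 ?t1 ?t4 ?t6 //.
by case: eqP; case: eqP; case: eqP; case: eqP.
Qed.

(** Disjoint factors do not suffice here: the entries may lie in a noncommutative algebra, hence the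
    condition on them. *)
Lemma emb_comm (B : pzRingType) K i p j r (X : 'M[B]_(tdim N p)) (Y : 'M[B]_(tdim N r)) :
  (i + p <= j)%N -> (j + r <= K)%N ->
  (forall u v u' v', entry X u v * entry Y u' v' = entry Y u' v' * entry X u v) ->
  emb K i X *m emb K j Y = emb K j Y *m emb K i X.
Proof.
move=> pj jr cXY; apply: eq_entry => u v su sv.
have [u' [u4 [u5 [uE zu s4 s5]]]] := word_split su jr.
have [v' [v4 [v5 [vE zv t4 t5]]]] := word_split sv jr.
have [u1 [u2 [u3 [u'E s1 s2 s3]]]] := word_split zu pj.
have [v1 [v2 [v3 [v'E t1 t2 t3]]]] := word_split zv pj.
have ip : (i + p <= K)%N by lia.
rewrite uE (entry_embl Y) // u'E -!catA entry_embl ?size_cat //; last by lia.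
transitivity (entry X u2 v2 * entry Y u4 v4 *+ [&& u1 == v1, u3 == v3 & u5 == v5]).
  rewrite -[LHS](eq_wsum (F := fun w => entry X u2 w * entry Y u4 v4 *+
    [&& u1 == v1, u3 == v3 & u5 == v5] *+ (v2 == w))) ?wsum_delta // => w zw.
  have -> : u1 ++ w ++ u3 ++ u4 ++ u5 = (u1 ++ w ++ u3) ++ u4 ++ u5 by rewrite -!catA.
  rewrite vE v'E entry_emb ?size_cat //; [|lia..].
  rewrite mulrnAr -mulrnA !eqseq_cat ?zw ?s1 ?s3 // (eq_sym v2); congr (_ *+ _).
  by do ![case: eqP => //].
rewrite cXY -[RHS](eq_wsum (F := fun w => entry Y u4 w * entry X u2 v2 *+
    [&& u1 == v1, u3 == v3 & u5 == v5] *+ (v4 == w))) ?wsum_delta // => w zw.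
rewrite vE v'E -!catA entry_emb ?size_cat //; [|lia..].
rewrite mulrnAr -mulrnA !eqseq_cat ?zw ?s3 // (eq_sym v4); congr (_ *+ _).
by do ![case: eqP => //].
Qed.

Lemma siteM (C : fieldType) K i (X Y : 'M[C]_(tdim N 2)) : (i + 2 <= K)%N ->
  site K i X *m site K i Y = site K i (X *m Y).
Proof. by move=> iK; rewrite !siteE emb_mul. Qed.

Lemma site1 (C : fieldType) K i : (i + 2 <= K)%N ->
  site K i (1%:M : 'M[C]_(tdim N 2)) = 1%:M.
Proof. by move=> iK; rewrite siteE emb_scalar. Qed.

End Words.

(** * Partial R-traces *)

Section PartialTrace.
Variables (C : fieldType) (A : algType C) (N : nat).
Implicit Types (u v w : seq 'I_N).

Lemma entry_scal k (X : 'M[C]_(tdim N k)) u v : entry (scal_mx A X) u v = (entry X u v)%:A.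
Proof.
rewrite /entry; case: (insub u : option (k.-tuple 'I_N)) (insub v : option (k.-tuple 'I_N))
  => [a|] [b|]; by rewrite ?mxE ?scale0r.
Qed.

Lemma scal_emb K i p (X : 'M[C]_(tdim N p)) : scal_mx A (emb K i X) = emb K i (scal_mx A X).
Proof.
apply: eq_entry => u v su sv; rewrite entry_scal !entry_tens // entry_scal.
by rewrite scalerMnl.
Qed.

Lemma scal_mul k (X Y : 'M[C]_(tdim N k)) : scal_mx A (X *m Y) = scal_mx A X *m scal_mx A Y.
Proof. exact: map_mxM. Qed.

Lemma scal_scalar k (c : C) : scal_mx A (c%:M : 'M_(tdim N k)) = (c%:A)%:M.
Proof. by apply/matrixP => i j; rewrite !mxE scalerMnl. Qed.

Lemma scal1 k : scal_mx A (1%:M : 'M_(tdim N k)) = 1%:M.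
Proof. by rewrite scal_scalar scale1r. Qed.

Lemma scal_central k (a : A) (X : 'M[C]_(tdim N k)) : a%:M *m scal_mx A X = scal_mx A X *m a%:M.
Proof.
apply/matrixP => i j; rewrite mul_scalar_mx [RHS]mxE (bigD1 j) //= big1 => [|l /negPf lj].
  by rewrite !mxE eqxx addr0 mulr_algl mulr_algr.
by rewrite !mxE lj mulr0n mulr0.
Qed.

Lemma emb_scal_comm K i p j r (X : 'M[A]_(tdim N p)) (Y : 'M[C]_(tdim N r)) :
  (i + p <= j)%N -> (j + r <= K)%N ->
  emb K i X *m emb K j (scal_mx A Y) = emb K j (scal_mx A Y) *m emb K i X.
Proof.
move=> h1 h2; apply: emb_comm => // u v u' v'.
by rewrite entry_scal mulr_algl mulr_algr.
Qed.

Variable D : 'M[C]_N.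

Definition dweight u v : C := \prod_(p <- zip u v) D p.1 p.2.

Lemma dweight_cat u1 u2 v1 v2 : size u1 = size v1 ->
  dweight (u1 ++ u2) (v1 ++ v2) = dweight u1 v1 * dweight u2 v2.
Proof. by move=> e; rewrite /dweight zip_cat // big_cat. Qed.

Lemma RtraceE r K (Y : 'M[A]_(tdim N K)) u v : Rtrace D r Y u v =
  wsum r (fun s => wsum r (fun t => dweight s t *: entry Y (u ++ t) (v ++ s))).
Proof.
apply: eq_bigr => s _; apply: eq_bigr => t _; congr (_ *: _).
rewrite /dweight -[zip s t]/(tval (zip_tuple s t)) big_tuple.
apply: eq_bigr => j _; rewrite (tnth_nth (tnth s j, tnth t j)) /= nth_zip ?size_tuple //=.
by rewrite -!tnth_nth.
Qed.

(** For [k = 0] the result is a matrix of size 1, whose entry at the empty words is the full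
    trace. *)
Definition ptr K k (Y : 'M[A]_(tdim N K)) : 'M[A]_(tdim N k) :=
  tens k (Rtrace D (K - k) Y).

Lemma entry_ptr K k (Y : 'M[A]_(tdim N K)) u v : size u = k -> size v = k ->
  entry (ptr k Y) u v = wsum (K - k) (fun s => wsum (K - k) (fun t =>
    dweight s t *: entry Y (u ++ t) (v ++ s))).
Proof. by move=> su sv; rewrite entry_tens // RtraceE. Qed.

Lemma scaler_wsum k (c : C) (F : seq 'I_N -> A) : c *: wsum k F = wsum k (fun w => c *: F w).
Proof. exact: scaler_sumr. Qed.

Lemma ptr_comp K k j (Y : 'M[A]_(tdim N K)) : (j <= k)%N -> (k <= K)%N ->
  ptr j (ptr k Y) = ptr j Y.
Proof.
move=> jk kK; apply: eq_entry => u v su sv; rewrite !entry_ptr //.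
have sp F : wsum (K - j) F = wsum (k - j) (fun w1 => wsum (K - k) (fun w2 => F (w1 ++ w2))) :> A.
  by rewrite -wsum_cat; congr wsum; lia.
rewrite sp; apply: eq_wsum => s1 z1.
rewrite (eq_wsum (G := fun t1 => wsum (K - k) (fun s2 => wsum (K - k) (fun t2 =>
  dweight (s1 ++ s2) (t1 ++ t2) *: entry Y (u ++ t1 ++ t2) (v ++ s1 ++ s2))))).
  by rewrite exchange_wsum; apply: eq_wsum => s2 _; rewrite sp.
move=> t1 y1; rewrite entry_ptr ?size_cat; [|lia..].
rewrite scaler_wsum; apply: eq_wsum => s2 _; rewrite scaler_wsum; apply: eq_wsum => t2 _.
by rewrite scalerA dweight_cat ?z1 // !catA.
Qed.

Lemma ptr_id K (Y : 'M[A]_(tdim N K)) : ptr K Y = Y.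
Proof.
apply: eq_entry => u v su sv; rewrite entry_ptr // subnn !wsum0 /dweight big_nil scale1r.
by rewrite !cats0.
Qed.

Lemma entry_emb_mull K k (X : 'M[A]_(tdim N k)) (Y : 'M[A]_(tdim N K)) u t v :
  (k <= K)%N -> size u = k -> size t = (K - k)%N -> size v = K ->
  entry (emb K 0 X *m Y) (u ++ t) v = wsum k (fun w => entry X u w * entry Y (w ++ t) v).
Proof. by move=> *; rewrite -[u ++ t]cat0s entry_embl // subn0. Qed.

Lemma entry_emb_mulr K k (X : 'M[A]_(tdim N k)) (Y : 'M[A]_(tdim N K)) u t v :
  (k <= K)%N -> size u = k -> size t = (K - k)%N -> size v = K ->
  entry (Y *m emb K 0 X) v (u ++ t) = wsum k (fun w => entry Y v (w ++ t) * entry X w u).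
Proof. by move=> *; rewrite -[u ++ t]cat0s entry_embr // subn0. Qed.

Lemma ptr_mull K k (X : 'M[A]_(tdim N k)) (Y : 'M[A]_(tdim N K)) : (k <= K)%N ->
  ptr k (emb K 0 X *m Y) = X *m ptr k Y.
Proof.
move=> kK; apply: eq_entry => u v su sv; rewrite entry_mul // entry_ptr //.
rewrite [RHS](eq_wsum (G := fun w => wsum (K - k) (fun s => wsum (K - k) (fun t =>
  dweight s t *: (entry X u w * entry Y (w ++ t) (v ++ s)))))); last first.
  move=> w zw; rewrite entry_ptr // wsum_distrr; apply: eq_wsum => s _.
  by rewrite wsum_distrr; apply: eq_wsum => t _; rewrite -scalerAr.
rewrite [RHS]exchange_wsum; apply: eq_wsum => s zs; rewrite [RHS]exchange_wsum; apply: eq_wsum => t zt.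
by rewrite entry_emb_mull ?scaler_wsum ?size_cat //; lia.
Qed.

Lemma ptr_mulr K k (X : 'M[A]_(tdim N k)) (Y : 'M[A]_(tdim N K)) : (k <= K)%N ->
  ptr k (Y *m emb K 0 X) = ptr k Y *m X.
Proof.
move=> kK; apply: eq_entry => u v su sv; rewrite entry_mul // entry_ptr //.
rewrite [RHS](eq_wsum (G := fun w => wsum (K - k) (fun s => wsum (K - k) (fun t =>
  dweight s t *: (entry Y (u ++ t) (w ++ s) * entry X w v))))); last first.
  move=> w zw; rewrite entry_ptr // wsum_distrl; apply: eq_wsum => s _.
  by rewrite wsum_distrl; apply: eq_wsum => t _; rewrite -scalerAl.
rewrite [RHS]exchange_wsum; apply: eq_wsum => s zs; rewrite [RHS]exchange_wsum; apply: eq_wsum => t zt.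
by rewrite entry_emb_mulr ?scaler_wsum ?size_cat //; lia.
Qed.

End PartialTrace.

(** * Skew inverses and R-traces *)

Notation braided R := (site 3 0 R *m site 3 1 R *m site 3 0 R =
  site 3 1 R *m site 3 0 R *m site 3 1 R) (only parsing).
Notation slides_up X F := (site 3 1 X *m site 3 0 F *m site 3 1 F =
  site 3 0 F *m site 3 1 F *m site 3 0 X) (only parsing).
Notation slides_down X F := (site 3 0 X *m site 3 1 F *m site 3 0 F =
  site 3 1 F *m site 3 0 F *m site 3 1 X) (only parsing).

Section SkewInverse.
Variables (C : fieldType) (N : nat).
Implicit Types X Y Z Psi F G R : 'M[C]_(tdim N 2).
Implicit Types (u v w : seq 'I_N).

Definition e2 X (a b c d : 'I_N) : C := entry X [:: a; b] [:: c; d].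

Lemma wsum2 (B : nmodType) (f : seq 'I_N -> B) :
  wsum 2 f = \sum_a \sum_b f [:: a; b].
Proof. by rewrite -[2%N]/(1 + 1)%N wsum_cat wsum1; apply: eq_bigr => a _; rewrite wsum1. Qed.

Lemma e2_mul X Y a b c d : e2 (X *m Y) a b c d = \sum_x \sum_y e2 X a b x y * e2 Y x y c d.
Proof. by rewrite /e2 entry_mul // wsum2. Qed.

Lemma sum_deltar (B : nmodType) (a : 'I_N) (f : 'I_N -> B) : \sum_x f x *+ (x == a) = f a.
Proof.
rewrite (bigD1 a) //= eqxx mulr1n big1 ?addr0 // => x /negPf ->.
by rewrite mulr0n.
Qed.

Lemma sum_deltal (B : nmodType) (a : 'I_N) (f : 'I_N -> B) : \sum_x f x *+ (a == x) = f a.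
Proof. by under eq_bigr do rewrite eq_sym; exact: sum_deltar. Qed.

Lemma e2_1 a b c d : e2 1%:M a b c d = ((a == c) && (b == d))%:R.
Proof. by rewrite /e2 entry_scalar // !eqseq_cons eqxx andbT. Qed.

Lemma eq_e2 X Y : (forall a b c d, e2 X a b c d = e2 Y a b c d) -> X = Y.
Proof.
move=> h; apply: eq_entry => u v; case: u => [|a [|b [|x u]]] //.
by case: v => [|c [|d [|y v]]] // _ _; exact: h.
Qed.

Lemma entry_site0 Y (x1 x2 x3 y1 y2 y3 : 'I_N) :
  entry (site 3 0 Y) [:: x1; x2; x3] [:: y1; y2; y3] = e2 Y x1 x2 y1 y2 *+ (x3 == y3).
Proof. by rewrite entry_tens //= !eqseq_cons eqxx ?andbT ?andTb. Qed.

Lemma entry_site1 Y (x1 x2 x3 y1 y2 y3 : 'I_N) :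
  entry (site 3 1 Y) [:: x1; x2; x3] [:: y1; y2; y3] = e2 Y x2 x3 y2 y3 *+ (x1 == y1).
Proof. by rewrite entry_tens //= !eqseq_cons eqxx ?andbT ?andTb. Qed.

Lemma entry_site0_mul Y (W : 'M[C]_(tdim N 3)) x1 x2 x3 v : size v = 3%N ->
  entry (site 3 0 Y *m W) [:: x1; x2; x3] v =
    \sum_a \sum_b e2 Y x1 x2 a b * entry W [:: a; b; x3] v.
Proof.
move=> sv; rewrite siteE -[[:: x1; x2; x3]]/([::] ++ [:: x1; x2] ++ [:: x3]).
by rewrite entry_embl // wsum2.
Qed.

Lemma entry_site1_mul Y (W : 'M[C]_(tdim N 3)) x1 x2 x3 v : size v = 3%N ->
  entry (site 3 1 Y *m W) [:: x1; x2; x3] v =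
    \sum_a \sum_b e2 Y x2 x3 a b * entry W [:: x1; a; b] v.
Proof.
move=> sv; rewrite siteE -[[:: x1; x2; x3]]/([:: x1] ++ [:: x2; x3] ++ [::]).
by rewrite entry_embl // wsum2.
Qed.

Lemma entry_mul_site1 Y (W : 'M[C]_(tdim N 3)) x1 x2 x3 v : size v = 3%N ->
  entry (W *m site 3 1 Y) v [:: x1; x2; x3] =
    \sum_a \sum_b entry W v [:: x1; a; b] * e2 Y a b x2 x3.
Proof.
move=> sv; rewrite siteE -[[:: x1; x2; x3]]/([:: x1] ++ [:: x2; x3] ++ [::]).
by rewrite entry_embr // wsum2.
Qed.

Lemma entry_010 X Y Z x1 x2 x3 y1 y2 y3 :
  entry (site 3 0 X *m (site 3 1 Y *m site 3 0 Z)) [:: x1; x2; x3] [:: y1; y2; y3] =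
  \sum_a \sum_b \sum_c e2 X x1 x2 a b * e2 Y b x3 c y3 * e2 Z a c y1 y2.
Proof.
rewrite entry_site0_mul //; apply: eq_bigr => a _; apply: eq_bigr => b _.
rewrite entry_site1_mul // mulr_sumr; apply: eq_bigr => c _.
rewrite -(sum_deltar y3 (fun d => _ * e2 Y b x3 c d * _)) mulr_sumr; apply: eq_bigr => d _.
by rewrite entry_site0 !mulrnAr mulrA.
Qed.

Lemma entry_101 X Y Z x1 x2 x3 y1 y2 y3 :
  entry (site 3 1 X *m (site 3 0 Y *m site 3 1 Z)) [:: x1; x2; x3] [:: y1; y2; y3] =
  \sum_a \sum_b \sum_c e2 X x2 x3 a b * e2 Y x1 a y1 c * e2 Z c b y2 y3.
Proof.
rewrite entry_site1_mul //; apply: eq_bigr => a _; apply: eq_bigr => b _.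
rewrite entry_site0_mul // exchange_big mulr_sumr; apply: eq_bigr => c _.
rewrite -(sum_deltar y1 (fun d => _ * e2 Y x1 a d c * _)) mulr_sumr; apply: eq_bigr => d _.
by rewrite entry_site1 !mulrnAr mulrA.
Qed.

Section Conjugation.
Variables (X Psi : 'M[C]_(tdim N 2)).
Hypothesis X_Psi : skew_inverse X Psi.

(** The definition says that one reshuffled square matrix is a right inverse of another; it is then
    also a left inverse. *)
Lemma skew_left b d x y :
  \sum_i \sum_k e2 Psi x k y i * e2 X i b k d = ((y == b) && (x == d))%:R.
Proof.
pose I := {: 'I_N * 'I_N}.
pose P : 'M[C]_#|I| := \matrix_(p, r) e2 X (enum_val p).1 (enum_val r).1 (enum_val p).2 (enum_val r).2.
pose Q : 'M[C]_#|I| := \matrix_(p, r) e2 Psi (enum_val p).2 (enum_val r).2 (enum_val p).1 (enum_val r).1.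
have PQ : P *m Q = 1%:M.
  apply/matrixP => p r; rewrite !mxE -(inj_eq enum_val_inj).
  rewrite -pair_eqE /pair_eq /= (eq_sym (enum_val p).2) -X_Psi pair_big /=.
  rewrite (reindex_onto (@enum_val I predT) enum_rank) /=; last by move=> ? _; rewrite enum_rankK.
  apply: eq_big => [z|z _]; first by rewrite enum_valK eqxx.
  by rewrite !mxE.
have /matrixP/(_ (enum_rank (y, x)) (enum_rank (b, d))) := mulmx1C PQ.
rewrite !mxE (inj_eq enum_rank_inj) xpair_eqE => <-.
rewrite pair_big /= (reindex_onto (@enum_val I predT) enum_rank) /=; last by move=> ? _; rewrite enum_rankK.
apply: eq_big => [z|z _]; first by rewrite enum_valK eqxx.
by rewrite !mxE !enum_rankK.
Qed.

Lemma skew_right i j k l :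
  \sum_a \sum_b e2 X i a k b * e2 Psi b j a l = ((i == l) && (j == k))%:R.
Proof. exact: X_Psi. Qed.

(** The kernels are scalar while the unknowns lie in a module, as entries of a quantum matrix do;
    invertibility of a kernel is used in this form. *)
Lemma left_inverse_kernel (I J : finType) (P : J -> I -> C) (Q : I -> J -> C)
    (V : lmodType C) (Z : I -> V) :
  (forall i i', \sum_j Q i j * P j i' = (i == i')%:R) ->
  (forall j, \sum_i P j i *: Z i = 0) -> forall i, Z i = 0.
Proof.
move=> QP PZ i; transitivity (\sum_j Q i j *: \sum_i' P j i' *: Z i').
  have E i' : \sum_j Q i j *: (P j i' *: Z i') = Z i' *+ (i == i').
    by under eq_bigr do rewrite scalerA; rewrite -scaler_suml QP scaler_nat.
  under eq_bigr do rewrite scaler_sumr; rewrite exchange_big /=.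
  rewrite (bigD1 i) //= E eqxx mulr1n big1 ?addr0 // => i' /negPf i'i.
  by rewrite E eq_sym i'i mulr0n.
by rewrite big1 // => j _; rewrite PZ scaler0.
Qed.

Lemma skew_kernel (V : lmodType C) (Z : 'I_N -> 'I_N -> V) :
  (forall a b, \sum_i \sum_k e2 X i a k b *: Z i k = 0) -> forall i k, Z i k = 0.
Proof.
move=> h i k.
apply: (@left_inverse_kernel _ _ (fun (p q : 'I_N * 'I_N) => e2 X q.1 p.1 q.2 p.2)
  (fun p q => e2 Psi q.2 p.2 q.1 p.1) _ (fun p => Z p.1 p.2) _ _ (i, k)).
  move=> [l j] [i' k'] /=; rewrite -(pair_bigA _ (fun a b => e2 Psi b j a l * e2 X i' a k' b)) /=.
  rewrite -pair_eqE /pair_eq /= (eq_sym l) -skew_right.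
  by apply: eq_bigr => a _; apply: eq_bigr => b _; rewrite mulrC.
by move=> [a b] /=; rewrite -(pair_bigA _ (fun i k => e2 X i a k b *: Z i k)) h.
Qed.

Lemma skew_inverse_kernel (V : lmodType C) (Z : 'I_N -> 'I_N -> V) :
  (forall i k, \sum_a \sum_b e2 Psi b k a i *: Z a b = 0) -> forall a b, Z a b = 0.
Proof.
move=> h a b.
apply: (@left_inverse_kernel _ _ (fun (p q : 'I_N * 'I_N) => e2 Psi q.2 p.2 q.1 p.1)
  (fun p q => e2 X q.1 p.1 q.2 p.2) _ (fun p => Z p.1 p.2) _ _ (a, b)).
  move=> [b' d] [y x] /=; rewrite -(pair_bigA _ (fun i k => e2 X i b' k d * e2 Psi x k y i)) /=.
  rewrite -pair_eqE /pair_eq /= (eq_sym b') (eq_sym d) -skew_left.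
  by apply: eq_bigr => i _; apply: eq_bigr => k _; rewrite mulrC.
by move=> [i k] /=; rewrite -(pair_bigA _ (fun a b => e2 Psi b k a i *: Z a b)) h.
Qed.

Definition dpsi x y := \sum_z e2 Psi x z y z.

(** This is Tr_X(2) X = Id, obtained by contracting the defining relation of [Psi]. *)
Lemma trace_dpsi a c : \sum_j \sum_l dpsi l j * e2 X a j c l = (a == c)%:R.
Proof.
transitivity (\sum_z \sum_j \sum_l e2 X a j c l * e2 Psi l z j z).
  rewrite [RHS]exchange_big; apply: eq_bigr => j _; rewrite [RHS]exchange_big.
  by apply: eq_bigr => l _; rewrite mulrC /dpsi mulr_sumr.
under eq_bigr do rewrite skew_right.
rewrite -(sum_deltal a (fun z => (z == c)%:R)); apply: eq_bigr => z _.
by rewrite -mulrnA mulnC mulnb.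
Qed.

Variables F G : 'M[C]_(tdim N 2).
Hypotheses (FG : F *m G = 1%:M) (GF : G *m F = 1%:M).
Hypothesis XFF : slides_up X F.

Lemma conj_swap : site 3 0 G *m (site 3 1 X *m site 3 0 F) = site 3 1 F *m (site 3 0 X *m site 3 1 G).
Proof.
transitivity (site 3 0 G *m (site 3 1 X *m site 3 0 F *m site 3 1 F) *m site 3 1 G).
  by rewrite -!mulmxA siteM // FG site1 // mulmx1.
by rewrite XFF !mulmxA siteM // GF site1 // mul1mx.
Qed.

Let W := site 3 0 G *m (site 3 1 X *m site 3 0 F).

(* [F_1^-1 X_2 F_1 = F_2 X_1 F_2^-1] contracted with [Psi] on the first factor. *)
Lemma conj_dual x x2 x3 y y2 y3 :
  \sum_b e2 F x2 x3 y b * e2 G x b y2 y3 =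
  \sum_x1 \sum_y1 e2 Psi x y1 y x1 * entry W [:: x1; x2; x3] [:: y1; y2; y3].
Proof.
transitivity (\sum_a \sum_b \sum_c (\sum_x1 \sum_y1 e2 Psi x y1 y x1 * e2 X x1 a y1 c) *
    (e2 F x2 x3 a b * e2 G c b y2 y3)).
  rewrite -(sum_deltal y (fun a => \sum_b e2 F x2 x3 a b * e2 G x b y2 y3)).
  apply: eq_bigr => a _; rewrite -sumrMnl; apply: eq_bigr => b _.
  rewrite -(sum_deltal x (fun c => e2 F x2 x3 a b * e2 G c b y2 y3)) -sumrMnl.
  by apply: eq_bigr => c _; rewrite skew_left mulr_natl -mulrnA mulnC mulnb.
under [RHS]eq_bigr do under eq_bigr do rewrite /W conj_swap entry_101 !pair_bigA /= mulr_sumr.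
rewrite [LHS]pair_bigA [LHS]pair_bigA [RHS]pair_bigA [RHS]exchange_big /=.
apply: eq_bigr => -[[a b] c] _ /=; rewrite pair_bigA /= mulr_suml; apply: eq_bigr => p _ /=.
by rewrite -!mulrA; congr (_ * _); rewrite mulrCA.
Qed.

Lemma conj_trace_aux x1 x2 y1 y2 :
  \sum_s \sum_t dpsi s t * entry W [:: x1; x2; t] [:: y1; y2; s] = ((x1 == y1) && (x2 == y2))%:R.
Proof.
rewrite -e2_1 -GF e2_mul.
transitivity (\sum_a \sum_b \sum_c (\sum_t \sum_s dpsi s t * e2 X b t c s) * (e2 G x1 x2 a b * e2 F a c y1 y2)).
  under eq_bigr do under eq_bigr do rewrite /W entry_010 !pair_bigA /= mulr_sumr.
  rewrite [RHS]pair_bigA [RHS]pair_bigA [LHS]pair_bigA [LHS]exchange_big /=.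
  apply: eq_bigr => -[[a b] c] _ /=; rewrite [in RHS]exchange_big /= pair_bigA /= mulr_suml; apply: eq_bigr => p _ /=.
  by rewrite -!mulrA; congr (_ * _); rewrite mulrCA.
apply: eq_bigr => a _; apply: eq_bigr => b _.
rewrite -(sum_deltal b (fun c => e2 G x1 x2 a b * e2 F a c y1 y2)).
by apply: eq_bigr => c _; rewrite trace_dpsi mulr_natl.
Qed.

(* [Tr_X(2) (F Y_1 F^-1) = Tr_X (Y) Id], read off on matrix units [Y]. *)
Lemma conj_trace x y i i' :
  \sum_s \sum_t dpsi s t * (\sum_l e2 F i t y l * e2 G x l i' s) = dpsi x y *+ (i == i').
Proof.
under eq_bigr do under eq_bigr do rewrite conj_dual !pair_bigA mulr_sumr.
rewrite pair_bigA exchange_big /=.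
transitivity (\sum_z \sum_u (e2 Psi x u y z *+ (z == u)) *+ (i == i')).
  rewrite [RHS]pair_bigA; apply: eq_bigr => -[x1 y1] _ /=.
  rewrite -mulrnA mulnb -[RHS]mulr_natr -conj_trace_aux pair_bigA /= mulr_sumr.
  by apply: eq_bigr => p _; rewrite mulrCA.
by rewrite /dpsi -sumrMnl; apply: eq_bigr => z _; rewrite sumrMnl sum_deltal.
Qed.

End Conjugation.
End SkewInverse.

(** * Consequences of compatibility *)

Section CompatiblePair.
Variables (C : fieldType) (N : nat).
Implicit Types X Y Psi F G Theta : 'M[C]_(tdim N 2).

(** Solves a relation in which [W] occurs contracted with [Y], by a further contraction with the
    skew inverse of [Y]. *)
Lemma skew_contract_right Y Theta (W : 'I_N -> 'I_N -> 'I_N -> 'I_N -> C) Z :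
  skew_inverse Y Theta ->
  (forall x y i i', \sum_t \sum_l W x l i' t * e2 Y i t y l = Z x y *+ (i == i')) ->
  forall x b i a, W x b i a = \sum_y Z x y * e2 Theta b y a i.
Proof.
move=> YT WZ x b i' a.
transitivity (\sum_t \sum_l W x l i' t * (\sum_i \sum_y e2 Theta b y a i * e2 Y i t y l)).
  rewrite -(sum_deltal a (W x b i')); apply: eq_bigr => t _.
  rewrite -(sum_deltal b (fun l => W x l i' t)) -sumrMnl; apply: eq_bigr => l _.
  by rewrite (skew_left YT) mulr_natr -mulrnA mulnC mulnb.
transitivity (\sum_i \sum_y e2 Theta b y a i * (\sum_t \sum_l W x l i' t * e2 Y i t y l)).
  under eq_bigr do under eq_bigr do rewrite pair_bigA mulr_sumr.
  rewrite pair_bigA [LHS]exchange_big [RHS]pair_bigA; apply: eq_bigr => -[i y] _ /=.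
  by rewrite pair_bigA mulr_sumr; apply: eq_bigr => p _; rewrite mulrCA.
rewrite exchange_big; apply: eq_bigr => y _.
rewrite -(sum_deltar i' (fun i => Z x y * e2 Theta b y a i)); apply: eq_bigr => i _.
by rewrite WZ mulrnAr mulrC.
Qed.

Lemma skew_contract_left Y Theta (W : 'I_N -> 'I_N -> 'I_N -> 'I_N -> C) Z :
  skew_inverse Y Theta ->
  (forall x y i i', \sum_s \sum_l W i s y l * e2 Y x l i' s = Z x y *+ (i == i')) ->
  forall i b y a, W i b y a = \sum_x Z x y * e2 Theta b i a x.
Proof.
move=> YT WZ i b y a.
transitivity (\sum_s \sum_l W i s y l * (\sum_x \sum_i' e2 Theta b i' a x * e2 Y x l i' s)).
  rewrite -(sum_deltal b (fun s => W i s y a)); apply: eq_bigr => s _.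
  rewrite -(sum_deltal a (fun l => W i s y l)) -sumrMnl; apply: eq_bigr => l _.
  by rewrite (skew_left YT) mulr_natr -mulrnA mulnb.
transitivity (\sum_x \sum_i' e2 Theta b i' a x * (\sum_s \sum_l W i s y l * e2 Y x l i' s)).
  under eq_bigr do under eq_bigr do rewrite pair_bigA mulr_sumr.
  rewrite pair_bigA [LHS]exchange_big [RHS]pair_bigA; apply: eq_bigr => -[x i'] _ /=.
  by rewrite pair_bigA mulr_sumr; apply: eq_bigr => p _; rewrite mulrCA.
apply: eq_bigr => x _.
rewrite -(sum_deltal i (fun i' => Z x y * e2 Theta b i' a x)); apply: eq_bigr => i' _.
by rewrite WZ mulrnAr mulrC.
Qed.

Section Conv.
Variables X Psi F G Theta : 'M[C]_(tdim N 2).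
Hypothesis X_Psi : skew_inverse X Psi.
Hypotheses (FG : F *m G = 1%:M) (GF : G *m F = 1%:M).
Hypothesis XFF : slides_up X F.

Lemma conv_right : skew_inverse F Theta -> forall x b i a,
  \sum_s e2 G x b i s * dpsi Psi s a = \sum_y dpsi Psi x y * e2 Theta b y a i.
Proof.
move=> FT; apply: (skew_contract_right FT (W := fun x b i a => \sum_s e2 G x b i s * dpsi Psi s a)).
move=> x y i i'; rewrite -(conj_trace X_Psi FG GF XFF) exchange_big [RHS]exchange_big /=.
under [RHS]eq_bigr do under eq_bigr do rewrite mulr_sumr.
under eq_bigr do under eq_bigr do rewrite mulr_suml.
rewrite exchange_big /=; apply: eq_bigr => t _; rewrite exchange_big /=.
apply: eq_bigr => s _; apply: eq_bigr => l _.
by rewrite [e2 G _ _ _ _ * _]mulrC -mulrA; congr (_ * _); rewrite mulrC.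
Qed.

Lemma conv_left : skew_inverse G Theta -> forall i b y a,
  \sum_t dpsi Psi b t * e2 F i t y a = \sum_x dpsi Psi x y * e2 Theta b i a x.
Proof.
move=> FT; apply: (skew_contract_left FT (W := fun i b y a => \sum_t dpsi Psi b t * e2 F i t y a)).
move=> x y i i'; rewrite -(conj_trace X_Psi FG GF XFF); apply: eq_bigr => s _ /=.
under [RHS]eq_bigr do rewrite mulr_sumr.
under eq_bigr do rewrite mulr_suml.
rewrite exchange_big /=; apply: eq_bigr => t _.
by apply: eq_bigr => l _; rewrite mulrA.
Qed.

End Conv.

Lemma swap_inverse X F G : F *m G = 1%:M -> G *m F = 1%:M ->
  slides_down X F ->
  slides_up X G.
Proof.
move=> FG GF XFF.
transitivity (site 3 0 G *m site 3 1 G *m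
  (site 3 1 F *m site 3 0 F *m site 3 1 X) *m (site 3 0 G *m site 3 1 G)).
  rewrite !mulmxA -(mulmxA _ (site 3 1 G)) siteM // GF site1 // mulmx1.
  by rewrite siteM // GF site1 // mul1mx.
rewrite -XFF -!mulmxA (mulmxA (site 3 0 F)) siteM // FG site1 // mul1mx.
by rewrite siteM // FG site1 // mulmx1.
Qed.

(* [D_2 R^-1 = Psi' D_1] and [R^-1 D_2 = D_1 Psi'], where [Psi'] is [Psi] with
   both pairs of indices flipped. *)
Lemma dpsi_comm R Ri Psi : skew_inverse R Psi -> R *m Ri = 1%:M -> Ri *m R = 1%:M ->
  braided R ->
  forall z b y a, \sum_p \sum_t dpsi Psi z p * dpsi Psi b t * e2 Ri p t y a =
    \sum_p \sum_s e2 Ri z b p s * (dpsi Psi p y * dpsi Psi s a).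
Proof.
move=> RP RV VR RR z b y a.
have cR := conv_right RP RV VR (esym RR) RP.
have cL := conv_left RP VR RV (swap_inverse RV VR RR) RP.
transitivity (\sum_p \sum_x dpsi Psi z p * dpsi Psi x y * e2 Psi b p a x).
  apply: eq_bigr => p _; under eq_bigr do rewrite -mulrA.
  by rewrite -mulr_sumr cL mulr_sumr; apply: eq_bigr => x _; rewrite mulrA.
rewrite exchange_big; apply: eq_bigr => p _.
under [RHS]eq_bigr do rewrite mulrCA.
rewrite -mulr_sumr cR mulr_sumr; apply: eq_bigr => x _.
by rewrite mulrA [_ * dpsi Psi p y]mulrC.
Qed.

Definition mx_dpsi Psi : 'M[C]_N := \matrix_(x, y) dpsi Psi x y.

Section Inverse.
Variables F G Theta : 'M[C]_(tdim N 2).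
Hypotheses (F_Theta : skew_inverse F Theta) (FG : F *m G = 1%:M) (GF : G *m F = 1%:M).
Hypothesis braidF : braided F.
Hypothesis unitD : mx_dpsi Theta \in unitmx.

Let DI := invmx (mx_dpsi Theta).

Lemma sum_dpsiI x y : \sum_z dpsi Theta x z * DI z y = (x == y)%:R.
Proof.
have /matrixP/(_ x y) := mulmxV unitD; rewrite !mxE => <-.
by apply: eq_bigr => z _; rewrite mxE.
Qed.

(* [F^-1 = D_1 Theta' D_2^-1], where [Theta'] is [Theta] flipped. *)
Lemma skew_inverse_inv : exists Phi, skew_inverse G Phi.
Proof.
have cR := conv_right F_Theta FG GF (esym braidF) F_Theta.
pose phi (b j a l : 'I_N) : C := \sum_c dpsi Theta b c * \sum_y e2 F j c y a * DI y l.
pose Phi : 'M[C]_(tdim N 2) := tens 2 (fun u v =>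
  if (u, v) is ([:: b; j], [:: a; l]) then phi b j a l else 0).
exists Phi => i j k l.
transitivity (\sum_a \sum_b \sum_c e2 G i a k b * dpsi Theta b c * \sum_y e2 F j c y a * DI y l).
  apply: eq_bigr => a _; apply: eq_bigr => b _.
  rewrite [entry Phi _ _]entry_tens // mulr_sumr; apply: eq_bigr => c _.
  by rewrite mulrA.
transitivity (\sum_y \sum_y' (dpsi Theta i y * DI y' l) *
    (\sum_c \sum_a e2 F j c y' a * e2 Theta a y c k)).
  transitivity (\sum_a \sum_c (\sum_y dpsi Theta i y * e2 Theta a y c k) * (\sum_y e2 F j c y a * DI y l)).
    apply: eq_bigr => a _; rewrite exchange_big; apply: eq_bigr => c _.
    by rewrite -cR mulr_suml.
  under [RHS]eq_bigr do under eq_bigr do rewrite exchange_big /= pair_bigA mulr_sumr.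
  rewrite pair_bigA [RHS]pair_bigA [RHS]exchange_big; apply: eq_bigr => -[a c] _ /=.
  rewrite mulr_suml -[RHS](pair_bigA _ (fun y y' => dpsi Theta i y * DI y' l * (e2 F j c y' a * e2 Theta a y c k))).
  apply: eq_bigr => y _; rewrite mulr_sumr; apply: eq_bigr => y' _ /=; ring.
rewrite -mulnb natrM -sum_dpsiI mulr_suml; apply: eq_bigr => y _.
rewrite -(sum_deltar y (fun y' => dpsi Theta i y * DI y' l * (j == k)%:R)).
apply: eq_bigr => y' _; rewrite (skew_right F_Theta) (eq_sym y') -mulnb natrM mulrA.
by rewrite [LHS]mulr_natr.
Qed.

End Inverse.

Section Kernel.
Variables (R Ri Psi F G Theta : 'M[C]_(tdim N 2)).
Hypotheses (R_Psi : skew_inverse R Psi) (RRi : R *m Ri = 1%:M) (RiR : Ri *m R = 1%:M).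
Hypothesis braidR : braided R.
Hypothesis unitDR : mx_dpsi Psi \in unitmx.
Hypotheses (F_Theta : skew_inverse F Theta) (FG : F *m G = 1%:M) (GF : G *m F = 1%:M).
Hypothesis braidF : braided F.
Hypothesis unitDF : mx_dpsi Theta \in unitmx.
Hypothesis compat1 : slides_down R F.
Hypothesis compat2 : slides_up R F.

(* [Tr_R(2) F], which equals [D^R (D^F)^-1]. *)
Definition mx_rtrace : 'M[C]_N := \matrix_(x, i) \sum_b \sum_s dpsi Psi s b * e2 F x b i s.

(** With [F] and [G] exchanged, [conv_right] gives Tr_X(2) F = D^X T with the same [T] for X = R and
    X = F. For X = F the left side is the identity, so [T] is the inverse of D^F. *)
Lemma unit_rtrace : mx_rtrace \in unitmx.
Proof.
have [Phi G_Phi] := skew_inverse_inv F_Theta FG GF braidF unitDF.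
pose T : 'M[C]_N := \matrix_(y, i) \sum_b e2 Phi b y b i.
have tr X' Psi' : skew_inverse X' Psi' ->
    slides_up X' G ->
    (\matrix_(x, i) \sum_b \sum_s dpsi Psi' s b * e2 F x b i s) = mx_dpsi Psi' *m T.
  move=> XP XGG; apply/matrixP => x i; rewrite !mxE.
  under eq_bigr do under eq_bigr do rewrite mulrC.
  under eq_bigr do rewrite (conv_right XP GF FG XGG G_Phi).
  rewrite exchange_big; apply: eq_bigr => y _.
  by rewrite -mulr_sumr !mxE.
have T1 : mx_dpsi Theta *m T = 1%:M.
  rewrite -(tr F Theta F_Theta (swap_inverse FG GF braidF)).
  by apply/matrixP => x i; rewrite !mxE trace_dpsi.
rewrite /mx_rtrace (tr R Psi R_Psi (swap_inverse FG GF compat1)) unitmx_mul unitDR.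
by have [] := mulmx1_unit T1.
Qed.

(* [F X_1 F^-1] is [Tr_1 (Xi_1 F_1^-1 R_2 F_1)] with [Xi] the contraction of [X]
   with [Psi], and [Tr_R(3) (R_2 F_1 R_2^-1)] is [Tr_R(2) F] on the first factor. *)
Lemma conj_kernel_entry x y x2 y2 :
  \sum_s \sum_t dpsi Psi s t *
    (\sum_p \sum_r (\sum_b e2 F x2 t y b * e2 G x b p r) * e2 Ri p r y2 s) =
  \sum_x1 \sum_y1 e2 Psi x y1 y x1 * (\sum_a e2 G x1 x2 a y2 * mx_rtrace a y1).
Proof.
pose W := site 3 0 G *m (site 3 1 R *m site 3 0 F).
have tr a b y1 : \sum_s \sum_t dpsi Psi s t *
    entry (site 3 1 R *m (site 3 0 F *m site 3 1 Ri)) [:: a; b; t] [:: y1; y2; s] =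
    mx_rtrace a y1 *+ (b == y2).
  transitivity (\sum_c \sum_e e2 F a c y1 e *
      (\sum_s \sum_t dpsi Psi s t * \sum_d e2 R b t c d * e2 Ri e d y2 s)).
    under eq_bigr do under eq_bigr do rewrite entry_101.
    under [RHS]eq_bigr do under eq_bigr do
      rewrite pair_bigA mulr_sumr.
    rewrite pair_bigA [RHS]pair_bigA [RHS]exchange_big; apply: eq_bigr => -[s t] _ /=.
    rewrite -[RHS](pair_bigA _ (fun c e => e2 F a c y1 e * (dpsi Psi s t * \sum_d e2 R b t c d * e2 Ri e d y2 s))).
    rewrite mulr_sumr; apply: eq_bigr => c _; rewrite exchange_big mulr_sumr; apply: eq_bigr => e _ /=.
    by rewrite mulrCA; congr (_ * _); rewrite mulr_sumr; apply: eq_bigr => d _; rewrite mulrAC mulrC mulrA.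
  rewrite mxE -sumrMnl; apply: eq_bigr => c _; rewrite -sumrMnl; apply: eq_bigr => e _.
  by rewrite (conj_trace R_Psi RRi RiR (esym braidR)) mulrnAr mulrC.
have trW x1 y1 : \sum_s \sum_t dpsi Psi s t *
    entry (W *m site 3 1 Ri) [:: x1; x2; t] [:: y1; y2; s] =
    \sum_a e2 G x1 x2 a y2 * mx_rtrace a y1.
  rewrite /W -!mulmxA.
  under eq_bigr do under eq_bigr do rewrite entry_site0_mul // pair_bigA mulr_sumr.
  rewrite pair_bigA exchange_big /=.
  transitivity (\sum_a \sum_b e2 G x1 x2 a b * (mx_rtrace a y1 *+ (b == y2))).
    rewrite [RHS]pair_bigA; apply: eq_bigr => -[a b] _ /=.
    by rewrite -tr pair_bigA mulr_sumr; apply: eq_bigr => p _; rewrite mulrCA.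
  apply: eq_bigr => a _; rewrite -(sum_deltar y2 (fun b => e2 G x1 x2 a b * mx_rtrace a y1)).
  by apply: eq_bigr => b _; rewrite mulrnAr.
under [RHS]eq_bigr do under eq_bigr do rewrite -trW pair_bigA mulr_sumr.
rewrite pair_bigA [RHS]pair_bigA [RHS]exchange_big; apply: eq_bigr => -[s t] _ /=.
under eq_bigr do under eq_bigr do rewrite (conj_dual R_Psi FG GF compat2) pair_bigA mulr_suml.
rewrite pair_bigA exchange_big mulr_sumr; apply: eq_bigr => -[x1 y1] _ /=.
rewrite entry_mul_site1 // pair_bigA !mulr_sumr; apply: eq_bigr => p _ /=.
by rewrite -!mulrA mulrCA.
Qed.

(** By [conj_kernel_entry] the map is a contraction with [Psi], followed by the matrix [mx_rtrace],
    followed by a contraction with [G]. Each is injective, the last since [G] is skew-invertible. *)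
Lemma conj_kernel (V : lmodType C) (Z : 'I_N -> 'I_N -> V) :
  (forall x2 y2, \sum_x \sum_y (\sum_s \sum_t dpsi Psi s t *
    (\sum_p \sum_r (\sum_b e2 F x2 t y b * e2 G x b p r) * e2 Ri p r y2 s)) *: Z y x = 0) ->
  forall y x, Z y x = 0.
Proof.
move=> Z0; have [Phi G_Phi] := skew_inverse_inv F_Theta FG GF braidF unitDF.
pose Xi y1 x1 := \sum_y \sum_x e2 Psi x y1 y x1 *: Z y x.
suff Xi0 y1 x1 : Xi y1 x1 = 0 by apply: (skew_inverse_kernel R_Psi) => i k; exact: Xi0.
suff CXi0 a x1' : \sum_y mx_rtrace a y *: Xi y x1' = 0.
  apply: (@left_inverse_kernel _ _ _ (fun a y => mx_rtrace a y) (fun y a => invmx mx_rtrace y a) V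
    (fun y => Xi y x1)) => [i i'|j]; last exact: CXi0.
  by have /matrixP/(_ i i') := mulVmx unit_rtrace; rewrite !mxE.
move: x1' a; apply: (skew_kernel G_Phi (Z := fun x1 a => \sum_y mx_rtrace a y *: Xi y x1)) => x2 y2.
apply: (etrans _ (Z0 x2 y2)); under [RHS]eq_bigr do under eq_bigr do rewrite conj_kernel_entry.
transitivity (\sum_x1 \sum_y1 (\sum_a e2 G x1 x2 a y2 * mx_rtrace a y1) *: Xi y1 x1).
  apply: eq_bigr => z1 _; under eq_bigr do rewrite scaler_sumr.
  rewrite exchange_big; apply: eq_bigr => w1 _; rewrite scaler_suml.
  by apply: eq_bigr => a _; rewrite scalerA.
have XiE c z1 w1 : c *: Xi w1 z1 =
    \sum_(p : 'I_N * 'I_N) (e2 Psi p.1 w1 p.2 z1 * c) *: Z p.2 p.1.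
  rewrite /Xi exchange_big pair_bigA scaler_sumr; apply: eq_bigr => p _.
  by rewrite scalerA mulrC.
apply: (etrans (eq_bigr _ (fun x1 _ => eq_bigr _ (fun y1 _ => XiE _ _ _)))).
rewrite pair_bigA [RHS]pair_bigA exchange_big; apply: eq_bigr => -[x y] _ /=.
by rewrite pair_bigA scaler_suml.
Qed.

End Kernel.

End CompatiblePair.

Section RTraceProperties.
Variables (C : fieldType) (A : algType C) (N : nat).
Variables (R Ri Psi F G : 'M[C]_(tdim N 2)).
Hypotheses (R_Psi : skew_inverse R Psi) (RRi : R *m Ri = 1%:M) (RiR : Ri *m R = 1%:M).
Hypothesis braidR : braided R.
Hypotheses (FG : F *m G = 1%:M) (GF : G *m F = 1%:M).
Hypothesis compat2 : slides_up R F.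

Let D := mx_dpsi Psi.

(** This is [conj_trace] on the last two factors, with all others as spectators. *)
Lemma ptr_conj k (Y : 'M[A]_(tdim N k.+1)) :
  ptr D k.+1 (scal_mx A (site k.+2 k F) *m emb k.+2 0 Y *m scal_mx A (site k.+2 k G)) =
  emb k.+1 0 (ptr D k Y).
Proof.
apply: eq_entry => u v su sv.
have [u0 [i [-> s0]]] : exists u0 i, u = u0 ++ [:: i] /\ size u0 = k.
  by case/lastP: u su => // u i; rewrite size_rcons => -[<-]; exists u, i; rewrite cats1.
have [v0 [i' [-> t0]]] : exists v0 i, v = v0 ++ [:: i] /\ size v0 = k.
  by case/lastP: v sv => // v i'; rewrite size_rcons => -[<-]; exists v, i'; rewrite cats1.
rewrite -[u0 ++ _]cat0s -[v0 ++ _]cat0s entry_emb ?entry_ptr ?size_cat //=; [|lia..].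
have -> : (k.+2 - k.+1 = 1)%N by lia.
have -> : (k.+1 - k = 1)%N by lia.
rewrite !wsum1 -sumrMnl.
transitivity (\sum_s \sum_t \sum_y \sum_x (\sum_l dpsi Psi s t * (e2 F i t y l * e2 G x l i' s)) *:
    entry Y (u0 ++ [:: y]) (v0 ++ [:: x])).
  apply: eq_bigr => s _; rewrite wsum1; apply: eq_bigr => t _.
  rewrite /dweight /= big_seq1 mxE !siteE !scal_emb.
  rewrite -!catA /= -[[:: i; t]]cats0 -[[:: i'; s]]cats0 -mulmxA entry_embl ?size_cat //=; [|lia..].
  rewrite wsum2 scaler_sumr; apply: eq_bigr => y _.
  have E b : entry (emb k.+2 0 Y *m emb k.+2 k (scal_mx A G)) (u0 ++ [:: y; b] ++ [::])
      (v0 ++ [:: i'; s]) = \sum_x e2 G x b i' s *: entry Y (u0 ++ [:: y]) (v0 ++ [:: x]).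
    rewrite -[[:: i'; s]]cats0 entry_embr ?size_cat //=; [|lia..].
    rewrite wsum2; apply: eq_bigr => x _.
    rewrite -(sum_deltal b (fun l => e2 G x l i' s *: _)); apply: eq_bigr => l _.
    have cE w (c d : 'I_N) : w ++ [:: c; d] = [::] ++ (w ++ [:: c]) ++ [:: d].
      by rewrite -catA.
    rewrite /= (cE u0) (cE v0).
    rewrite entry_emb ?size_cat //=; [|lia..].
    by rewrite eqseq_cons andbT entry_scal mulr_algr scalerMnr.
  rewrite (eq_bigr _ (fun b _ => congr1 _ (E b))).
  under eq_bigr do rewrite entry_scal mulr_algl scaler_sumr.
  rewrite exchange_big scaler_sumr; apply: eq_bigr => x _ /=.
  rewrite [RHS]scaler_suml [LHS]scaler_sumr; apply: eq_bigr => l _.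
  by rewrite !scalerA mulrA.
transitivity (\sum_y \sum_x (dpsi Psi x y *+ (i == i')) *: entry Y (u0 ++ [:: y]) (v0 ++ [:: x])).
  rewrite pair_bigA; under eq_bigr do rewrite pair_bigA.
  rewrite exchange_big [RHS]pair_bigA; apply: eq_bigr => -[y x] _ /=.
  rewrite -scaler_suml; congr (_ *: _).
  rewrite -(conj_trace R_Psi FG GF compat2) [RHS]pair_bigA; apply: eq_bigr => p _ /=.
  by rewrite mulr_sumr.
rewrite exchange_big; apply: eq_bigr => x _; rewrite wsum1 -sumrMnl.
apply: eq_bigr => y _; rewrite /dweight /= big_seq1 mxE eqseq_cons andbT.
by rewrite scalerMnl.
Qed.

Definition dweight_mx r : 'M[C]_(tdim N r) := tens r (dweight D).

Lemma dweight_mx2_comm : dweight_mx 2 *m R = R *m dweight_mx 2.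
Proof.
suff c : dweight_mx 2 *m Ri = Ri *m dweight_mx 2.
  by rewrite -[LHS]mul1mx -RRi -mulmxA (mulmxA Ri) -c -mulmxA RiR mulmx1.
apply: eq_e2 => z b y a; rewrite !e2_mul.
have dE p t p' t' : e2 (dweight_mx 2) p t p' t' = dpsi Psi p p' * dpsi Psi t t'.
  by rewrite /e2 entry_tens // /dweight /= big_cons big_seq1 !mxE.
under eq_bigr do under eq_bigr do rewrite dE.
under [RHS]eq_bigr do under eq_bigr do rewrite dE.
exact: dpsi_comm R_Psi RRi RiR braidR _ _ _ _.
Qed.

Lemma dweight_mx_site r i : (i + 2 <= r)%N -> dweight_mx r *m site r i R = site r i R *m dweight_mx r.
Proof.
move=> ir; rewrite siteE; apply: eq_entry => u v su sv.
have [u1 [u2 [u3 [-> s1 s2 s3]]]] := word_split su ir.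
have [v1 [v2 [v3 [-> t1 t2 t3]]]] := word_split sv ir.
rewrite entry_embl ?entry_embr ?size_cat //; [|lia..].
have eW w w' : size w = 2%N -> size w' = 2%N -> entry (dweight_mx r) (u1 ++ w ++ u3) (v1 ++ w' ++ v3) =
    dweight D u1 v1 * entry (dweight_mx 2) w w' * dweight D u3 v3.
  move=> z z'; rewrite !entry_tens ?size_cat ?dweight_cat ?z ?z' ?s1 ?t1 ?s3 ?t3 ?mulrA //; lia.
transitivity (dweight D u1 v1 * entry (dweight_mx 2 *m R) u2 v2 * dweight D u3 v3).
  rewrite entry_mul // wsum_distrr wsum_distrl; apply: eq_wsum => w zw.
  by rewrite eW // !mulrA mulrAC.
rewrite dweight_mx2_comm entry_mul // wsum_distrr wsum_distrl; apply: eq_wsum => w zw.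
by rewrite eW // -!mulrA mulrCA.
Qed.

(** The moved factor is a scalar matrix on traced positions, so the noncommuting entries of [Y] keep
    their order. The weights go along because a tensor power of D^R commutes with every R_i. *)
Lemma ptr_cyc K k i (Y : 'M[A]_(tdim N K)) : (k <= i)%N -> (i + 2 <= K)%N ->
  ptr D k (Y *m scal_mx A (site K i R)) = ptr D k (scal_mx A (site K i R) *m Y).
Proof.
move=> ki iK.
have -> : site K i R = emb K k (site (K - k) (i - k) R).
  by rewrite !siteE emb_emb ?subnKC //; lia.
have := @dweight_mx_site (K - k) (i - k).
move: (site (K - k) (i - k) R) => Z cZ; have {}cZ := cZ ltac:(lia).
apply: eq_entry => u v su sv; rewrite !entry_ptr // scal_emb.
have kK : (k + (K - k) <= K)%N by lia.
transitivity (wsum (K - k) (fun t => wsum (K - k) (fun w =>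
    entry (Z *m dweight_mx (K - k)) w t *: entry Y (u ++ t) (v ++ w)))).
  rewrite exchange_wsum; apply: eq_wsum => t zt.
  transitivity (wsum (K - k) (fun s => wsum (K - k) (fun w =>
      (entry Z w s * dweight D s t) *: entry Y (u ++ t) (v ++ w)))).
    apply: eq_wsum => s zs.
    have zut : size (u ++ t) = K by rewrite size_cat; lia.
    have := entry_embr (scal_mx A Z) Y (u3 := [::]) sv zs (esym (subnn _)) kK zut.
    rewrite cats0 => ->; rewrite scaler_wsum; apply: eq_wsum => w zw.
    by rewrite cats0 entry_scal mulr_algr scalerA mulrC.
  rewrite exchange_wsum; apply: eq_wsum => w zw; rewrite entry_mul // /wsum scaler_suml.
  by apply: eq_bigr => s _; rewrite entry_tens ?size_tuple.
rewrite -cZ exchange_wsum; apply: eq_wsum => s zs.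
transitivity (wsum (K - k) (fun t => wsum (K - k) (fun w =>
    (dweight D s t * entry Z t w) *: entry Y (u ++ w) (v ++ s)))).
  rewrite exchange_wsum; apply: eq_wsum => w zw; rewrite entry_mul // /wsum scaler_suml.
  by apply: eq_bigr => t _; rewrite entry_tens ?size_tuple.
apply: eq_wsum => t zt; have zvs : size (v ++ s) = K by rewrite size_cat; lia.
have := entry_embl (scal_mx A Z) Y (u3 := [::]) su zt (esym (subnn _)) kK zvs.
rewrite cats0 => ->; rewrite scaler_wsum; apply: eq_wsum => w zw.
by rewrite cats0 entry_scal mulr_algl scalerA.
Qed.

Lemma ptr_site : ptr D 1 (scal_mx A (site 2 0 R)) = 1%:M.
Proof.
apply: eq_entry => u v; case: u => [|a [|]] // ; case: v => [|c [|]] // _ _.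
rewrite entry_ptr // entry_scalar // eqseq_cons andbT.
have := congr1 (fun x : C => x%:A : A) (trace_dpsi R_Psi a c).
rewrite scaler_nat => <-.
rewrite -[(2 - 1)%N]/1%N wsum1 [in RHS]exchange_big [RHS]scaler_suml; apply: eq_bigr => s _.
rewrite wsum1 [RHS]scaler_suml; apply: eq_bigr => t _ /=.
rewrite entry_scal scalerA /dweight /= big_seq1 mxE siteE emb_id.
done.
Qed.

End RTraceProperties.

(** * Shifted copies of the quantum matrix *)

Section SiteAlgebra.
Variables (C : fieldType) (N : nat).
Implicit Types X Y Z F G : 'M[C]_(tdim N 2).

Lemma site_emb K k i X : (k <= K)%N -> (i + 2 <= k)%N -> emb K 0 (site k i X) = site K i X.
Proof. by move=> kK ik; rewrite !siteE emb_emb. Qed.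

Lemma site_far K i j X Y : (i + 2 <= j)%N -> (j + 2 <= K)%N ->
  site K i X *m site K j Y = site K j Y *m site K i X.
Proof. by move=> ij jK; rewrite !siteE; apply: emb_comm => // *; rewrite mulrC. Qed.

Lemma site3 K i j X : (j < 2)%N -> (i + 3 <= K)%N -> emb K i (site 3 j X) = site K (i + j) X.
Proof. by move=> j2 iK; rewrite !siteE emb_emb //; lia. Qed.

Lemma site_swap K i X F : (i + 3 <= K)%N ->
  slides_up X F ->
  site K i.+1 X *m site K i F *m site K i.+1 F = site K i F *m site K i.+1 F *m site K i X.
Proof.
move=> iK /(congr1 (@emb _ _ K i 3)); rewrite -!emb_mul //.
by rewrite !site3 // addn0 addn1.
Qed.

Lemma site_swap' K i X F : (i + 3 <= K)%N ->
  slides_down X F ->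
  site K i X *m site K i.+1 F *m site K i F = site K i.+1 F *m site K i F *m site K i.+1 X.
Proof.
move=> iK /(congr1 (@emb _ _ K i 3)); rewrite -!emb_mul //.
by rewrite !site3 // addn0 addn1.
Qed.

End SiteAlgebra.

Section Shift.
Variables (C : fieldType) (A : algType C) (N : nat).
Variables F G : 'M[C]_(tdim N 2).
Hypotheses (FG : F *m G = 1%:M) (GF : G *m F = 1%:M).
Local Notation scal := (scal_mx A).

Fixpoint fchain p : 'M[C]_(tdim N p.+1) :=
  if p is p'.+1 then emb p'.+2 0 (fchain p') *m site p'.+2 p' F else 1%:M.

Fixpoint gchain p : 'M[C]_(tdim N p.+1) :=
  if p is p'.+1 then site p'.+2 p' G *m emb p'.+2 0 (gchain p') else 1%:M.

Lemma fgchain p : fchain p *m gchain p = 1%:M.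
Proof.
elim: p => [|p IH] /=; first by rewrite mulmx1.
rewrite -mulmxA (mulmxA (site _ _ F)) siteM ?FG ?site1 ?mul1mx; [|lia..].
by rewrite emb_mul ?IH ?emb_scalar //; lia.
Qed.

Lemma gfchain p : gchain p *m fchain p = 1%:M.
Proof.
elim: p => [|p IH] /=; first by rewrite mulmx1.
rewrite -mulmxA (mulmxA (emb _ _ _)) emb_mul ?IH ?emb_scalar ?mul1mx; [|lia..].
by rewrite siteM ?GF ?site1 //; lia.
Qed.

(* [Y_{2..p+1}], the copy of [Y] transported by [F] to the factors 2, ..., p + 1. *)
Definition shift p (Y : 'M[A]_(tdim N p)) : 'M[A]_(tdim N p.+1) :=
  scal (fchain p) *m emb p.+1 0 Y *m scal (gchain p).

Lemma shiftM p (Y Z : 'M[A]_(tdim N p)) : shift (Y *m Z) = shift Y *m shift Z.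
Proof.
rewrite /shift -emb_mul; last by lia.
rewrite -!mulmxA; congr (_ *m (_ *m _)).
by rewrite [RHS]mulmxA [in RHS]mulmxA -scal_mul gfchain scal1 mul1mx.
Qed.

Lemma shift_scalar p a : shift (a%:M : 'M[A]_(tdim N p)) = a%:M.
Proof.
rewrite /shift emb_scalar; last by lia.
by rewrite -mulmxA scal_central mulmxA -scal_mul fgchain scal1 mul1mx.
Qed.

(** The additional factors of the chain act beyond [Z], commute with it and cancel against their
    inverses. *)
Lemma shift_emb p p' (Z : 'M[A]_(tdim N p)) : (p <= p')%N -> shift (emb p' 0 Z) = emb p'.+1 0 (shift Z).
Proof.
elim: p' => [|p' IH] pp'.
  have p0 : p = 0%N by lia.
  by subst p; rewrite !emb_id.
move: pp'; rewrite leq_eqVlt => /predU1P [e|pp'].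
  by subst p; rewrite !emb_id.
have -> : emb p'.+1 0 Z = emb p'.+1 0 (emb p' 0 Z) by rewrite emb_emb ?add0n //; lia.
have -> : emb p'.+2 0 (shift Z) = emb p'.+2 0 (emb p'.+1 0 (shift Z)) by rewrite emb_emb ?add0n //; lia.
rewrite -IH; last by lia.
move: (emb p' 0 Z) => {Z IH pp'}Z.
rewrite /shift /= -!emb_mul; [|lia..].
rewrite !scal_mul !scal_emb -!mulmxA; congr (_ *m _); rewrite !mulmxA; congr (_ *m _).
rewrite emb_emb ?add0n; [|lia..].
rewrite siteE scal_emb -emb_scal_comm; [|lia..].
rewrite -mulmxA -!scal_emb -!siteE -scal_mul siteM ?FG ?site1 ?scal1 ?mulmx1 //; lia.
Qed.

(** Only two factors of the chain F_1 ... F_p meet the operator; they carry it one position up by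
    the compatibility relation. *)
Lemma shift_site p l X : (l + 2 <= p)%N ->
  slides_up X F ->
  shift (scal (site p l X)) = scal (site p.+1 l.+1 X).
Proof.
move=> lp XFF; rewrite -(@site_emb _ _ p l.+2); [|lia..].
rewrite scal_emb shift_emb; last by lia.
rewrite -(@site_emb _ _ p.+1 l.+3); [|lia..].
rewrite scal_emb; congr (emb _ _ _).
rewrite /shift -scal_emb site_emb; [|lia..].
rewrite -!scal_mul; congr scal.
suff -> : fchain l.+2 *m site l.+3 l X = site l.+3 l.+1 X *m fchain l.+2.
  by rewrite -mulmxA fgchain mulmx1.
rewrite /= -emb_mul ?emb_emb ?add0n ?site_emb; [|lia..].
rewrite -!mulmxA (mulmxA (site _ l F)) -site_swap //; last by lia.
rewrite !mulmxA; congr (_ *m _ *m _).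
by rewrite !siteE; apply: emb_comm => [||*]; [lia..|rewrite mulrC].
Qed.

Variable D : 'M[C]_N.
Hypothesis ptr_conj : forall k (Y : 'M[A]_(tdim N k.+1)),
  ptr D k.+1 (scal (site k.+2 k F) *m emb k.+2 0 Y *m scal (site k.+2 k G)) =
  emb k.+1 0 (ptr D k Y).

(** One factor at a time: tracing out the last factor removes the last F and its inverse from the
    chain, by [ptr_conj]. *)
Lemma ptr_shift p k (Y : 'M[A]_(tdim N p)) : (k <= p)%N -> ptr D k.+1 (shift Y) = shift (ptr D k Y).
Proof.
elim: p Y => [|p IH] Y kp; first by move: kp; rewrite leqn0 => /eqP ->; rewrite !ptr_id.
move: kp; rewrite leq_eqVlt => /predU1P [e|kp]; first by subst k; rewrite !ptr_id.
rewrite -(ptr_comp D (k := p.+1)); [|lia..].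
rewrite -(ptr_comp D (k := p) (j := k)); [|lia..].
rewrite -IH //; congr (ptr _ _ _).
rewrite [in LHS]/shift /= !scal_mul !scal_emb -!mulmxA ptr_mull; last by lia.
by rewrite !mulmxA ptr_mulr ?ptr_conj ?mulmxA //; lia.
Qed.

End Shift.

(** * Products of copies, the map phi and its injectivity *)

Section QuantumPowers.
Variables (C : fieldType) (A : algType C) (N : nat).
Variables (R Ri Psi F G Theta : 'M[C]_(tdim N 2)).
Hypotheses (R_Psi : skew_inverse R Psi) (RRi : R *m Ri = 1%:M) (RiR : Ri *m R = 1%:M).
Hypothesis braidR : braided R.
Hypotheses (F_Theta : skew_inverse F Theta) (FG : F *m G = 1%:M) (GF : G *m F = 1%:M).
Hypothesis braidF : braided F.
Hypothesis compat1 : slides_down R F.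
Hypothesis compat2 : slides_up R F.
Variables (q : C).
Hypothesis heckeR : R - Ri = (q - q^-1)%:M.
Variable M : 'M[A]_N.
Hypothesis RMM : scal_mx A (site 2 0 R) *m mcopy F M 2 0 *m mcopy F M 2 1 =
  mcopy F M 2 0 *m mcopy F M 2 1 *m scal_mx A (site 2 0 R).

Local Notation scal := (scal_mx A).
Local Notation mcopy := (mcopy F M).
Local Notation shift := (@shift C A N F G _).
Let D := mx_dpsi Psi.

Lemma invmx_site k j : (j + 2 <= k)%N -> invmx (site k j F) = site k j G.
Proof.
move=> jk; have E : site k j F *m site k j G = 1%:M by rewrite siteM // FG site1.
by rewrite -[RHS](mulKmx (mulmx1_unit E).1) E mulmx1.
Qed.

Lemma mcopyS k j : (j + 2 <= k)%N ->
  mcopy k j.+1 = scal (site k j F) *m mcopy k j *m scal (site k j G).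
Proof. by move=> jk; rewrite /= invmx_site. Qed.

Lemma mcopy0_emb k K : (0 < k)%N -> (k <= K)%N -> emb K 0 (mcopy k 0) = mcopy K 0.
Proof.
move=> k0 kK; apply: eq_entry => u v su sv.
have kK' : (0 + k <= K)%N by [].
have [u1 [u2 [u3 [-> s1 s2 s3]]]] := word_split su kK'.
have [v1 [v2 [v3 [-> t1 t2 t3]]]] := word_split sv kK'.
rewrite entry_emb // (size0nil s1) (size0nil t1) eqxx /= !entry_tens ?size_cat //; [|lia..].
case: u2 s2 => [|a u2] s2; first by move: s2 k0 => /= <-.
case: v2 t2 => [|b v2] t2; first by move: t2 k0 => /= <-.
rewrite /= -mulrnA mulnb eqseq_cat //.
exact: (succn_inj (etrans s2 (esym t2))).
Qed.

Lemma mcopy_emb k K l : (l < k)%N -> (k <= K)%N -> emb K 0 (mcopy k l) = mcopy K l.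
Proof.
move=> lk kK; elim: l lk => [|l IH] lk; first exact: mcopy0_emb.
rewrite !mcopyS; [|lia..].
rewrite -!emb_mul ?IH; [|lia..].
by rewrite -!scal_emb !site_emb //; lia.
Qed.

Lemma braid_inv : slides_up G F.
Proof.
have c i : (i < 2)%N -> site 3 i G *m site 3 i F = 1%:M by move=> i2; rewrite siteM ?GF ?site1 //; lia.
have c' i : (i < 2)%N -> site 3 i F *m site 3 i G = 1%:M by move=> i2; rewrite siteM ?FG ?site1 //; lia.
rewrite -[LHS]mulmx1 -(c' 0%N) // !mulmxA -(mulmxA (site 3 1 G) (site 3 0 F)).
by rewrite -(mulmxA (site 3 1 G)) braidF !mulmxA c // mul1mx.
Qed.

Lemma shift1E (X : 'M[A]_(tdim N 1)) :
  shift X = scal (site 2 0 F) *m emb 2 0 X *m scal (site 2 0 G).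
Proof. by rewrite /shift /= !emb_scalar // mul1mx mulmx1. Qed.

Lemma mcopy_shift p l : (l < p)%N -> shift (mcopy p l) = mcopy p.+1 l.+1.
Proof.
elim: l => [|l IH] lp.
  rewrite mcopyS; last by lia.
  rewrite -(@mcopy_emb 1 p) // shift_emb // -(@mcopy_emb 1 p.+1) //.
  have -> : site p.+1 0 F = emb p.+1 0 (site 2 0 F) by rewrite site_emb.
  have -> : site p.+1 0 G = emb p.+1 0 (site 2 0 G) by rewrite site_emb.
  have -> : emb p.+1 0 (mcopy 1 0) = emb p.+1 0 (emb 2 0 (mcopy 1 0)) by rewrite emb_emb.
  rewrite !scal_emb !emb_mul //; congr (emb _ _ _).
  by rewrite shift1E !siteE !scal_emb.
rewrite [in RHS](mcopyS (j := l.+1)) ?[in LHS](mcopyS (k := p) (j := l)); [|lia..].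
rewrite !shiftM // IH; last by lia.
have lp2 : (l + 2 <= p)%N by lia.
by rewrite (shift_site A FG lp2 (esym braidF)) (shift_site A FG lp2 braid_inv).
Qed.

Definition mcopies p : 'M[A]_(tdim N p) := \prod_(l < p) mcopy p l.

Lemma mcopiesS p : mcopies p.+1 = mcopy p.+1 0 *m shift (mcopies p).
Proof.
rewrite /mcopies big_ord_recl; congr (_ *m _).
rewrite (big_morph shift (@shiftM _ _ _ _ _ GF p) (@shift_scalar _ _ _ _ _ FG p 1)).
by apply: eq_bigr => l _; rewrite mcopy_shift.
Qed.

(** In the copy with [l = 2] the operator R_1 passes F_2 F_1 and becomes R_2, which commutes with
    the first copy, and then returns to R_1. Further copies only add F's that are far from R_1. *)
Lemma site_mcopy p l : (2 <= l)%N -> (l < p)%N ->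
  scal (site p 0 R) *m mcopy p l = mcopy p l *m scal (site p 0 R).
Proof.
elim: l => [|l IHl] // l2 lp; rewrite mcopyS; last by lia.
move: l2; rewrite leq_eqVlt => /predU1P [[l1]|l2]; last first.
  rewrite !mulmxA -scal_mul site_far; [|lia..].
  rewrite scal_mul -(mulmxA (scal _)) IHl; [|lia..].
  by rewrite -!mulmxA -!scal_mul site_far //; lia.
rewrite -l1 mcopyS; last by lia.
have h2 := congr1 (fun Z => scal Z) (site_swap' (K := p) (i := 0) ltac:(lia) compat1).
have h1 := congr1 (fun Z => scal Z)
  (site_swap (K := p) (i := 0) ltac:(lia) (swap_inverse FG GF compat1)).
rewrite !scal_mul in h1 h2.
rewrite !mulmxA h2 -(mulmxA _ (scal (site p 1 R))).
have -> : scal (site p 1 R) *m mcopy p 0 = mcopy p 0 *m scal (site p 1 R).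
  by rewrite -(@mcopy_emb 1 p) // ?siteE ?scal_emb ?emb_scal_comm //; lia.
by rewrite -!mulmxA in h1 *; rewrite h1.
Qed.

Lemma mcopies_emb p : mcopies p.+1 = emb p.+1 0 (mcopies p) *m mcopy p.+1 p.
Proof.
rewrite /mcopies big_ord_recr; congr (_ *m _) => /=.
rewrite (big_morph (@emb _ _ p.+1 0 p) (id1 := 1) (op1 := *%R)); first last.
- by rewrite -[1]/1%:M emb_scalar.
- by move=> X Y; rewrite -[_ * _]/(_ *m _) -emb_mul.
by apply: eq_bigr => l _; rewrite mcopy_emb.
Qed.

(** For [i = 0] the defining relation of the algebra treats the first two copies and [site_mcopy]
    the others; larger [i] follow by shifting. *)
Lemma site_mcopies p i : (i + 2 <= p)%N -> scal (site p i R) *m mcopies p = mcopies p *m scal (site p i R).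
Proof.
elim: i p => [|i IH] p ip; last first.
  case: p ip => [|p] ip //; have {}ip : (i + 2 <= p)%N by lia.
  have S := shift_site A FG ip compat2; rewrite mcopiesS mulmxA.
  have -> : scal (site p.+1 i.+1 R) *m mcopy p.+1 0 = mcopy p.+1 0 *m scal (site p.+1 i.+1 R).
    by rewrite -(@mcopy_emb 1 p.+1) // siteE scal_emb emb_scal_comm //; lia.
  by rewrite -S -!(mulmxA (mcopy _ _)) -!(shiftM GF) IH.
elim: p ip => [|p IHp] ip //.
move: ip; rewrite leq_eqVlt => /predU1P [[p1]|p2].
  by subst p; rewrite /mcopies !big_ord_recl big_ord0 mulr1 -[_ * _]/(_ *m _) mulmxA.
have e0 : site p.+1 0 R = emb p.+1 0 (site p 0 R) by rewrite site_emb //; lia.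
rewrite mcopies_emb mulmxA {1}e0 scal_emb emb_mul // IHp; last by lia.
rewrite -emb_mul // -!(mulmxA (emb _ _ _)) -scal_emb -e0 site_mcopy //; lia.
Qed.

Fixpoint shiftn r j (Z : 'M[A]_(tdim N r)) : 'M[A]_(tdim N (j + r)) :=
  if j is j'.+1 then shift (shiftn j' Z) else Z.

Lemma shiftnM r j (Y Z : 'M[A]_(tdim N r)) : shiftn j (Y *m Z) = shiftn j Y *m shiftn j Z.
Proof. by elim: j => //= j ->; rewrite (shiftM GF). Qed.

Lemma shiftn_scalar r j a : shiftn j (a%:M : 'M[A]_(tdim N r)) = a%:M.
Proof. by elim: j => //= j ->; rewrite (shift_scalar FG). Qed.

Lemma shiftn_site r j i : (i + 2 <= r)%N ->
  shiftn j (scal (site r i R)) = scal (site (j + r) (j + i) R).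
Proof.
move=> ir; elim: j => //= j ->.
by rewrite (shift_site A FG _ compat2) //; lia.
Qed.

Lemma ptr_conjD k (Y : 'M[A]_(tdim N k.+1)) :
  ptr D k.+1 (scal (site k.+2 k F) *m emb k.+2 0 Y *m scal (site k.+2 k G)) =
  emb k.+1 0 (ptr D k Y).
Proof. exact: (ptr_conj R_Psi FG GF compat2 Y). Qed.

(** Partial traces commute with [shift], and [shift] fixes scalar matrices, so a complete trace
    stays scalar wherever it is transported. *)
Lemma ptr_shiftn r j (Z : 'M[A]_(tdim N r)) :
  ptr D j (shiftn j Z) = (entry (ptr D 0 Z) [::] [::])%:M.
Proof.
elim: j => [|j IH] /=.
  by apply: eq_entry => -[|//] [|//] _ _; rewrite entry_scalar.
by rewrite (ptr_shift ptr_conjD) ?leq_addr // IH (shift_scalar FG).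
Qed.

Lemma mcopies_split r j : mcopies (j + r) = emb (j + r) 0 (mcopies j) *m shiftn j (mcopies r).
Proof.
elim: j => [|j IH] /=; first by rewrite [mcopies 0]big_ord0 -[1]/1%:M emb_scalar // mul1mx.
rewrite !mcopiesS -emb_mul ?mcopy_emb //; [|lia..].
by rewrite -mulmxA -(shift_emb FG) ?leq_addr // -(shiftM GF) -IH.
Qed.

(* For [Z = R] this is the map [phi] taking [M^j] to [Tr_R(2..) (M_2 ... R_j ... R_1)]. *)
Definition shift_tr Z (X : 'M[A]_(tdim N 1)) : 'M[A]_(tdim N 1) :=
  ptr D 1 (shift X *m scal (site 2 0 Z)).

Local Notation phi := (shift_tr R).
Local Notation phim := (shift_tr Ri).

Definition rprod j : 'M[C]_(tdim N j.+1) := \prod_(l <- rev (iota 0 j)) site j.+1 l R.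

Definition qpow j : 'M[A]_(tdim N 1) :=
  if j is j'.+1 then ptr D 1 (mcopies j'.+1 *m scal (rprod j')) else 1%:M.

(** The source of the product of a power and a Schur function: the last [r] copies, with [U] between
    them and [B], trace to a scalar matrix, which may be moved to the right of the scalar operator
    [B]. *)
Lemma ptr_mcopies_split r j (U : 'M[A]_(tdim N r)) (B : 'M[C]_(tdim N j.+1)) :
  ptr D 1 (shift (mcopies (j + r)) *m shiftn j.+1 U *m emb (j.+1 + r) 0 (scal B)) =
  ptr D 1 (shift (mcopies j) *m scal B) *m (entry (ptr D 0 (mcopies r *m U)) [::] [::])%:M.
Proof.
have -> : shift (mcopies (j + r)) = emb (j.+1 + r) 0 (shift (mcopies j)) *m shiftn j.+1 (mcopies r).
  by rewrite mcopies_split (shiftM GF) (shift_emb FG) ?leq_addr.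
rewrite -(mulmxA (emb _ _ (shift (mcopies j)))) -(shiftnM j.+1 (mcopies r) U).
rewrite -(ptr_comp D (k := j.+1)) ?ltnS ?leq_addr //.
rewrite ptr_mulr ?ptr_mull ?ltnS ?leq_addr // (@ptr_shiftn r j.+1).
rewrite -mulmxA scal_central mulmxA.
have -> a : a%:M = emb j.+1 0 (a%:M : 'M[A]_(tdim N 1)) by rewrite emb_scalar.
by rewrite ptr_mulr.
Qed.

Lemma scal_prod k (I : Type) (s : seq I) (f : I -> 'M[C]_(tdim N k)) :
  scal (\prod_(i <- s) f i) = \prod_(i <- s) scal (f i).
Proof. by apply: big_morph; [exact: scal_mul|exact: scal1]. Qed.

Lemma scal_rprodS j : scal (rprod j.+1) = shift (scal (rprod j)) *m scal (site j.+2 0 R).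
Proof.
rewrite /rprod -[iota 0 j.+1]/(0 :: iota 1 j) rev_cons -cats1 big_cat big_seq1 /= scal_mul.
congr (_ *m _); rewrite !scal_prod (big_morph shift (@shiftM _ _ _ _ _ GF _) (@shift_scalar _ _ _ _ _ FG _ 1)).
rewrite -[1%N]addn0 iotaDl -map_rev big_map big_seq [RHS]big_seq; apply: eq_bigr => l.
rewrite mem_rev mem_iota => lj; rewrite (shift_site A FG _ compat2) //; lia.
Qed.

(** R_(j+1) ... R_1 is the shift of R_j ... R_1 times R_1. The shifted part is traced inside
    [shift], and only R_1 is left. The case [j = 0] is Tr_R(2) R = Id. *)
Lemma phi_qpow j : ptr D 1 (shift (mcopies j) *m scal (rprod j)) = phi (qpow j).
Proof.
case: j => [|j].
  rewrite /shift_tr [mcopies 0]big_ord0 /rprod big_nil (shift_scalar FG) mul1mx ptr_id.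
  by rewrite (shift_scalar FG) mul1mx (ptr_site A R_Psi) -[1%R]/1%:M scal1.
rewrite scal_rprodS mulmxA -(shiftM GF) -(@site_emb _ _ j.+2 2) // scal_emb.
rewrite -(ptr_comp D (k := 2)) // ptr_mulr // (ptr_shift ptr_conjD) //.
Qed.

Lemma ptrD K k (X Y : 'M[A]_(tdim N K)) : ptr D k (X + Y) = ptr D k X + ptr D k Y.
Proof.
apply: eq_entry => u v su sv; rewrite entryD !entry_ptr // /wsum -big_split.
apply: eq_bigr => s _; rewrite -big_split; apply: eq_bigr => t _.
by rewrite entryD scalerDr.
Qed.

Lemma shiftD p (X Y : 'M[A]_(tdim N p)) : shift (X + Y) = shift X + shift Y.
Proof.
rewrite /shift -mulmxDl -mulmxDr; congr (_ *m _ *m _).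
by apply: eq_entry => u v su sv; rewrite entryD !entry_tens // entryD mulrnDl.
Qed.

Lemma shift_trD Z X Y : shift_tr Z (X + Y) = shift_tr Z X + shift_tr Z Y.
Proof. by rewrite /shift_tr shiftD mulmxDl ptrD. Qed.

Lemma shift_trM Z X a : shift_tr Z (X *m a%:M) = shift_tr Z X *m a%:M.
Proof.
rewrite /shift_tr (shiftM GF) (shift_scalar FG) -mulmxA scal_central mulmxA.
have -> : a%:M = emb 2 0 (a%:M : 'M[A]_(tdim N 1)) by rewrite emb_scalar.
by rewrite ptr_mulr // emb_scalar.
Qed.

Lemma sum_scale4 (V : lmodType C) (K : 'I_N -> 'I_N -> 'I_N -> 'I_N -> C) (X : 'I_N -> 'I_N -> V) :
  \sum_i \sum_j \sum_x \sum_y K i j x y *: X y x =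
  \sum_x \sum_y (\sum_i \sum_j K i j x y) *: X y x.
Proof.
under eq_bigr do under eq_bigr do rewrite pair_bigA.
rewrite pair_bigA exchange_big [RHS]pair_bigA; apply: eq_bigr => p _ /=.
by rewrite -scaler_suml pair_bigA.
Qed.

Lemma entry_shift_tr (X : 'M[A]_(tdim N 1)) Z x2 y2 :
  entry (shift_tr Z X) [:: x2] [:: y2] =
  \sum_x \sum_y (\sum_s \sum_t dpsi Psi s t *
    (\sum_p \sum_r (\sum_b e2 F x2 t y b * e2 G x b p r) * e2 Z p r y2 s)) *: entry X [:: y] [:: x].
Proof.
rewrite entry_ptr //.
transitivity (\sum_s \sum_t \sum_p \sum_r \sum_y \sum_b \sum_x
   (dpsi Psi s t * (e2 F x2 t y b * e2 G x b p r * e2 Z p r y2 s)) *: entry X [:: y] [:: x]).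
  rewrite wsum1; apply: eq_bigr => s _; rewrite wsum1; apply: eq_bigr => t _.
  rewrite /dweight /= big_seq1 mxE shift1E !siteE !emb_id.
  rewrite entry_mul // wsum2 scaler_sumr; apply: eq_bigr => p _.
  rewrite scaler_sumr; apply: eq_bigr => r _.
  rewrite -mulmxA entry_mul // wsum2 mulr_suml scaler_sumr; apply: eq_bigr => y _.
  rewrite mulr_suml scaler_sumr; apply: eq_bigr => b _.
  have E : entry (emb 2 0 X *m scal G) [:: y; b] [:: p; r] =
      \sum_x e2 G x b p r *: entry X [:: y] [:: x].
    rewrite -[[:: y; b]]/([::] ++ [:: y] ++ [:: b]) entry_embl // wsum1.
    by apply: eq_bigr => x _; rewrite entry_scal mulr_algr.
  rewrite E mulr_sumr mulr_suml scaler_sumr; apply: eq_bigr => x _.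
  rewrite !entry_scal mulr_algl mulr_algr !scalerA; congr (_ *: _).
  by rewrite /e2; ring.
transitivity (\sum_s \sum_t \sum_x \sum_y (\sum_p \sum_r
    dpsi Psi s t * ((\sum_b e2 F x2 t y b * e2 G x b p r) * e2 Z p r y2 s)) *: entry X [:: y] [:: x]).
  apply: eq_bigr => s _; apply: eq_bigr => t _.
  rewrite -(sum_scale4 _ (fun y x => entry X [:: y] [:: x])).
  apply: eq_bigr => p _; apply: eq_bigr => r _.
  rewrite [RHS]exchange_big; apply: eq_bigr => y _; rewrite exchange_big; apply: eq_bigr => x _.
  by rewrite mulr_suml mulr_sumr scaler_suml.
rewrite (sum_scale4 _ (fun y x => entry X [:: y] [:: x])).
apply: eq_bigr => x _; apply: eq_bigr => y _; congr (_ *: _).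
apply: eq_bigr => s _; apply: eq_bigr => t _.
by rewrite mulr_sumr; apply: eq_bigr => p _; rewrite mulr_sumr.
Qed.

Hypothesis unitDR : mx_dpsi Psi \in unitmx.
Hypothesis unitDF : mx_dpsi Theta \in unitmx.

Lemma phim_kernel X : phim X = 0 -> X = 0.
Proof.
move=> X0; apply: eq_entry => u v; case: u => [|a [|]] // ; case: v => [|c [|]] // _ _.
rewrite entry0.
apply: (conj_kernel R_Psi RRi RiR braidR unitDR F_Theta FG GF braidF unitDF compat1 compat2
  (Z := fun y x => entry X [:: y] [:: x])) => x2 y2.
by rewrite -entry_shift_tr X0 entry0.
Qed.

Let zeta := q - q^-1.

Lemma phi_phim X : phi X = phim X + (zeta%:A * entry (ptr D 0 X) [::] [::])%:M.
Proof.
have E : R = Ri + zeta%:M by rewrite /zeta -heckeR addrC subrK.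
rewrite {1}/shift_tr {1}E.
have -> : scal (site 2 0 (Ri + zeta%:M)) = scal (site 2 0 Ri) + (zeta%:A)%:M.
  rewrite -scal_scalar !siteE !emb_id.
  by rewrite /scal_mx map_mxD.
rewrite mulmxDr ptrD; congr (_ + _).
have -> : (zeta%:A)%:M = emb 2 0 ((zeta%:A)%:M : 'M[A]_(tdim N 1)) by rewrite emb_scalar.
have /= h := ptr_shiftn 1 X.
by rewrite ptr_mulr // h -scalar_mxM mulr_algl mulr_algr.
Qed.

Lemma phi1 : phi 1%:M = 1%:M.
Proof. by rewrite /shift_tr (shift_scalar FG) mul1mx (ptr_site A R_Psi). Qed.

Lemma phim1 : phim 1%:M = ((1 - zeta * \sum_s dpsi Psi s s)%:A)%:M.
Proof.
have := phi_phim 1%:M; rewrite phi1 entry_ptr // wsum1.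
have -> : \sum_i wsum (1 - 0) (fun t => dweight D [:: i] t *:
    entry (1%:M : 'M[A]_(tdim N 1)) ([::] ++ t) ([::] ++ [:: i])) = (\sum_s dpsi Psi s s)%:A.
  rewrite scaler_suml; apply: eq_bigr => s _.
  rewrite wsum1 -(sum_deltar s (fun t => (dpsi Psi s t)%:A)); apply: eq_bigr => t _.
  by rewrite entry_scalar // eqseq_cons andbT /dweight /= big_seq1 mxE scalerMnr.
move/eqP; rewrite -subr_eq => /eqP <-.
by rewrite mulr_algl scalerA scalerBl scale1r raddfB.
Qed.

(* [R = R^-1 + zeta], so [phi X - phim X] is a scalar matrix, while [phi] fixes
   the identity and [phim] is injective. *)
Lemma phi_inj X : phi X = 0 -> X = 0.
Proof.
move=> X0; have := phi_phim X; rewrite X0; move: (_ * _) => c /esym/eqP.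
rewrite addr_eq0 => /eqP Xc; pose b := 1 - zeta * \sum_s dpsi Psi s s.
(* In the first case [phim] kills the identity, so 1 = 0 among these matrices and all of them
   vanish. *)
have [b0|b0] := eqVneq b 0.
  have : 1%:M = 0 :> 'M[A]_(tdim N 1).
    by apply: phim_kernel; rewrite phim1 -/b b0 scale0r raddf0.
  by move=> o; rewrite -[X]mulmx1 o mulmx0.
(* The scalar is chosen so that [phim] kills the sum. Thus [X] is a scalar matrix, and [phi] fixes
   scalar matrices. *)
have XE : X + (b^-1 *: c)%:M = 0.
  apply: phim_kernel; rewrite shift_trD Xc.
  rewrite -[(b^-1 *: c)%:M]mul1mx shift_trM phim1 -/b -scalar_mxM mulr_algl scalerA divff //.
  by rewrite scale1r addNr.
move/eqP: XE; rewrite addr_eq0 => /eqP XE.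
have {}XE : X = 1%:M *m (- (b^-1 *: c))%:M.
  by rewrite XE mul1mx; apply/matrixP => i j; rewrite !mxE mulNrn.
by rewrite XE mul1mx -X0 XE shift_trM phi1 mul1mx.
Qed.

End QuantumPowers.

(** * Representations of the Hecke algebra *)

Section FreeEval.
Variables (K : fieldType) (I : choiceType).
Local Notation T := (free_alg K I).
Local Notation MT := {malg K[{fmonom I}]}.

Definition free_mon (w : {fmonom I}) : T := (<< w >> : MT).

Lemma free_mon_cons i (s : seq I) :
  free_mon (FMonom (i :: s)) = free_gen K i * free_mon (FMonom s).
Proof.
rewrite -[RHS]/(free_mul _ _) free_mulE free_genE malgM_def fgmulUU mulr1; congr (<< _ >>).
by apply/eqP; rewrite -val_eqE /= fmM fmU.
Qed.

Lemma free_mon1 : free_mon (FMonom [::]) = 1.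
Proof.
rewrite -[RHS]/(free_one K I) free_oneE -mpolyC1E; congr (<< _ >>).
by apply/eqP; rewrite -val_eqE /= fm1.
Qed.

Lemma free_span (P : T -> Prop) : P 0 -> (forall x y, P x -> P y -> P (x + y)) ->
  (forall c w, P (c *: free_mon w)) -> forall x, P x.
Proof.
move=> P0 PD PZ x; rewrite -[x]/(x : MT) [x : MT]monalgE.
elim/big_ind: _ => [|y z|w _].
- by move: P0; rewrite -[0 : T]/(free_zero K I) free_zeroE.
- by move=> Py Pz; have := PD _ _ Py Pz; rewrite -[_ + _]/(free_add _ _) free_addE.
have := PZ ((x : MT)@_w) w; rewrite -[_ *: _]/(free_scale _ _) free_scaleE.
suff -> : (x : MT)@_w *: (<< w >> : MT) = << (x : MT)@_w *g w >> by [].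
by apply/malgP => v; rewrite mcoeffZ !mcoeffU mulrnAr mulr1.
Qed.

Lemma free_ind (P : T -> Prop) :
  (forall c : K, P c%:A) -> (forall i, P (free_gen K i)) ->
  (forall x y, P x -> P y -> P (x + y)) -> (forall x y, P x -> P y -> P (x * y)) ->
  forall x, P x.
Proof.
move=> PC PG PD PM x; elim/free_span: x => [|//|c w].
  by rewrite -(scale0r (1 : T)).
rewrite -mulr_algl; apply: (PM) => //.
have -> : w = FMonom (w : seq I) by rewrite fmK.
elim: (w : seq I) => [|i s IH]; last by rewrite free_mon_cons; apply: PM.
by rewrite free_mon1 -(scale1r (1 : T)).
Qed.

Section Eval.
Variables (d : nat) (f : I -> 'M[K]_d).
Local Notation ev := (@free_eval K I d f).
Local Notation h w := (\prod_(i <- (w : {fmonom I})) f i).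

Lemma free_evalEw (D : {fset {fmonom I}}) (x : MT) : (msupp x `<=` D)%fset ->
  ev x = \sum_(w <- D) x@_w *: h w.
Proof.
move=> le; rewrite /free_eval [LHS](big_fset_incl _ le) //= => w wD /mcoeff_outdom ->.
by rewrite scale0r.
Qed.

Lemma free_evalD x y : ev (x + y) = ev x + ev y.
Proof.
rewrite -[x + y]/(free_add x y) free_addE.
pose D := (msupp (x : MT) `|` msupp (y : MT) `|` msupp ((x : MT) + (y : MT)))%fset.
have Dx : (msupp (x : MT) `<=` D)%fset by rewrite /D -fsetUA fsubsetUl.
have Dy : (msupp (y : MT) `<=` D)%fset.
  by rewrite /D (fsetUC (msupp (x : MT))) -fsetUA fsubsetUl.
have Dxy : (msupp ((x : MT) + (y : MT)) `<=` D)%fset by rewrite /D fsubsetUr.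
rewrite (free_evalEw Dx) (free_evalEw Dy) (free_evalEw Dxy).
by rewrite -big_split; apply: eq_bigr => w _; rewrite mcoeffD scalerDl.
Qed.

Lemma free_evalZ c x : ev (c *: x) = c *: ev x.
Proof.
rewrite -[c *: x]/(free_scale c x) free_scaleE (free_evalEw (msuppZ_le _ _)).
by rewrite /free_eval scaler_sumr; apply: eq_bigr => w _; rewrite mcoeffZ scalerA.
Qed.

Lemma free_eval_mon w : ev (free_mon w) = h w.
Proof. by rewrite (free_evalEw (msuppU_le)) big_seq_fset1 mcoeffUU scale1r. Qed.

Lemma free_eval1 : ev 1 = 1.
Proof. by rewrite -free_mon1 free_eval_mon big_nil. Qed.

Lemma free_eval_gen i : ev (free_gen K i) = f i.
Proof. by rewrite free_genE -[<< _ >>]/(free_mon _) free_eval_mon fmU big_seq1. Qed.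

Lemma free_eval0 : ev 0 = 0.
Proof. by rewrite -(scale0r (1 : T)) free_evalZ scale0r. Qed.

(** [free_eval] is a sum over monomials; the left factor is reduced to a generator and the right one
    to a monomial, where the product is a concatenation. *)
Lemma free_evalM x y : ev (x * y) = ev x *m ev y.
Proof.
elim/free_ind: x y => [c|i|x1 x2 IH1 IH2|x1 x2 IH1 IH2] y.
- by rewrite mulr_algl !free_evalZ free_eval1 -scalemxAl mul1mx.
- rewrite free_eval_gen; elim/free_span: y => [|y1 y2 IH1 IH2|c w].
  + by rewrite mulr0 free_eval0 mulmx0.
  + by rewrite mulrDr !free_evalD IH1 IH2 mulmxDr.
  rewrite -scalerAr !free_evalZ -scalemxAr; congr (_ *: _).
  have -> : w = FMonom (w : seq I) by rewrite fmK.
  by rewrite -free_mon_cons !free_eval_mon big_cons.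
- by rewrite mulrDl !free_evalD IH1 IH2 mulmxDl.
by rewrite -mulrA IH1 IH2 IH1 mulmxA.
Qed.

End Eval.
End FreeEval.

(** * The Hecke algebra as a quotient and its representation *)

Section HeckeQuotient.
Variables (C : fieldType) (q : C).
Implicit Types k i j : nat.

(* The strands are numbered from the last one, as in [hecke_y]. *)
Definition hgen k j : hecke q k := hecke_gen q k (k - j.+2).

Local Notation pi k := (quot_pi (@hecke_proper C q k)).

Lemma piM k x y : pi k x * pi k y = pi k (x * y).
Proof. by rewrite rmorphM. Qed.

Lemma piM3 k x y w : pi k x * pi k y * pi k w = pi k (x * y * w).
Proof. by rewrite (piM x y) (piM (x * y) w). Qed.

Lemma hecke_genE k i (ik : (i < k.-1)%N) :
  hecke_gen q k i = quot_pi (@hecke_proper C q k) (free_gen C (Ordinal ik)).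
Proof. by rewrite /hecke_gen insubT. Qed.

Lemma hecke_gen_braid k i : (i.+1 < k.-1)%N ->
  hecke_gen q k i * hecke_gen q k i.+1 * hecke_gen q k i =
  hecke_gen q k i.+1 * hecke_gen q k i * hecke_gen q k i.+1.
Proof.
move=> ik; have ik' : (i < k.-1)%N by lia.
rewrite (hecke_genE ik) (hecke_genE ik') !piM3.
apply/quot_piP/IdealGen; constructor 1; exists (Ordinal ik'), (Ordinal ik).
by split.
Qed.

Lemma hecke_gen_far k i j : (i.+1 < j)%N -> (j < k.-1)%N ->
  hecke_gen q k i * hecke_gen q k j = hecke_gen q k j * hecke_gen q k i.
Proof.
move=> ij jk; have ik : (i < k.-1)%N by lia.
rewrite (hecke_genE ik) (hecke_genE jk) !piM.
apply/quot_piP/IdealGen; constructor 2; exists (Ordinal ik), (Ordinal jk).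
by split.
Qed.

Lemma hecke_gen_quad k i : (i < k.-1)%N ->
  hecke_gen q k i * hecke_gen q k i = 1 + (q - q^-1) *: hecke_gen q k i.
Proof.
move=> ik; rewrite (hecke_genE ik) piM -linearZ -(rmorph1 (pi k)) -rmorphD.
by apply/quot_piP/IdealGen; constructor 3; exists (Ordinal ik).
Qed.

Lemma hgen_family k : hecke_family q k.-1 (hgen k).
Proof.
split=> [i ik|i j ij jk|i ik]; rewrite /hgen.
- have -> : (k - i.+2 = (k - i.+3).+1)%N by lia.
  by rewrite hecke_gen_braid //; lia.
- by rewrite -hecke_gen_far //; lia.
- by rewrite hecke_gen_quad //; lia.
Qed.

Lemma hgen_span k (x : hecke q k) : gen (hgen k) k.-1 x.
Proof.
elim/quot_ind: x => f; elim/free_ind: f => [c|i|x y hx hy|x y hx hy].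
- rewrite linearZ rmorph1; exact: GenC.
- have -> : quot_pi (@hecke_proper C q k) (free_gen C i) = hgen k (k - i.+2).
    rewrite /hgen; have -> : (k - (k - i.+2).+2 = i)%N by have := ltn_ord i; lia.
    by rewrite (hecke_genE (ltn_ord i)); congr (quot_pi _ (free_gen _ _)); exact: val_inj.
  by apply: GenT; have := ltn_ord i; lia.
- by rewrite rmorphD; exact: GenD.
- by rewrite rmorphM; exact: GenM.
Qed.

Lemma hecke_yE k j : hecke_y q k j = jm (hgen k) j.
Proof. by elim: j => // j IH; rewrite /= IH. Qed.

Section Representation.
Variables (N : nat) (R : 'M[C]_(tdim N 2)).
Hypothesis braidR : braided R.
Hypothesis heckeR : R *m R = 1%:M + (q - q^-1) *: R.
Local Notation rho k := (@hecke_rep C N q R k).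
Local Notation ev k := (@free_eval C 'I_k.-1 _ (fun i : 'I_k.-1 => site k i R)).

Lemma site_quad k i : (i + 2 <= k)%N ->
  site k i R *m site k i R = 1%:M + (q - q^-1) *: site k i R.
Proof.
move=> ik; rewrite siteM // heckeR -(@site1 N C k i) //; apply: eq_entry => u v su sv.
by rewrite entryD entryZ !entry_tens // entryD entryZ mulrnDl mulrnAr.
Qed.

Lemma free_eval_hecke k f : ideal_gen (@hecke_rel C q k) f -> ev k f = 0.
Proof.
elim=> [_ [[i [j [ji ->]]]|[i [j [ij ->]]]|[i ->]]||x y _ hx _ hy|a x _ hx|a x _ hx].
- rewrite -scaleN1r free_evalD free_evalZ !free_evalM !free_eval_gen ji scaleN1r.
  by rewrite site_swap' ?subrr //; have := ltn_ord j; lia.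
- rewrite -scaleN1r free_evalD free_evalZ !free_evalM !free_eval_gen scaleN1r.
  by rewrite site_far ?subrr //; have := ltn_ord j; lia.
- rewrite -scaleN1r free_evalD free_evalZ free_evalD free_evalZ !free_evalM !free_eval_gen.
  by rewrite free_eval1 scaleN1r site_quad ?subrr //; have := ltn_ord i; lia.
- exact: free_eval0.
- by rewrite free_evalD hx hy addr0.
- by rewrite free_evalM hx mulmx0.
- by rewrite free_evalM hx mul0mx.
Qed.

(** Independence of the representative: two of them differ by an element of the ideal, which the
    evaluation kills. *)
Lemma rho_pi k f : rho k (quot_pi (@hecke_proper C q k) f) = ev k f.
Proof.
apply/eqP; rewrite -subr_eq0 /hecke_rep -scaleN1r -free_evalZ -free_evalD scaleN1r.
by apply/eqP/free_eval_hecke/repr_quot_pi.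
Qed.

Lemma rhoD k x y : rho k (x + y) = rho k x + rho k y.
Proof.
by elim/quot_ind: x => x; elim/quot_ind: y => y; rewrite -rmorphD !rho_pi free_evalD.
Qed.

Lemma rhoZ k c x : rho k (c *: x) = c *: rho k x.
Proof. by elim/quot_ind: x => x; rewrite -linearZ !rho_pi free_evalZ. Qed.

Lemma rhoM k x y : rho k (x * y) = rho k x *m rho k y.
Proof.
by elim/quot_ind: x => x; elim/quot_ind: y => y; rewrite -rmorphM !rho_pi free_evalM.
Qed.

Lemma rho1 k : rho k 1 = 1%:M.
Proof. by rewrite -(rmorph1 (quot_pi _)) rho_pi free_eval1. Qed.

Lemma rho_gen k i : (i < k.-1)%N -> rho k (hecke_gen q k i) = site k i R.
Proof. by move=> ik; rewrite (hecke_genE ik) rho_pi free_eval_gen. Qed.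

Lemma rho_hgen k j : (j < k.-1)%N -> rho k (hgen k j) = site k (k - j.+2) R.
Proof. by move=> jk; rewrite rho_gen //; lia. Qed.

End Representation.
End HeckeQuotient.

(** * Standard tableaux *)

Section RelatedFamilies.
Variables (C : fieldType) (q : C) (A1 A2 : algType C).
Variable P : A1 -> A2 -> Prop.
Hypothesis PC : forall c : C, P c%:A c%:A.
Hypothesis PD : forall a b a' b', P a a' -> P b b' -> P (a + b) (a' + b').
Hypothesis PM : forall a b a' b', P a a' -> P b b' -> P (a * b) (a' * b').

Let P0 : P 0 0. Proof. by have := PC 0; rewrite !scale0r. Qed.
Let P1 : P 1 1. Proof. by have := PC 1; rewrite !scale1r. Qed.

Lemma horner_alg_related a a' p : P a a' -> P (horner_alg a p) (horner_alg a' p).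
Proof.
move=> Pa; elim/poly_ind: p => [|p c IH].
  by rewrite !rmorph0.
by rewrite !rmorphD !rmorphM /= !horner_algX !horner_algC; apply: PD (PC c); apply: PM.
Qed.

Variables (n : nat) (t1 : nat -> A1) (t2 : nat -> A2).
Hypothesis Pt : forall j, (j < n)%N -> P (t1 j) (t2 j).

Lemma jm_related j : (j <= n)%N -> P (jm t1 j) (jm t2 j).
Proof.
elim: j => [|j IH] jn; first exact: P0.
have Pj := IH ltac:(lia); have Ptj := Pt jn.
by apply: (PD _ Ptj); apply: (PM _ Ptj); exact: PM.
Qed.

(** The relation [P] takes the place of a morphism. In [rho_et_shift] it plays the part of the
    embedding of H_r(q) into H_(j+r)(q), seen on operators. *)
Lemma et_related s : (size s <= n.+1)%N -> P (et q t1 s) (et q t2 s).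
Proof.
elim: s => [|x s IH] sn; first exact: P1.
apply: PM; first by apply: IH => /=; rewrite /= in sn; lia.
by apply/horner_alg_related/jm_related; rewrite /= in sn; lia.
Qed.

End RelatedFamilies.

Section MatrixUnits.
Variables (C : fieldType) (q : C).
Hypothesis q_neq0 : q != 0.
Hypothesis qnum_neq0 : forall k : nat, (0 < k)%N -> qnum q k != 0.

(* If the idempotent vanished, [munit] would take its default value 0. *)
Lemma munitE k t : (0 < k)%N -> size t = k -> rtab (rev t) ->
  munit q k t = et q (hgen q k) (rev t).
Proof.
move=> k0 st ht_t; have fam := hgen_family q k.
have sz : size (rev t) = k.-1.+1 by rewrite size_rev st prednK.
have uniq_e e : @munit_spec C q k t e -> e = et q (hgen q k) (rev t).
  move=> [e0 ee eE]; apply: (et_unique q_neq0 qnum_neq0 fam) => //.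
  - exact: hgen_span.
  - apply/(eigP q_neq0 qnum_neq0 fam) => j; rewrite sz prednK // revK => jk.
    by rewrite -hecke_yE; exact: (eE j jk).1.
  - apply/(eigrPn q_neq0 qnum_neq0 fam) => j; rewrite sz prednK // revK => jk.
    by rewrite -hecke_yE; exact: (eE j jk).2.
have [e0|e0] := eqVneq (et q (hgen q k) (rev t)) 0.
  rewrite /munit e0; apply: xgetPN => e spec_e.
  by have [/eqP] := spec_e; rewrite (uniq_e e spec_e).
apply: uniq_e; rewrite /munit; apply: (xgetI _ (x := et q (hgen q k) (rev t))).
split=> // [|j jk]; first by apply: (idemT q_neq0 qnum_neq0 fam) => //; rewrite sz.
have E := (eigT q_neq0 qnum_neq0 fam ht_t ltac:(by rewrite sz)).
have E' := (eigrT q_neq0 qnum_neq0 fam ht_t ltac:(by rewrite sz)).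
move/(eigP q_neq0 qnum_neq0 fam)/(_ j): E; move/(eigrPn q_neq0 qnum_neq0 fam)/(_ j): E'.
rewrite sz prednK // revK hecke_yE => E' E.
by split; [exact: E|exact: E'].
Qed.

End MatrixUnits.

Section StandardTableaux.
Implicit Types (lam : seq nat) (t : seq (nat * nat)).

Lemma mem_cells lam i j : ((i, j) \in cells lam) = (j < nth 0 lam i)%N.
Proof.
apply/allpairsPdep/idP => [[r [c []]]|jl].
  rewrite !mem_iota /= !add0n => rl cl [-> ->] //.
have il : (i < size lam)%N.
  by case: ltnP => // li; move: jl; rewrite nth_default.
by exists i, j; rewrite !mem_iota.
Qed.

Lemma size_cells lam : size (cells lam) = sumn lam.
Proof.
rewrite /cells size_allpairs_dep; congr sumn.
apply: (@eq_from_nth _ 0%N); rewrite size_map size_iota // => i il.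
by rewrite (nth_map 0%N) ?size_iota // nth_iota // size_iota.
Qed.

Lemma cells_uniq lam : uniq (cells lam).
Proof. by apply: allpairs_uniq_dep => //=; [exact: iota_uniq|move=> *; exact: iota_uniq|case=> a b [c d] _ _ /= [-> ->]]. Qed.

Lemma partition_nth lam i : is_partition lam -> (nth 0 lam i.+1 <= nth 0 lam i)%N.
Proof.
move=> /andP[h _]; have [il|il] := ltnP i.+1 (size lam); last by rewrite nth_default.
have tr : transitive geq by move=> y x z xy yz; exact: leq_trans yz xy.
by apply: (sorted_ltn_nth tr 0%N h) (ltnSn i); rewrite inE //; lia.
Qed.

Lemma std_tableau_rtab lam t : is_partition lam -> is_std_tableau lam t -> rtab (rev t).
Proof.
move=> lamP /andP[tc /allP ord].
have ut : uniq t by rewrite (perm_uniq tc) cells_uniq.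
have mt x : (x \in t) = (x.2 < nth 0 lam x.1)%N by rewrite (perm_mem tc); case: x => i j; rewrite mem_cells.
suff h i : (i <= size t)%N -> rtab (rev (take i t)) by rewrite -[t]take_size h.
elim: i => [|i IH] it; first by rewrite take0.
rewrite (take_nth (0, 0)%N) // rev_rcons /= IH ?andbT; last by lia.
set x := nth _ t i; have xt : x \in t by exact: mem_nth.
have ix : index x t = i by rewrite index_uniq.
(* Standardness places the nodes above and to the left of [x] earlier in [t], hence in the
   prefix. *)
have pre y : y \in t -> (index y t < i)%N -> y \in rev (take i t).
  move=> yt yi; rewrite mem_rev -[y](nth_index (0, 0)%N yt) -(nth_take (0,0)%N yi).
  by apply: mem_nth; rewrite size_take it.
apply/and3P; split.
- rewrite mem_rev; apply/negP => /(nthP (0, 0)%N) [j]; rewrite size_take it => ji.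
  rewrite nth_take // => e; have : index x t = j by rewrite -e index_uniq // (ltn_trans ji it).
  by move=> ij; move: ji; rewrite -ij ix ltnn.
- case x1 : x.1 => [|r] //=; have yt : (r, x.2) \in t.
    rewrite mt /=; apply: leq_trans (partition_nth _ lamP).
    by rewrite -x1 -mt.
  apply: pre => //; rewrite -ix; have /allP/(_ x xt) := ord _ yt.
  by move=> /implyP; apply; rewrite x1 /= eqxx leqnn orbT.
- case x2 : x.2 => [|r] //=; have yt : (x.1, r) \in t.
    by rewrite mt /=; move: xt; rewrite mt x2; exact: ltnW.
  apply: pre => //; rewrite -ix; have /allP/(_ x xt) := ord _ yt.
  by move=> /implyP; apply; rewrite x2 /= eqxx leqnn.
Qed.

End StandardTableaux.

Section HookShapes.
Local Open Scope nat_scope.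
Variables m n : nat.
Hypothesis n_gt0 : (0 < n)%N.

Lemma LambdaE k l : Lambda m n k l = nseq k n.+1 ++ nseq (m - k) n ++ nseq (l != 0)%N l.
Proof.
rewrite /Lambda !filter_cat; congr (_ ++ (_ ++ _)).
- by apply/all_filterP; rewrite all_nseq orbT.
- by apply/all_filterP; rewrite all_nseq -lt0n n_gt0 orbT.
by case: l.
Qed.

Lemma Lambda_neq0 k l : (0 < m)%N -> (k <= m)%N -> Lambda m n k l != [::].
Proof.
rewrite LambdaE => m0 km; rewrite -size_eq0 !size_cat !size_nseq; lia.
Qed.

Lemma sumn_Lambda k l : (k <= m)%N -> sumn (Lambda m n k l) = (m * n + k + l)%N.
Proof. by move=> km; rewrite LambdaE !sumn_cat !sumn_nseq; case: l => [|l] /=; nia. Qed.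

Lemma nth_Lambda k l i : (k <= m)%N -> (l <= n)%N -> nth 0 (Lambda m n k l) i =
  (if i < k then n.+1 else if i < m then n else if i == m then l else 0)%N.
Proof.
move=> km ln; rewrite LambdaE !nth_cat !nth_nseq !size_nseq.
case: ltnP => // ki; have -> : (i - k < m - k)%N = (i < m)%N by lia.
case: ltnP => // mi; have -> : (i - k - (m - k) = i - m)%N by lia.
by case: l ln => [|l] ln /=; rewrite ?if_same // ltnS leqn0 subn_eq0 eqn_leq mi andbT.
Qed.

Lemma Lambda_partition k l : (k <= m)%N -> (l <= n)%N -> is_partition (Lambda m n k l).
Proof.
move=> km ln; apply/andP; split; last by rewrite mem_filter eqxx.
apply: sorted_filter => [y x z /= xy yz|]; first exact: leq_trans yz xy.
apply/(sortedP 0%N) => i _.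
have nE r : nth 0 (nseq k n.+1 ++ nseq (m - k) n ++ [:: l]) r =
    (if r < k then n.+1 else if r < m then n else if r == m then l else 0)%N.
  rewrite !nth_cat !nth_nseq !size_nseq.
  case: ltnP => // kr; have -> : (r - k < m - k)%N = (r < m)%N by lia.
  case: ltnP => // mr; have -> : (r - k - (m - k) = r - m)%N by lia.
  by rewrite eqn_leq mr andbT -subn_eq0; case: (r - m)%N => //= ?; rewrite nth_nil.
by rewrite /= !nE; do ?[case: ifP => ?]; lia.
Qed.

Lemma mem_Lambda k l i j : (k <= m)%N -> (l <= n)%N ->
  ((i, j) \in cells (Lambda m n k l)) =
  [|| (i < m)%N && (j < n)%N, (j == n) && (i < k)%N | (i == m) && (j < l)%N].
Proof.
move=> km ln; rewrite mem_cells nth_Lambda //.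
by do ?[case: ifP => ?]; lia.
Qed.

(** The corner [(m, n)] ends both its row and its column, so it can carry the last number. *)
Lemma rect_std_tableau t : is_std_tableau (Lambda m n m n) t ->
  is_std_tableau (nseq m.+1 n.+1) (rcons t (m, n)).
Proof.
move=> /andP[tc /allP ord].
have mt i j : ((i, j) \in t) = [|| (i < m)%N && (j < n)%N, (j == n) && (i < m)%N | (i == m) && (j < n)%N].
  by rewrite (perm_mem tc) mem_Lambda.
have tn : (m, n) \notin t by rewrite mt !ltnn !andbF.
have ut : uniq t by rewrite (perm_uniq tc) cells_uniq.
apply/andP; split.
  apply: uniq_perm; rewrite ?cells_uniq ?rcons_uniq ?tn //.
  move=> [i j]; rewrite mem_rcons inE mt mem_cells nth_nseq xpair_eqE.
  by case: ifP => ?; lia.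
have ix x : index x (rcons t (m, n)) = if x \in t then index x t else (size t + (x != (m, n)))%N.
  rewrite -cats1 index_cat; case: ifP => //= _; congr addn.
  by rewrite (eq_sym (m, n)); case: eqP.
apply/allP => -[i j] ht_x; apply/allP => -[i' j'] ht_y; rewrite !ix.
case: ifP => xt.
  case: ifP => yt; first by have /allP/(_ _ yt) := ord _ xt.
  by apply/implyP => _; rewrite (leq_trans _ (leq_addr _ _)) // index_mem.
move: ht_x ht_y; rewrite !mem_rcons !inE xt orbF => /eqP [-> ->].
move=> /orP[/eqP [-> ->]|yt]; first by rewrite !ltnn !andbF.
by move: yt (yt); rewrite {1}mt => h ->; apply/implyP => /= h2; exfalso; move: h h2 => /=; lia.
Qed.

End HookShapes.

(** * The Cayley-Hamilton identity *)

Section CayleyHamilton.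
Variables (C : fieldType) (q : C).
Hypothesis q_neq0 : q != 0.
Hypothesis qnum_neq0 : forall k : nat, (0 < k)%N -> qnum q k != 0.
Variables (A : algType C) (N : nat).
Variables (R Ri Psi F G Theta : 'M[C]_(tdim N 2)).
Hypotheses (R_Psi : skew_inverse R Psi) (RRi : R *m Ri = 1%:M) (RiR : Ri *m R = 1%:M).
Hypothesis braidR : braided R.
Hypothesis unitDR : mx_dpsi Psi \in unitmx.
Hypotheses (F_Theta : skew_inverse F Theta) (FG : F *m G = 1%:M) (GF : G *m F = 1%:M).
Hypothesis braidF : braided F.
Hypothesis unitDF : mx_dpsi Theta \in unitmx.
Hypothesis compat1 : slides_down R F.
Hypothesis compat2 : slides_up R F.
Hypothesis heckeR : R - Ri = (q - q^-1)%:M.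
Hypothesis R_quad : R *m R = 1%:M + (q - q^-1) *: R.
Variable M : 'M[A]_N.
Hypothesis RMM : scal_mx A (site 2 0 R) *m mcopy F M 2 0 *m mcopy F M 2 1 =
  mcopy F M 2 0 *m mcopy F M 2 1 *m scal_mx A (site 2 0 R).

Local Notation scal := (scal_mx A).
Local Notation rho k := (@hecke_rep C N q R k).
Local Notation mcopies := (mcopies F M).
Local Notation shift := (@shift C A N F G _).
Local Notation D := (mx_dpsi Psi).
Local Notation phi := (shift_tr Psi F G R).
Local Notation qpow := (qpow R Psi F M).

Lemma entry_scalar_mulr k (Y : 'M[A]_(tdim N k)) a u v : size u = k -> size v = k ->
  entry (Y *m a%:M) u v = entry Y u v * a.
Proof.
move=> su sv; rewrite entry_mul // -(wsum_delta (fun w => entry Y u w * a) sv).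
by apply: eq_wsum => w sw; rewrite entry_scalar // mulrnAr eq_sym.
Qed.

Section Functional.
Variables (p : nat) (a b : 'I_N).

(** One entry of psi(x), at fixed indices of the untraced first factor; its values lie in [A], a
    module over [C] as [hook_sum] requires. *)
Definition qtrace (x : hecke q p.+1) : A :=
  entry (ptr D 1 (shift (mcopies p) *m scal (rho p.+1 x))) [:: a] [:: b].

Lemma qtrace_linear : linear qtrace.
Proof.
move=> c x y; rewrite /qtrace (rhoD braidR R_quad) (rhoZ braidR R_quad).
rewrite /scal_mx map_mxD -!/(scal_mx _ _) mulmxDr ptrD entryD; congr (_ + _).
rewrite -mul_scalar_mx scal_mul scal_scalar scal_central mulmxA.
have -> : (c%:A)%:M = emb p.+1 0 ((c%:A)%:M : 'M[A]_(tdim N 1)) by rewrite emb_scalar.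
by rewrite ptr_mulr // entry_scalar_mulr // mulr_algr.
Qed.

Lemma qtraceC x y : gen (hgen q p.+1) p.-1 x -> qtrace (x * y) = qtrace (y * x).
Proof.
move=> gx; rewrite /qtrace !(rhoM braidR R_quad) !scal_mul !mulmxA; congr (entry _ _ _).
move: (rho p.+1 y) => V; elim: gx V => [c|i ip|x1 x2 _ IH1 _ IH2|x1 x2 _ IH1 _ IH2] V.
- rewrite (rhoZ braidR R_quad) (rho1 braidR R_quad) -mul_scalar_mx mulmx1 scal_scalar.
  by rewrite -!mulmxA scal_central.
(* These generators are R_2, ..., R_p. They act on traced factors only, so [ptr_cyc] applies, and
   they commute with M_2 ... M_(p+1), the shift of M_1 ... M_p. *)
- rewrite (rho_hgen braidR R_quad); last by rewrite /=; lia.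
  have [l lp ->] : exists2 l, (l + 2 <= p)%N & (p.+1 - i.+2 = l.+1)%N.
    by exists (p.+1 - i.+3)%N; lia.
  have lp1 : (l.+1 + 2 <= p.+1)%N by rewrite addSn.
  rewrite (ptr_cyc R_Psi RRi RiR braidR _ (ltn0Sn l) lp1).
  have S := shift_site A FG lp compat2; congr (ptr _ _ _); rewrite mulmxA; congr (_ *m _).
  by rewrite -S -!(shiftM GF) (site_mcopies FG GF braidF compat1 compat2 RMM).
- rewrite (rhoD braidR R_quad) /scal_mx map_mxD -!/(scal_mx _ _).
  by rewrite !mulmxDr mulmxDl !ptrD IH1 IH2.
rewrite (rhoM braidR R_quad) !scal_mul !mulmxA.
have := IH2 (V *m rho p.+1 x1); rewrite scal_mul !mulmxA => <-.
have := IH1 (rho p.+1 x2 *m V); rewrite scal_mul !mulmxA => ->.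
by rewrite -!mulmxA.
Qed.

End Functional.

Lemma descent_rprod r j : rho (j + r).+1 (descent (j + r) (hgen q (j + r).+1) r) =
  emb (j.+1 + r) 0 (rprod R j).
Proof.
rewrite /descent (big_morph (rho _) (rhoM braidR R_quad (k := _)) (rho1 braidR R_quad _)).
rewrite /rprod (big_morph (@emb N C (j.+1 + r) 0 j.+1) (id1 := 1) (op1 := *%R)); first last.
- by rewrite -[1]/1%:M emb_scalar ?leq_addr.
- by move=> X Y; rewrite -[_ * _]/(_ *m _) -emb_mul ?leq_addr.
have -> : rev (iota 0 j) = [seq (j + r).+1 - i.+2 | i <- iota r j]%N.
  apply: (@eq_from_nth _ 0%N); rewrite size_rev size_iota ?size_map ?size_iota // => i ij.
  by rewrite nth_rev ?size_iota // nth_iota ?(nth_map 0%N) ?size_iota ?nth_iota //; lia.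
rewrite big_map /index_iota addnK big_seq [RHS]big_seq; apply: eq_bigr => i.
rewrite mem_iota => ir; rewrite (rho_hgen braidR R_quad) ?site_emb //; lia.
Qed.

Lemma rho_et_shift r j s : (size s <= r)%N -> (0 < r)%N ->
  scal (rho (j + r) (et q (hgen q (j + r)) s)) = shiftn F G j (scal (rho r (et q (hgen q r) s))).
Proof.
move=> sr r0.
apply: (@et_related _ q _ _ (fun x y => scal (rho (j + r) x) = shiftn F G j (scal (rho r y))) _ _ _ r.-1).
- move=> c; rewrite !(rhoZ braidR R_quad) !(rho1 braidR R_quad) -!mul_scalar_mx !mulmx1.
  by rewrite !scal_scalar (shiftn_scalar FG).
- move=> x y x' y' h h'; rewrite !(rhoD braidR R_quad).
  rewrite /scal_mx !map_mxD -!/(scal_mx _ _) h h'.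
  by elim: (j) => //= i <-; rewrite shiftD.
- by move=> x y x' y' h h'; rewrite !(rhoM braidR R_quad) !scal_mul h h' (shiftnM GF).
- move=> i ir; rewrite !(rho_hgen braidR R_quad) //; last by lia.
  rewrite (shiftn_site A FG compat2); last by lia.
  by congr (scal (site _ _ _)); lia.
by rewrite prednK.
Qed.

Lemma qtrace_descent p r j s a b : p = (j + r)%N -> size s = r -> (0 < r)%N ->
  qtrace a b (et q (hgen q p.+1) s * descent p (hgen q p.+1) r) =
  entry (phi (qpow j)) [:: a] [:: b] *
    entry (ptr D 0 (mcopies r *m scal (rho r (et q (hgen q r) s)))) [::] [::].
Proof.
move=> -> sr r0; rewrite /qtrace (rhoM braidR R_quad) scal_mul descent_rprod scal_emb mulmxA.
have -> := @rho_et_shift r j.+1 s _ r0; last by rewrite sr.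
rewrite (ptr_mcopies_split R_Psi FG GF braidF compat2) (phi_qpow R_Psi FG GF compat2).
by rewrite entry_scalar_mulr.
Qed.

Variables m n : nat.
Hypotheses (m_gt0 : (0 < m)%N) (n_gt0 : (0 < n)%N).
Variable alpha : seq nat -> seq (nat * nat).
Hypothesis alpha_std : forall lam, is_partition lam -> is_std_tableau lam (alpha lam).
Let p := (m * n + m + n)%N.
Hypothesis rho_rect : forall t, is_std_tableau (nseq m.+1 n.+1) t ->
  rho p.+1 (munit q p.+1 t) = 0.

Definition hook_schur k l : A :=
  let r := (m * n + k + l)%N in
  entry (ptr D 0 (mcopies r *m scal (rho r (munit q r (alpha (Lambda m n k l)))))) [::] [::].

Lemma size_alpha lam : is_partition lam -> size (alpha lam) = sumn lam.
Proof. by move=> /alpha_std /andP[/perm_size -> _]; rewrite size_cells. Qed.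

Lemma rect_partition : is_partition (nseq m.+1 n.+1).
Proof.
apply/andP; split; last by rewrite mem_nseq.
apply/(sortedP 0%N) => i; rewrite size_nseq => im.
by rewrite !nth_nseq im (ltnW im) /=.
Qed.

Lemma sum_phi_entries a b :
  \sum_(k < m.+1) \sum_(l < n.+1) ((-1) ^+ k * q ^ (k%:Z - l%:Z)) *:
    (entry (phi (qpow (m + n - k - l))) [:: a] [:: b] * hook_schur k l) = 0.
Proof.
have fam : hecke_family q p (hgen q p.+1) := hgen_family q p.+1.
pose psi : {linear hecke q p.+1 -> A} :=
  HB.pack (@qtrace p a b) (GRing.isLinear.Build C _ A *:%R _ (@qtrace_linear p a b)).
pose S k l := rev (alpha (Lambda m n k l)).
have LP k l := @Lambda_partition m n n_gt0 k l.
have S_rtab k l : (k <= m)%N -> (l <= n)%N -> rtab (S k l).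
  by move=> km ln; apply: std_tableau_rtab (LP k l km ln) (alpha_std (LP k l km ln)).
have S_size k l : (k <= m)%N -> (l <= n)%N -> size (S k l) = (m * n + k + l)%N.
  by move=> km ln; rewrite size_rev size_alpha ?sumn_Lambda //; exact: LP.
have S_mem k l i j : (k <= m)%N -> (l <= n)%N -> ((i, j) \in S k l) =
    [|| (i < m)%N && (j < n)%N, (j == n) && (i < k)%N | (i == m) && (j < l)%N].
  move=> km ln; rewrite mem_rev -(mem_Lambda n_gt0 i j km ln).
  by have /andP[/perm_mem -> _] := alpha_std (LP k l km ln).
have psi_rect : psi (et q (hgen q p.+1) ((m, n) :: S m n)) = 0.
  have std := rect_std_tableau n_gt0 (alpha_std (LP m n (leqnn m) (leqnn n))).
  rewrite -rev_rcons -munitE ?std_tableau_rtab ?rect_partition //; last first.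
  - exact: (std_tableau_rtab rect_partition std).
  - by rewrite size_rcons -size_rev S_size // /p; lia.
  rewrite /psi /= /qtrace rho_rect //.
  by have := linear0 psi; rewrite /psi /= /qtrace -(scale0r (0 : hecke q p.+1)) (rhoZ braidR R_quad) scale0r.
have psiC x y : gen (hgen q p.+1) p.-1 x -> psi (x * y) = psi (y * x) := @qtraceC p a b x y.
have := hook_sum q_neq0 qnum_neq0 fam psiC m_gt0 n_gt0 S_rtab S_mem S_size erefl psi_rect.
move=> h; rewrite -[RHS]h; apply: eq_bigr => k _; apply: eq_bigr => l _.
have km : (k <= m)%N := ltn_ord k; have ln : (l <= n)%N := ltn_ord l.
have r0 : (0 < m * n + k + l)%N by rewrite -addnA addn_gt0 muln_gt0 m_gt0 n_gt0.
have pE : p = ((m + n - k - l) + (m * n + k + l))%N by rewrite /p; lia.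
congr (_ *: _); rewrite S_size // -[psi _]/(qtrace a b _).
rewrite (qtrace_descent a b pE (S_size k l km ln) r0) /hook_schur munitE ?S_rtab //.
by rewrite size_alpha ?sumn_Lambda //; exact: LP.
Qed.

Lemma cayley_hamilton : \sum_(k < m.+1) \sum_(l < n.+1)
  qpow (m + n - k - l) *m (((-1) ^+ k * q ^ (k%:Z - l%:Z)) *: hook_schur k l)%:M = 0.
Proof.
apply: (phi_inj R_Psi RRi RiR braidR F_Theta FG GF braidF compat1 compat2 heckeR unitDR unitDF).
have phi0 : phi (0 : 'M[A]_(tdim N 1)) = 0.
  by apply: (addIr (phi 0)); rewrite -shift_trD !add0r.
rewrite (big_morph phi (shift_trD Psi F G R) phi0).
under eq_bigr do rewrite (big_morph phi (shift_trD Psi F G R) phi0).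
apply: eq_entry => u v; case: u => [|a [|]] // ; case: v => [|b [|]] // _ _.
rewrite entry0 (big_morph (fun X : 'M[A]_(tdim N 1) => entry X [:: a] [:: b])
  (fun X Y => entryD X Y [:: a] [:: b]) (entry0 _ _ _ _)).
rewrite -[RHS](sum_phi_entries a b); apply: eq_bigr => k _.
rewrite (big_morph (fun X : 'M[A]_(tdim N 1) => entry X [:: a] [:: b])
  (fun X Y => entryD X Y [:: a] [:: b]) (entry0 _ _ _ _)).
apply: eq_bigr => l _.
by rewrite (shift_trM Psi FG GF) entry_scalar_mulr // scalerAr.
Qed.

End CayleyHamilton.

(** * Transfer to the definitions of the theorem *)

Lemma sum_diagonals (V : nmodType) (m n : nat) (f : nat -> nat -> V) :
  \sum_(i < (m + n).+1) \sum_(i - n <= k < (minn i m).+1) f k (i - k)%N =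
  \sum_(k < m.+1) \sum_(l < n.+1) f k l.
Proof.
transitivity (\sum_(i < (m + n).+1) \sum_(k < m.+1 | (i - n <= k <= i)%N) f k (i - k)%N).
  apply: eq_bigr => i _; rewrite (big_nat_widenl _ 0%N) // (big_nat_widen _ _ m.+1) ?big_mkord.
    by apply: eq_bigl => k; have := ltn_ord k; lia.
  by rewrite ltnS geq_minr.
rewrite (exchange_big_dep xpredT) //=; apply: eq_bigr => k _.
rewrite -(big_mkord (fun i => (i - n <= k <= i)%N) (fun i => f k (i - k)%N)).
rewrite -(big_mkord xpredT (f k)).
transitivity (\sum_(0 + k <= i < n.+1 + k) f k (i - k)%N); last first.
  by rewrite big_addn addnK; apply: eq_bigr => i _; rewrite addnK.
rewrite [RHS](big_nat_widenl _ 0%N) // [RHS](big_nat_widen _ _ (m + n).+1); last first.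
  by have := ltn_ord k; lia.
by apply: eq_bigl => i; lia.
Qed.

Section PowersAndSchur.
Variables (C : fieldType) (A : algType C) (N : nat) (R F : 'M[C]_(tdim N 2)) (M : 'M[A]_N).

Lemma mpowerE Psi j a b : Dmx R = mx_dpsi Psi ->
  mpower R F M j a b = entry (qpow R Psi F M j) [:: a] [:: b].
Proof.
move=> DE; case: j => [|[|j]] /=.
- by rewrite entry_scalar // eqseq_cons andbT mxE.
- by rewrite /rprod big_nil scal1 mulmx1 ptr_id /mcopies big_ord_recl big_ord0 mulr1 entry_tens.
by rewrite mxE entry_tens // DE.
Qed.

Lemma schurE Psi (q : C) alpha lam r : Dmx R = mx_dpsi Psi -> lam != [::] -> sumn lam = r ->
  schur q R F M alpha lam =
  entry (ptr (mx_dpsi Psi) 0 (mcopies F M r *m scal_mx A (hecke_rep R (munit q r (alpha lam))))) [::] [::].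
Proof.
move=> DE; case: lam => // x lam _ <-.
by rewrite entry_tens // /schur DE subn0.
Qed.

End PowersAndSchur.

Lemma map_scal_mx (C : fieldType) (A B : algType C) (f : {lrmorphism A -> B}) d (X : 'M[C]_d) :
  map_mx f (scal_mx A X) = scal_mx B X.
Proof. by apply/matrixP => i j; rewrite !mxE linearZ rmorph1. Qed.

Lemma map_mcopy (C : fieldType) (A B : algType C) (f : {lrmorphism A -> B}) N
    (F : 'M[C]_(tdim N 2)) (M : 'M[A]_N) k j :
  map_mx f (mcopy F M k j) = mcopy F (map_mx f M) k j.
Proof.
elim: j => [|j IH] /=; last by rewrite !map_mxM /= !map_scal_mx IH.
apply/matrixP => a b; rewrite !mxE.
case: (word a) (word b) => [|x u] [|y v]; rewrite ?rmorph0 //.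
by rewrite rmorphMn mxE.
Qed.

Lemma qma_relation (C : fieldType) N (R F : 'M[C]_(tdim N 2)) (M := qma_mx R F) :
  scal_mx _ (site 2 0 R) *m mcopy F M 2 0 *m mcopy F M 2 1 =
  mcopy F M 2 0 *m mcopy F M 2 1 *m scal_mx _ (site 2 0 R).
Proof.
pose f : {lrmorphism free_alg C ('I_N * 'I_N)%type -> qma R F} := quot_pi (@qma_proper C N R F).
pose M0 : 'M[free_alg C ('I_N * 'I_N)%type]_N := \matrix_(i, j) free_gen C (i, j).
have -> : M = map_mx f M0 by apply/matrixP => i j; rewrite !mxE.
rewrite -!map_mcopy -!(map_scal_mx f) -!map_mxM; apply/matrixP => a b; rewrite [LHS]mxE [RHS]mxE.
apply/quot_piP/IdealGen; exists a, b; by rewrite [RHS]mxE [X in _ = _ + X]mxE.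
Qed.

Lemma hecke_square (C : fieldType) d (q : C) (X : 'M[C]_d) : q != 0 ->
  (X - q%:M) *m (X + (q^-1)%:M) = 0 -> X *m X = 1%:M + (q - q^-1) *: X.
Proof.
move=> q0; rewrite mulmxDr !mulmxBl !mul_scalar_mx mul_mx_scalar scale_scalar_mx divff //.
move: (X *m X) => XX /matrixP h; apply/matrixP => i j; have := h i j; rewrite !mxE => hij.
by apply/eqP; rewrite -subr_eq0; apply/eqP; rewrite -hij; ring.
Qed.

Lemma hecke_inverse (C : fieldType) d (q : C) (X : 'M[C]_d) :
  X *m X = 1%:M + (q - q^-1) *: X -> X - invmx X = (q - q^-1)%:M.
Proof.
move=> XX; have XV : X *m (X - (q - q^-1)%:M) = 1%:M by rewrite mulmxBr XX mul_mx_scalar addrK.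
have -> : invmx X = X - (q - q^-1)%:M by rewrite -[RHS](mulKmx (mulmx1_unit XV).1) XV mulmx1.
by rewrite opprB addrC subrK.
Qed.

(** [Dmx] is computed from a chosen skew inverse, so [Psi] has to be that choice. *)
Lemma strict_skew_inverse (C : fieldType) N (X : 'M[C]_(tdim N 2)) :
  strictly_skew_invertible X -> exists Psi,
    [/\ skew_inverse X Psi, Dmx X = mx_dpsi Psi & mx_dpsi Psi \in unitmx].
Proof.
move=> [[Psi XPsi] DX]; exists (xget 0 (skew_inverse X)).
have E : Dmx X = mx_dpsi (xget 0 (skew_inverse X)) by apply/matrixP => i j; rewrite !mxE.
by rewrite -E; split=> //; exact: xgetI XPsi.
Qed.

Theorem theorem10 (K : realType) (q : complex K) (q_neq0 : q != 0)
    (qnum_neq0 : forall k : nat, (0 < k)%N -> qnum q k != 0)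
    (m n : nat) (m_ge1 : (1 <= m)%N) (n_ge1 : (1 <= n)%N)
    (N : nat) (R F : 'M[complex K]_(tdim N 2))
    (R_Rmatrix : is_Rmatrix R) (F_Rmatrix : is_Rmatrix F)
    (RF_compatible : compatible R F)
    (R_strict : strictly_skew_invertible R)
    (F_strict : strictly_skew_invertible F)
    (Rf_skew : skew_invertible (invmx F *m invmx R *m F))
    (R_GL : is_GL_type q m n R)
    (alpha : seq nat -> seq (nat * nat))
    (alpha_std : forall lam, is_partition lam -> is_std_tableau lam (alpha lam)) :
  let M := qma_mx R F in
  \sum_(i < (m + n).+1)
    map_mx (fun x => x *
        \sum_(i - n <= k < (minn i m).+1)
          ((-1) ^+ k * q ^ ((2 * k)%:Z - i%:Z)) *:
            schur q R F M alpha (Lambda m n k (i - k)))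
      (mpower R F M (m + n - i)) = 0.
Proof.
move=> M; apply/matrixP => a b; rewrite mxE summxE.
have [Psi [R_Psi DR uDR]] := strict_skew_inverse R_strict.
have [Theta [F_Theta _ uDF]] := strict_skew_inverse F_strict.
have [uR braidR] := R_Rmatrix; have [uF braidF] := F_Rmatrix.
have [compat1 compat2] := RF_compatible.
have [[_ heckeR] _ rect _] := R_GL.
have R_quad := hecke_square q_neq0 heckeR.
have KE : (m.+1 * n.+1)%N = (m * n + m + n).+1 by lia.
rewrite KE in rect.
have CH := cayley_hamilton q_neq0 qnum_neq0 R_Psi (mulmxV uR) (mulVmx uR) braidR uDR
  F_Theta (mulmxV uF) (mulVmx uF) braidF uDF compat1 compat2 (hecke_inverse R_quad) R_quad
  (@qma_relation _ N R F) m_ge1 n_ge1 alpha_std rect.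
have := congr1 (fun X => entry X [:: a] [:: b]) CH; rewrite entry0 => CH0.
apply: (etrans _ CH0); pose e := fun X : 'M[qma R F]_(tdim N 1) => entry X [:: a] [:: b].
have eD X Y : e (X + Y) = e X + e Y by exact: entryD.
have e0 : e 0 = 0 by exact: entry0.
rewrite -[RHS]/(e _) (big_morph e eD e0).
under [RHS]eq_bigr do rewrite (big_morph e eD e0).
pose f k l := e (qpow R Psi F M (m + n - (k + l))) * (((-1) ^+ k * q ^ (k%:Z - l%:Z)) *:
  schur q R F M alpha (Lambda m n k l)).
transitivity (\sum_(k < m.+1) \sum_(l < n.+1) f k l); last first.
  apply: eq_bigr => k _; apply: eq_bigr => l _; rewrite /f.
  have km : (k <= m)%N := ltn_ord k.
  rewrite /e entry_scalar_mulr // subnDA; congr (_ * (_ *: _)).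
  by apply: schurE => //; [exact: Lambda_neq0|exact: sumn_Lambda].
rewrite -sum_diagonals; apply: eq_bigr => i _.
rewrite mxE (mpowerE _ _ _ _ _ DR) mulr_sumr; apply: eq_big_nat => k /andP[_ ki].
(* With [l = i - k] the exponent [2k - i] becomes [k - l]. *)
have ik : (k + (i - k) = i)%N by move: ki; lia.
rewrite /f ik; congr (_ * (_ * q ^ _ *: _)).
by rewrite -{1}ik; lia.
Qed.
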